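(* For all $m,n\ge1$ we have $g^{(m)}_{m^{n-1},m-1}(q,t,0)=C_n^{(m)}(q,t)$, the higher $q,t$-Catalan polynomial, where $(m^{n-1},m-1)$ denotes the sequence of length $n$ with $n-1$ entries $m$ followed by $m-1$.
   Context: The $g_v=g_v^{(m)}(q,t,a)\in\mathbb Z[q,t,a,(1-q)^{-1}]$, indexed by finite sequences $v$ with entries in $\{0,\dots,m\}$, are defined by the recursion (commas denote concatenation): $g_\emptyset=1$, $g_0=1+a$; $g_{0,v}=(t^{\#\{i:v_i<m\}}+a)g_v$ if $0\le v_1\le m-1$; $g_{0,m,v}=t^{\#\{i:v_i<m\}}g_{v,m-1}$; $g_{k,v}=t^{\#\{i:v_i<k\}}g_{v,k-1}$ for $1\le k\le m-1$; $g_{m,v}=g_{v,m-1}+qg_{v,m}$. The higher $q,t$-Catalan polynomial is $C_n^{(m)}(q,t)=\langle\nabla^m e_n,e_n\rangle$, where $e_n$ is the elementary symmetric function, $\langle-,-\rangle$ is the Hall inner product (Schur functions are orthonormal) on symmetric functions over $\mathbb Q(q,t)$, and $\nabla$ is the linear operator with $\nabla\tilde H_\mu=t^{n(\mu)}q^{n(\mu^t)}\tilde H_\mu$ on the modified Macdonald polynomials $\tilde H_\mu$, with $n(\mu)=\sum_i(i-1)\mu_i$ and $\mu^t$ the transpose partition. *)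

(* Defs.v *)
From HB Require Import structures.
From mathcomp Require Import all_boot all_order all_fingroup all_algebra.
From mathcomp Require Import boolp.
From mathcomp Require Import mpoly zify ring.

Set Implicit Arguments.
Unset Strict Implicit.
Unset Printing Implicit Defensive.

Import GRing.Theory.
Local Open Scope ring_scope.

Section DropLastVar.
Variable R : comNzRingType.

Lemma widen_lift_max N (i : 'I_N) : widen_ord (leqnSn N) i = lift ord_max i.
Proof. by apply: val_inj; rewrite /= /bump leqNgt ltn_ord. Qed.

Lemma msize_le N (p : {mpoly R[N]}) d :
  (forall m, p@_m != 0 -> (mdeg m < d)%N) -> (msize p <= d)%N.
Proof.
by move=> pd; apply/bigmax_leqP_seq => m mp _; apply: pd; rewrite mcoeff_eq0 negbK.
Qed.

Definition drop_last_var (N : nat) (p : {mpoly R[N.+1]}) : {mpoly R[N]} :=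
  p \mPo [tuple (if unlift ord_max i is Some j then 'X_j else 0) | i < N.+1].

HB.instance Definition _ N := GRing.RMorphism.copy (@drop_last_var N)
  (@drop_last_var N).
HB.instance Definition _ N := GRing.Linear.copy (@drop_last_var N)
  (@drop_last_var N).

Definition mnm_add_var (N : nat) (m : 'X_{1..N}) : 'X_{1..N.+1} :=
  [multinom (if unlift ord_max i is Some j then m j else 0%N) | i < N.+1].

Lemma mcoeff_drop_last_var N (p : {mpoly R[N.+1]}) m :
  (drop_last_var p)@_m = p@_(mnm_add_var m).
Proof.
rewrite /drop_last_var comp_mpolyEX raddf_sum /= [in RHS](mpolyE p) raddf_sum /=.
apply: eq_bigr => k _; rewrite !mcoeffZ; congr (_ * _).
rewrite comp_mpolyX big_ord_recr /= tnth_mktuple unlift_none.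
rewrite (eq_bigr (fun i : 'I_N => 'X_i ^+ k (widen_ord (leqnSn N) i))); last first.
  by move=> i _; rewrite tnth_mktuple widen_lift_max liftK.
have -> : \prod_(i < N) ('X_i : {mpoly R[N]}) ^+ k (widen_ord (leqnSn N) i)
   = 'X_[[multinom k (widen_ord (leqnSn N) i) | i < N]].
  by rewrite [RHS]mpolyXE_id; apply: eq_bigr => i _; rewrite mnmE.
rewrite expr0n mcoeffX.
case: (eqVneq (k ord_max) 0%N) => k0; last first.
  rewrite mulr0 mcoeff0; case: eqP => // kE.
  by move: k0; rewrite kE mnmE unlift_none eqxx.
rewrite mulr1 mcoeffX; congr (_%:R); congr nat_of_bool.
apply/eqP/eqP => [<-|->]; apply/mnmP => i; rewrite !mnmE.
  by case: unliftP => [j ->|->] //; rewrite mnmE widen_lift_max.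
by rewrite widen_lift_max liftK.
Qed.

Lemma mdeg_add_var N (m : 'X_{1..N}) : mdeg (mnm_add_var m) = mdeg m.
Proof.
rewrite !mdegE big_ord_recr /= mnmE unlift_none addn0.
by apply: eq_bigr => i _; rewrite mnmE widen_lift_max liftK.
Qed.

Definition complete_mpoly (N k : nat) : {mpoly R[N]} :=
  \sum_(m : 'X_{1..N < k.+1} | mdeg m == k) 'X_[m].

Definition power_sum_mpoly (N k : nat) : {mpoly R[N]} := \sum_(i < N) 'X_i ^+ k.

Lemma mcoeff_complete_mpoly N k m :
  (complete_mpoly N k)@_m = (mdeg m == k)%:R.
Proof.
rewrite /complete_mpoly raddf_sum /=.
under eq_bigr do rewrite mcoeffX.
case: eqP => [mk|mk]; last first.
  by rewrite big1 // => i /eqP ik; case: eqP => // im; case: mk; rewrite -im.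
have mk1 : (mdeg m < k.+1)%N by rewrite mk.
rewrite (bigD1 (BMultinom mk1)) /= ?mk ?eqxx //.
rewrite big1 ?addr0 // => i /andP[_ ne].
by case: eqP => // im; case/eqP: ne; apply: val_inj.
Qed.

End DropLastVar.

Section SymFun.
Variable R : comNzRingType.

(* The ring of symmetric functions as the graded inverse limit of the rings of *)
(* symmetric polynomials in N variables: an element is a family of symmetric   *)
(* polynomials, one for each N, of bounded degree and compatible with setting  *)
(* the last variable to 0.                                                     *)
Record symfun := SymFun {
  sympoly :> forall N : nat, {mpoly R[N]};
  sympoly_sym : forall N, sympoly N \is symmetric;
  sympoly_drop : forall N, drop_last_var (sympoly N.+1) = sympoly N;
  sympoly_bounded : exists d : nat, forall N, (msize (sympoly N) <= d)%N }.

HB.instance Definition _ := gen_eqMixin symfun.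
HB.instance Definition _ := gen_choiceMixin symfun.

Lemma symfunP (f g : symfun) : (forall N, f N = g N) -> f = g.
Proof.
case: f g => f f1 f2 f3 [g g1 g2 g3] /= fg.
have E : f = g by apply: functional_extensionality_dep.
by case: _ / E g1 g2 g3 {fg} => g1 g2 g3; congr SymFun; apply: Prop_irrelevance.
Qed.

Fact symfun_zero_bounded :
  exists d, forall N, (msize (0%R : {mpoly R[N]}) <= d)%N.
Proof. by exists 0%N => N; rewrite msize0. Qed.
Definition symfun_zero : symfun := SymFun
  (fun N => rpred0 _) (fun N => raddf0 _) symfun_zero_bounded.

Fact symfun_one_bounded : exists d, forall N, (msize (1%R : {mpoly R[N]}) <= d)%N.
Proof. by exists 1%N => N; rewrite msize1. Qed.
Definition symfun_one : symfun := SymFun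
  (fun N => rpred1 _) (fun N => rmorph1 _) symfun_one_bounded.

Section Ops.
Variables (c : R) (f g : symfun).

Fact symfun_opp_sym N : - f N \is symmetric.
Proof. by rewrite rpredN sympoly_sym. Qed.
Fact symfun_opp_drop N : drop_last_var (- f N.+1) = - f N.
Proof. by rewrite raddfN /= sympoly_drop. Qed.
Fact symfun_opp_bounded : exists d, forall N, (msize (- f N) <= d)%N.
Proof. by case: (sympoly_bounded f) => d fd; exists d => N; rewrite msizeN. Qed.
Definition symfun_opp := SymFun symfun_opp_sym symfun_opp_drop symfun_opp_bounded.

Fact symfun_add_sym N : f N + g N \is symmetric.
Proof. by rewrite rpredD ?sympoly_sym. Qed.
Fact symfun_add_drop N : drop_last_var (f N.+1 + g N.+1) = f N + g N.
Proof. by rewrite raddfD /= !sympoly_drop. Qed.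
Fact symfun_add_bounded : exists d, forall N, (msize (f N + g N) <= d)%N.
Proof.
case: (sympoly_bounded f) (sympoly_bounded g) => d fd [e ge].
exists (maxn d e) => N; apply: leq_trans (msizeD_le _ _) _.
by rewrite geq_max !leq_max fd ge orbT.
Qed.
Definition symfun_add := SymFun symfun_add_sym symfun_add_drop symfun_add_bounded.

Fact symfun_mul_sym N : f N * g N \is symmetric.
Proof. by rewrite rpredM ?sympoly_sym. Qed.
Fact symfun_mul_drop N : drop_last_var (f N.+1 * g N.+1) = f N * g N.
Proof. by rewrite rmorphM /= !sympoly_drop. Qed.
Fact symfun_mul_bounded : exists d, forall N, (msize (f N * g N) <= d)%N.
Proof.
case: (sympoly_bounded f) (sympoly_bounded g) => d fd [e ge].
exists (d + e).+1 => N; apply: leq_trans (msizeM_le _ _) _.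
by rewrite ltnS; exact: leq_add.
Qed.
Definition symfun_mul := SymFun symfun_mul_sym symfun_mul_drop symfun_mul_bounded.

Fact symfun_scale_sym N : c *: f N \is symmetric.
Proof. by rewrite rpredZ ?sympoly_sym. Qed.
Fact symfun_scale_drop N : drop_last_var (c *: f N.+1) = c *: f N.
Proof. by rewrite linearZ /= sympoly_drop. Qed.
Fact symfun_scale_bounded : exists d, forall N, (msize (c *: f N) <= d)%N.
Proof.
case: (sympoly_bounded f) => d fd.
by exists d => N; apply: leq_trans (msizeZ_le _ _) _.
Qed.
Definition symfun_scale :=
  SymFun symfun_scale_sym symfun_scale_drop symfun_scale_bounded.

End Ops.

Fact symfun_addA : associative symfun_add.
Proof. by move=> f g h; apply: symfunP => N /=; rewrite addrA. Qed.
Fact symfun_addC : commutative symfun_add.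
Proof. by move=> f g; apply: symfunP => N /=; rewrite addrC. Qed.
Fact symfun_add0 : left_id symfun_zero symfun_add.
Proof. by move=> f; apply: symfunP => N /=; rewrite add0r. Qed.
Fact symfun_addN : left_inverse symfun_zero symfun_opp symfun_add.
Proof. by move=> f; apply: symfunP => N /=; rewrite addNr. Qed.

HB.instance Definition _ := GRing.isZmodule.Build symfun
  symfun_addA symfun_addC symfun_add0 symfun_addN.

Fact symfun_mulA : associative symfun_mul.
Proof. by move=> f g h; apply: symfunP => N /=; rewrite mulrA. Qed.
Fact symfun_mulC : commutative symfun_mul.
Proof. by move=> f g; apply: symfunP => N /=; rewrite mulrC. Qed.
Fact symfun_mul1 : left_id symfun_one symfun_mul.
Proof. by move=> f; apply: symfunP => N /=; rewrite mul1r. Qed.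
Fact symfun_mulDl : left_distributive symfun_mul +%R.
Proof. by move=> f g h; apply: symfunP => N /=; rewrite mulrDl. Qed.
Fact symfun_one_neq0 : symfun_one != 0 :> symfun.
Proof.
apply/eqP => /(congr1 (fun f : symfun => f 0%N)) /= /eqP.
by rewrite oner_eq0.
Qed.

HB.instance Definition _ := GRing.Zmodule_isComNzRing.Build symfun
  symfun_mulA symfun_mulC symfun_mul1 symfun_mulDl symfun_one_neq0.

Fact symfun_scaleA a b f :
  symfun_scale a (symfun_scale b f) = symfun_scale (a * b) f.
Proof. by apply: symfunP => N /=; rewrite scalerA. Qed.
Fact symfun_scale1 : left_id 1 symfun_scale.
Proof. by move=> f; apply: symfunP => N /=; rewrite scale1r. Qed.
Fact symfun_scaleDr : right_distributive symfun_scale +%R.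
Proof. by move=> c f g; apply: symfunP => N /=; rewrite scalerDr. Qed.
Fact symfun_scaleDl f : {morph symfun_scale^~ f : a b / a + b}.
Proof. by move=> a b; apply: symfunP => N /=; rewrite scalerDl. Qed.

HB.instance Definition _ := GRing.Zmodule_isLmodule.Build R symfun
  symfun_scaleA symfun_scale1 symfun_scaleDr symfun_scaleDl.

Fact symfun_scaleAl a (f g : symfun) : a *: (f * g) = a *: f * g.
Proof. by apply: symfunP => N /=; rewrite scalerAl. Qed.

HB.instance Definition _ := GRing.Lmodule_isLalgebra.Build R symfun
  symfun_scaleAl.
HB.instance Definition _ := GRing.Lalgebra_isComAlgebra.Build R symfun.

Section Generators.
Variable k : nat.

Fact elementary_drop N : drop_last_var (mesym N.+1 R k) = mesym N R k.
Proof.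
apply/mpolyP => m; rewrite mcoeff_drop_last_var !mcoeff_mesym /mechar.
rewrite mdeg_add_var; congr (_ && _)%:R.
apply/forallP/forallP => m1 i; first by have := m1 (lift ord_max i); rewrite mnmE liftK.
by rewrite mnmE; case: unliftP => [j _|//]; apply: m1.
Qed.
Fact elementary_bounded : exists d, forall N, (msize (mesym N R k) <= d)%N.
Proof.
exists k.+1 => N; apply: msize_le => m; rewrite mcoeff_mesym /mechar.
by case: (mdeg m =P k) => [->|] //=; rewrite eqxx.
Qed.
Definition elementary : symfun := SymFun
  (fun N => mesym_sym N R k) elementary_drop elementary_bounded.

Fact complete_sym N : complete_mpoly R N k \is symmetric.
Proof.
apply/issymP => s; apply/mpolyP => m.
by rewrite mcoeff_sym !mcoeff_complete_mpoly mdeg_mperm.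
Qed.
Fact complete_drop N :
  drop_last_var (complete_mpoly R N.+1 k) = complete_mpoly R N k.
Proof.
apply/mpolyP => m.
by rewrite mcoeff_drop_last_var !mcoeff_complete_mpoly mdeg_add_var.
Qed.
Fact complete_bounded : exists d, forall N, (msize (complete_mpoly R N k) <= d)%N.
Proof.
exists k.+1 => N; apply: msize_le => m; rewrite mcoeff_complete_mpoly.
by case: (mdeg m =P k) => [->|] //=; rewrite eqxx.
Qed.
Definition complete : symfun :=
  SymFun complete_sym complete_drop complete_bounded.

Fact power_sum_sym N : power_sum_mpoly R N k.+1 \is symmetric.
Proof.
apply/issymP => s; rewrite raddf_sum /=.
rewrite [RHS](reindex_inj (@perm_inj _ s)) /=.
apply: eq_bigr => i _; rewrite rmorphXn /=; congr (_ ^+ _).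
rewrite msymX; congr 'X_[_]; apply/mnmP => j; rewrite !mnmE.
by rewrite (can2_eq (permK s) (permKV s)).
Qed.
Fact power_sum_drop N :
  drop_last_var (power_sum_mpoly R N.+1 k.+1) = power_sum_mpoly R N k.+1.
Proof.
rewrite raddf_sum big_ord_recr /= rmorphXn /= /drop_last_var comp_mpolyXU.
rewrite -tnth_nth tnth_mktuple unlift_none expr0n addr0.
apply: eq_bigr => i _; rewrite rmorphXn /= comp_mpolyXU -tnth_nth tnth_mktuple.
by rewrite widen_lift_max liftK.
Qed.
Fact power_sum_bounded :
  exists d, forall N, (msize (power_sum_mpoly R N k.+1) <= d)%N.
Proof.
exists k.+2 => N; apply: msize_le => m; rewrite raddf_sum /=.
apply: contraNltn => km; rewrite big1 // => i _.
rewrite mpolyXn mcoeffX; case: eqP => // im; move: km.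
by rewrite -im mdegMn mdeg1 mul1n ltnn.
Qed.

(* p_(k+1): the power sum p_0 is not a symmetric function. *)
Definition power_sum_succ : symfun :=
  SymFun power_sum_sym power_sum_drop power_sum_bounded.

End Generators.
End SymFun.

(* Partitions are weakly decreasing sequences of positive integers, 0-indexed. *)
Definition is_partition (la : seq nat) : bool := sorted geq la && (0%N \notin la).

Definition conj_partition (la : seq nat) : seq nat :=
  mkseq (fun j => count (fun x => j < x)%N la) (head 0%N la).

Definition partition_n (la : seq nat) : nat :=
  (\sum_(i < size la) i * nth 0%N la i)%N.

Definition dominates (la mu : seq nat) : Prop :=
  [/\ is_partition la, sumn la = sumn mu
    & forall k, (sumn (take k mu) <= sumn (take k la))%N].

Section Plethysm.
Variable R : comNzRingType.

(* Jacobi-Trudi: s_la = det (h_(la_i - i + j)), with h_r = 0 for r < 0. *)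
Definition schur (la : seq nat) : symfun R :=
  \det (\matrix_(i < size la, j < size la)
    (if (i <= nth 0%N la i + j)%N then complete R (nth 0%N la i + j - i) else 0)).

(* f |-> f[X(1-u)], as the R-algebra endomorphism with p_k |-> (1 - u^k) p_k;  *)
(* coefficients in R, including those involving u, are left unchanged.         *)
Definition is_plethysm_one_minus (u : R)
    (phi : {lrmorphism symfun R -> symfun R}) : Prop :=
  forall k, phi (power_sum_succ R k) = (1 - u ^+ k.+1) *: power_sum_succ R k.

Definition in_schur_span (P : seq nat -> Prop) (f : symfun R) : Prop :=
  exists (r : seq (seq nat)) (c : seq nat -> R),
    (forall la, la \in r -> P la) /\ f = \sum_(la <- r) c la *: schur la.

(* The modified Macdonald polynomial H_mu is determined by: H_mu[X(1-q)] lies  *)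
(* in the span of the s_la with la >= mu, H_mu[X(1-t)] in the span of the s_la *)
(* with la >= mu^t (dominance order), and H_mu[1] = H_mu(1, 0, 0, ...) = 1.    *)
Record is_modified_macdonald (q t : R) (mu : seq nat) (H : symfun R) : Prop := {
  macdonald_q : exists2 phi, is_plethysm_one_minus q phi &
    in_schur_span (fun la => dominates la mu) (phi H);
  macdonald_t : exists2 phi, is_plethysm_one_minus t phi &
    in_schur_span (fun la => dominates la (conj_partition mu)) (phi H);
  macdonald_1 : (H 1%N).@[fun=> 1] = 1 }.

Definition is_nabla (q t : R) (nabla : {linear symfun R -> symfun R}) : Prop :=
  forall mu H, is_partition mu -> is_modified_macdonald q t mu H ->
  nabla H = (t ^+ partition_n mu * q ^+ partition_n (conj_partition mu)) *: H.

Definition is_hall (hall : {biscalar symfun R}) : Prop :=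
  forall la mu, is_partition la -> is_partition mu ->
  hall (schur la) (schur mu) = (la == mu)%:R.

End Plethysm.

Section Recursion.
Variables (F : fieldType) (q t : F) (m : nat).

Definition entries_le (v : seq nat) : bool := all (fun k => k <= m)%N v.
Definition num_lt (k : nat) (v : seq nat) : nat := count (fun x => x < k)%N v.

(* The variable a is 'X. Only the values of g on sequences with entries in     *)
(* {0,...,m} are constrained.                                                  *)
Record g_recursion (g : seq nat -> {poly F}) : Prop := {
  g_nil : g [::] = 1;
  g_0 : g [:: 0%N] = 1 + 'X;
  g_0_lt : forall k v, entries_le v -> (k < m)%N ->
    g [:: 0%N, k & v] = ((t ^+ num_lt m (k :: v))%:P + 'X) * g (k :: v);
  g_0_m : forall v, entries_le v ->
    g [:: 0%N, m & v] = (t ^+ num_lt m v)%:P * g (rcons v m.-1);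
  g_mid : forall k v, entries_le v -> (0 < k < m)%N ->
    g (k :: v) = (t ^+ num_lt k v)%:P * g (rcons v k.-1);
  g_m : forall v, entries_le v ->
    g (m :: v) = g (rcons v m.-1) + q%:P * g (rcons v m) }.

Local Fixpoint g_weight (l : nat) : nat :=
  if l is l'.+1 then (g_weight l' + (m * l' * l'.+1 + l')).+1 else 0.

Local Definition g_measure (v : seq nat) : nat :=
  g_weight (size v) + sumn v * (size v).+1 + find (predC1 m) v.

Local Fixpoint g_fuel (d : nat) (v : seq nat) : {poly F} :=
  if d is d.+1 then
    if v is k :: w then
      if k == 0%N then
        if w is l :: w' then
          if l == m then (t ^+ num_lt m w')%:P * g_fuel d (rcons w' m.-1)
          else ((t ^+ num_lt m w)%:P + 'X) * g_fuel d w
        else 1 + 'X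
      else if (k < m)%N then (t ^+ num_lt k w)%:P * g_fuel d (rcons w k.-1)
      else if all (pred1 m) w then (1 - q)^-1%:P * g_fuel d (rcons w m.-1)
      else g_fuel d (rcons w m.-1) + q%:P * g_fuel d (rcons w m)
    else 1
  else 0.

Local Lemma sumn_entries_le v : entries_le v -> (sumn v <= m * size v)%N.
Proof.
by elim: v => [|k v IH] //= /andP[km /IH]; rewrite mulnS; apply: leq_add.
Qed.

Local Lemma entries_le_rcons v k :
  entries_le (rcons v k) = (k <= m)%N && entries_le v.
Proof. exact: all_rcons. Qed.

Local Lemma g_measure_size v w : entries_le v -> (size v < size w)%N ->
  (g_measure v < g_measure w)%N.
Proof.
move=> /sumn_entries_le sv svw.
have mono i j : (i <= j)%N -> (g_weight i <= g_weight j)%N.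
  elim: j => [|j IH]; first by case: i.
  rewrite leq_eqVlt => /predU1P[->|/IH ij] //=.
  by apply: leq_trans ij _; rewrite leqW // leq_addr.
have fv := find_size (predC1 m) v.
have /= wl := mono _ _ svw.
have : (sumn v * (size v).+1 <= m * size v * (size v).+1)%N by rewrite leq_mul2r sv orbT.
rewrite /g_measure; move: (sumn w * _)%N (sumn v * _)%N (m * _ * _)%N wl => x y z.
move: fv; move: (find _ v) (find _ w) (g_weight _) (g_weight _) => a b c e {mono sv svw}.
move: (size v) => s; lia.
Qed.

Local Lemma g_measure_sum v w : size v = size w -> (sumn v < sumn w)%N ->
  (g_measure v < g_measure w)%N.
Proof.
move=> vw svw; have fv := find_size (predC1 m) v.
have : ((sumn v).+1 * (size v).+1 <= sumn w * (size v).+1)%N by rewrite leq_mul2r svw orbT.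
rewrite mulSn /g_measure -vw; move: (sumn w * _)%N (sumn v * _)%N => x y.
move: fv; move: (find _ v) (find _ w) (g_weight _) => a b c {svw}.
move: (size v) => s; lia.
Qed.

Local Lemma g_measure_rot w : ~~ all (pred1 m) w ->
  (g_measure (rcons w m) < g_measure (m :: w))%N.
Proof.
rewrite -has_predC => hw; rewrite /g_measure size_rcons sumn_rcons /= eqxx /=.
by rewrite -cats1 find_cat hw addnS ltnS [(m + _)%N]addnC.
Qed.

Hypotheses (m_gt0 : (0 < m)%N) (one_sub_q_neq0 : 1 - q != 0).

Local Lemma measure_0_lt k v : entries_le (k :: v) ->
  (g_measure (k :: v) < g_measure [:: 0%N, k & v])%N.
Proof. by move=> kv; apply: g_measure_size. Qed.

Local Lemma measure_0_m v : entries_le v ->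
  (g_measure (rcons v m.-1) < g_measure [:: 0%N, m & v])%N.
Proof.
move=> vm; apply: g_measure_size; last by rewrite size_rcons.
by rewrite entries_le_rcons leq_pred.
Qed.

Local Lemma measure_pos k v : (0 < k)%N ->
  (g_measure (rcons v k.-1) < g_measure (k :: v))%N.
Proof.
move=> k0; apply: g_measure_sum; first by rewrite size_rcons.
by rewrite sumn_rcons /=; lia.
Qed.

Local Lemma g_fuel_stable d d' v : entries_le v ->
  (g_measure v < d)%N -> (g_measure v < d')%N -> g_fuel d v = g_fuel d' v.
Proof.
elim: d d' v => [|d IH] [|d'] [|k w] //= /andP[km wm]; rewrite !ltnS => vd vd'.
have stab u : entries_le u -> (g_measure u < g_measure (k :: w))%N ->
    g_fuel d u = g_fuel d' u.
  by move=> um uv; apply: IH => //; apply: leq_trans uv _.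
have rm j : (j <= m)%N -> entries_le (rcons w j).
  by rewrite entries_le_rcons wm andbT.
have [k0|k0] := posnP k.
  subst k; case: w wm stab rm {vd vd'} => [|l w] // wm stab rm.
  case: eqP => [lm|_]; last by rewrite stab //; exact: measure_0_lt.
  subst l; case/andP: wm => _ wm.
  by rewrite stab ?entries_le_rcons ?leq_pred //; exact: measure_0_m.
have kp : (k.-1 <= m)%N by apply: leq_trans km; exact: leq_pred.
have [klt|kge] := ltnP k m; first by rewrite stab ?rm //; exact: measure_pos.
have {}kge : k = m by apply/eqP; rewrite eqn_leq km.
subst k; rewrite (stab (rcons w m.-1)) ?rm //; last exact: measure_pos.
case: ifPn => // wall; rewrite (stab (rcons w m)) ?rm //; exact: g_measure_rot.
Qed.

Lemma rcons_all_m w : all (pred1 m) w -> rcons w m = m :: w.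
Proof. by move=> /all_pred1P ->; elim: (size w) => //= n ->. Qed.

Lemma g_recursion_exists : exists g, g_recursion g.
Proof.
pose g v := g_fuel (g_measure v).+1 v.
have gE d v : entries_le v -> (g_measure v < d)%N -> g_fuel d v = g v.
  by move=> vm vd; apply: g_fuel_stable.
exists g; split => //.
- move=> k v vm km; have kv : entries_le (k :: v) by rewrite /= (ltnW km).
  have := measure_0_lt kv; rewrite {1}/g; move: (g_measure (0%N :: _)) => d lt /=.
  by rewrite (ltn_eqF km) gE.
- move=> v vm; have := measure_0_m vm.
  rewrite {1}/g; move: (g_measure (0%N :: _)) => d lt /=.
  by rewrite eqxx gE // entries_le_rcons leq_pred.
- move=> k v vm /andP[k0 km]; have := measure_pos v k0.
  rewrite {1}/g; move: (g_measure (k :: _)) => d lt /=.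
  rewrite gtn_eqF // km gE // entries_le_rcons vm andbT; lia.
- move=> v vm; have vp : entries_le (rcons v m.-1).
    by rewrite entries_le_rcons leq_pred.
  have mp := measure_pos v m_gt0.
  have gm d : (g_measure (m :: v) < d.+1)%N -> all (pred1 m) v ->
      g_fuel d.+1 (m :: v) = (1 - q)^-1%:P * g (rcons v m.-1).
    move=> lt vall; rewrite /= gtn_eqF // ltnn vall gE //.
    by apply: leq_trans mp _.
  have [vall|vall] := boolP (all (pred1 m) v); last first.
    have := g_measure_rot vall; rewrite {1}/g.
    move: (g_measure (m :: _)) mp => d mp lt /=.
    by rewrite gtn_eqF // ltnn (negPf vall) !gE ?entries_le_rcons ?leqnn ?leq_pred ?vm.
  rewrite rcons_all_m // {1 3}/g gm //.
  have e : (1 - q)^-1 = 1 + q * (1 - q)^-1 by field.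
  by rewrite {1}e rmorphD rmorphM rmorph1 /=; ring.
Qed.

Lemma g_recursion_unique g g' v : g_recursion g -> g_recursion g' ->
  entries_le v -> g v = g' v.
Proof.
move=> gP gP'; have [d] := ubnP (g_measure v).
elim: d v => // d IH [|k w] vd; first by rewrite (g_nil gP) (g_nil gP').
move=> /= /andP[km wm].
have stab u : entries_le u -> (g_measure u < g_measure (k :: w))%N -> g u = g' u.
  by move=> um uv; apply: IH => //; apply: leq_trans uv _.
have rm j : (j <= m)%N -> entries_le (rcons w j).
  by rewrite entries_le_rcons wm andbT.
have [k0|k0] := posnP k.
  subst k; case: w wm stab rm {vd} => [|l w] wm stab rm.
    by rewrite (g_0 gP) (g_0 gP').
  case/andP: (wm) => lm wm'.
  case: (eqVneq l m) => [?|ne].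
    subst l; rewrite (g_0_m gP) // (g_0_m gP') // stab //.
      by rewrite entries_le_rcons leq_pred.
    exact: measure_0_m.
  have {}lm : (l < m)%N by rewrite ltn_neqAle ne.
  by rewrite (g_0_lt gP) // (g_0_lt gP') // stab //; exact: measure_0_lt.
have kp : (k.-1 <= m)%N by apply: leq_trans km; exact: leq_pred.
have [klt|kge] := ltnP k m.
  rewrite (g_mid gP) ?k0 // (g_mid gP') ?k0 // stab ?rm //; exact: measure_pos.
have {}kge : k = m by apply/eqP; rewrite eqn_leq km.
subst k; have E := stab _ (rm _ kp) (measure_pos w m_gt0).
have [wall|wall] := boolP (all (pred1 m) w); last first.
  rewrite (g_m gP) // (g_m gP') // E (stab (rcons w m)) ?rm //.
  exact: g_measure_rot.
have := g_m gP wm; have := g_m gP' wm; rewrite rcons_all_m // -E.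
move: (g (rcons _ _)) (g (m :: w)) (g' (m :: w)) => x y z Ez Ey.
have : ((1 - q)%:P * (y - z)) == 0.
  by rewrite rmorphB rmorph1 /= mulrBl mul1r mulrBr {1}Ey {1}Ez; apply/eqP; ring.
by rewrite mulf_eq0 polyC_eq0 (negPf one_sub_q_neq0) subr_eq0 => /eqP.
Qed.

End Recursion.

Definition Qqt : fieldType := {fraction {mpoly rat[2]}}.
Definition qvar : Qqt := tofrac ('X_ord0 : {mpoly rat[2]}).
Definition tvar : Qqt := tofrac ('X_ord_max : {mpoly rat[2]}).

Lemma one_sub_qvar_neq0 : 1 - qvar != 0.
Proof.
rewrite subr_eq0 -tofrac1 tofrac_eq; apply/eqP => /(congr1 (mcoeff 0%MM)) /eqP.
by rewrite mcoeff1 mcoeffX eqxx mnm1_eq0 oner_eq0.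
Qed.

(* Main.v *)
(* Let x_0, ..., x_K be N = K + 1 variables, with the Demazure-Lusztig operators  *)
(* T_i, the q-rotation w and the Cherednik operators Y_i on polynomials.          *)
(* A sequence v is encoded as m^b c_1 m^(b_1) ... c_k m^(b_k) with c_i < m; to it *)
(* corresponds a word in the T_i, w, the x_i and the Gaussian operator G, where G *)
(* commutes with T_i, Y_i and w, and G x_K = x_K w T_0 ... T_(K-1) G. Evaluating  *)
(* these words at x_i = t^(K-i) gives the values at a = - t^N of a solution of    *)
(* the recursion; in particular g_(m^(n-1),m-1) becomes the value of G^m          *)
(* applied to the t-symmetrization of x_K^n.                                      *)
(*                                                                                *)
(* On the symmetric side, f |-> f[(t - 1) X] (up to sign) sends e_n to that       *)
(* symmetrization and intertwines the operator                                    *)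
(* D0 f = sum_r (-1)^r e_r [w^r] f[X + (1 - q)(1 - t) w] with                     *)
(* t^N + (1 - t) (Y_0 + ... + Y_K). By triangularity of D0[X (1 - q)] on products *)
(* of complete functions, eigenvectors of D0 are modified Macdonald polynomials;  *)
(* multiplication by e_1 adds a box, so that e_n, which is an iterated commutator *)
(* of D0 and e_1 applied to 1, is a sum of such eigenvectors, with the same index *)
(* for every N. On an eigenvector of index mu, G has the eigenvalue               *)
(* t^(n(mu)) q^(n(mu')) of nabla.                                                 *)
(*                                                                                *)
(* Finally the evaluation at x_i = t^(K-i) is the value at X = - t^N of the       *)
(* homomorphism Psi to polynomials in X with p_k |-> (-1)^(k-1) (1 - (-X)^k), and *)
(* Psi(f)(0) is the Hall pairing of f with e_n. Both sides of the identity are    *)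
(* thus values at 0 of polynomials which agree at - t^N for all large N.          *)
Require Import Defs.
From HB Require Import structures.
From mathcomp Require Import all_boot all_order all_fingroup all_algebra.
From mathcomp Require Import boolp.
From mathcomp Require Import mpoly zify ring.

Set Implicit Arguments.
Unset Strict Implicit.
Unset Printing Implicit Defensive.

Import GRing.Theory.
Local Open Scope ring_scope.

(** * Demazure-Lusztig operators *)

(** Fix K and work with polynomials in N = K + 1 variables. The T_i, the q-rotation w and the
    multiplications by the x_i generate a double affine Hecke algebra. Its Gaussian operator G
    commutes with the T_i, with w and with the Cherednik operators Y_i, and has explicit exchange
    rules with x_0 and x_K ([G_var0], [G_varK]). A sequence with entries at most m is read as a
    word: an entry c < m is a variable placed at level c between m copies of G, and the entries m
    are exponents of the innermost monomial. Moving one variable across one copy of G lowers its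
    level by one and brings it to the last place, which is the rule that deletes a first entry k and
    appends k - 1 ([ev_mid_rotate]). The evaluation x_i = t^(K-i), under which T_i becomes 1 and t
    T_i^(-1) becomes t, produces the powers of t. The other rules are similar, so the evaluated
    words satisfy the recursion at a = - t^N ([g_word]), and the sequence m^n, m-1 gives the value
    of G^m on the symmetrization of x_K^(n+1) ([gauss_start]).

    On the symmetric side, [kap] sends e_n to the symmetrization of x_K^n ([symm_varX]) and turns
    [D0] into t^N + (1 - t) (Y_0 + ... + Y_K) ([kap_D0], [macdonald_op_sym]). Since e_n is, up to a
    nonzero scalar, an iterated commutator of [D0] with multiplication by e_1, applied to 1
    ([D0_comm1]), it suffices to know how e_1 acts on eigenvectors: it adds a box to the index
    ([good_sum_e1]), and the explicit evaluation of the pieces ([box_ratioE]) shows that they can be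
    normalized. Triangularity of [D0] on products of complete functions ([hs_Gseq]), together with
    its symmetry in q and t ([D0_swap]), makes these eigenvectors multiples of modified Macdonald
    polynomials ([good_macdonald]). Hence nabla acts on them by t^(n(mu)) q^(n(mu')), and so does G
    ([gauss_type], [cell_prod]).

    Thus G^m applied to kap e_n is kap of nabla^m e_n for all large N. Evaluation after [kap] is the
    value of [Psi] at - t^N ([evt_kap]), and the value of [Psi] at 0 is the pairing with e_n
    ([hall_elementary]). Two polynomials that agree at infinitely many points - t^N agree at 0
    ([poly_eq_at], [g_hall]). *)

Section HeckeIdentities.
Variables (R : comPzRingType) (A B X Y t f g df dg sf sg sdf dsf c u v : R).

Let lin x y k u1 v1 : u1 = v1 -> x - y = k * (u1 - v1) -> x = y :> R.
Proof. by move=> ->; rewrite subrr mulr0 => /eqP; rewrite subr_eq0 => /eqP. Qed.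

(** These ring identities are the Hecke relations with denominators cleared: X and Y are the two
    variables, [sf] the transposed function, [df] the value of the operator on f. *)
Fact hecke_def : (X - Y) * u = f - sf ->
  (X - Y) * (f - (X - t * Y) * u) = (t - 1) * Y * f + (X - t * Y) * sf.
Proof. by move=> E; apply: (lin (k := - (X - t * Y)) E); ring. Qed.

Fact hecke_add : A * df = Y * f + B * sf -> A * dg = Y * g + B * sg ->
  A * (df + dg) = Y * (f + g) + B * (sf + sg).
Proof. by rewrite !mulrDr => -> ->; ring. Qed.

Fact hecke_mul : A * df = Y * f + B * sf -> A * (c * df) = Y * (c * f) + B * (c * sf).
Proof. by rewrite mulrCA => ->; ring. Qed.

Fact hecke_fix : (X - Y) * f = (t - 1) * Y * f + (X - t * Y) * f.
Proof. by ring. Qed.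

Fact hecke_quad_id : (X - Y) * df = (t - 1) * Y * f + (X - t * Y) * sf ->
  (Y - X) * sdf = (t - 1) * X * sf + (Y - t * X) * f ->
  (Y - X) * ((X - Y) * ((1 - t) * df + t * f)) =
  (Y - X) * ((t - 1) * Y * df + (X - t * Y) * sdf).
Proof.
move=> E E'.
rewrite [RHS]mulrDr (mulrCA _ (X - t * Y)) E'.
have -> : (Y - X) * ((X - Y) * ((1 - t) * df + t * f)) =
  (Y - X) * ((1 - t) * ((X - Y) * df) + t * (X - Y) * f) by ring.
have -> : (Y - X) * ((t - 1) * Y * df) = - ((t - 1) * Y * ((X - Y) * df)) by ring.
by rewrite E; ring.
Qed.

Fact hecke_varl_id : (X - Y) * df = (t - 1) * Y * f + (X - t * Y) * sf ->
  (X - Y) * (Y * (df + (t - 1) * f)) = (t - 1) * Y * (X * f) + (X - t * Y) * (Y * sf).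
Proof. by move=> E; apply: (lin (k := Y) E); ring. Qed.

Fact hecke_varr_id : (X - Y) * df = (t - 1) * Y * f + (X - t * Y) * sf ->
  (X - Y) * (X * df + (1 - t) * (Y * f)) =
  (t - 1) * Y * (Y * f) + (X - t * Y) * (X * sf).
Proof. by move=> E; apply: (lin (k := X) E); ring. Qed.

Fact hecke_scale : (c * X - c * Y) * u = (t - 1) * (c * Y) * f + (c * X - t * (c * Y)) * sf ->
  c * ((X - Y) * u) = c * ((t - 1) * Y * f + (X - t * Y) * sf).
Proof. by move=> E; apply: (lin (k := 1) E); ring. Qed.

End HeckeIdentities.

(** [h u v g sg] is the operator in the variables u, v applied to g, with [sg] its transposed image.
    The arguments f, A, ..., E are the six images of one function under the permutations of x, y, z;
    treated as independent quantities they make the braid relation a rational identity. *)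
Fact hecke_braid (L : fieldType) (t x y z f A B C D E : L) :
  x - y != 0 -> y - z != 0 -> x - z != 0 ->
  let h u v g sg := ((t - 1) * v * g + (u - t * v) * sg) / (u - v) in
  h x y (h y z (h x y f A) (h x z B C)) (h x z (h y x A f) (h y z D E)) =
  h y z (h x y (h y z f B) (h x z A D)) (h x z (h z y B f) (h x y C E)).
Proof.
move=> xy yz xz /=; field.
by rewrite -(opprB y z) -(opprB x y) !oppr_eq0 xy yz xz.
Qed.

(** * Operators attached to a pair of variables *)

Section DividedDifference.
Variables (F : fieldType) (n : nat).
Implicit Types (a b : 'I_n) (f g : {mpoly F[n]}).

Lemma msym_var (s : 'S_n) (a : 'I_n) : msym s ('X_a : {mpoly F[n]}) = 'X_(s a).
Proof.
rewrite msymX; congr 'X_[_]; apply/mnmP => j; rewrite !mnmE.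
by rewrite (can2_eq (permK s) (permKV s)).
Qed.

Lemma var_sub_neq0 a b : a != b -> ('X_a - 'X_b : {mpoly F[n]}) != 0.
Proof.
move=> ab; apply/eqP => /(congr1 (mcoeff U_(a))) /eqP.
rewrite mcoeffB !mcoeffX eqxx mcoeff0 (_ : (U_(b) == U_(a))%MM = false) ?subr0 ?oner_eq0 //.
apply/eqP => /mnmP /(_ a); rewrite !mnm1E eqxx => /eqP.
by rewrite eqb1 eq_sym (negPf ab).
Qed.

Lemma mpoly_alg_ind (P : {mpoly F[n]} -> Prop) :
  (forall c, P c%:MP) -> (forall i, P 'X_i) ->
  (forall f g, P f -> P g -> P (f + g)) -> (forall f g, P f -> P g -> P (f * g)) ->
  forall f, P f.
Proof.
move=> PC PX PD PM; elim/mpolyind => [|c m f _ _ Pf].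
  by rewrite -mpolyC0; apply: PC.
apply: PD => //; rewrite -mul_mpolyC; apply: (PM) => //.
rewrite mpolyXE_id; apply: (big_ind P); [by rewrite -mpolyC1; apply: PC | exact: (PM) |].
move=> i _; elim: (m i) => [|k IH]; first by rewrite expr0 -mpolyC1; apply: PC.
by rewrite exprS; apply: (PM).
Qed.

(** The property holds for constants and variables, and passes to products by f g - s(f g) = (f - s
    f) g + s f (g - s g). *)
Lemma divided_difference_exists a b f :
  exists g, ('X_a - 'X_b) * g == f - msym (tperm a b) f.
Proof.
elim/mpoly_alg_ind: f => [c|i|f g [u /eqP fu] [v /eqP gv]|f g [u /eqP fu] [v /eqP gv]].
- by exists 0; rewrite mulr0 -[c%:MP]mulr1 mul_mpolyC msymZ msym1 subrr.
- rewrite msym_var; case: tpermP => [->|->|_ _].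
  + by exists 1; rewrite mulr1.
  + by exists (-1); rewrite mulrN1 opprB.
  + by exists 0; rewrite mulr0 subrr.
- by exists (u + v); rewrite mulrDr fu gv msymD; apply/eqP; ring.
- exists (u * g + msym (tperm a b) f * v).
  rewrite mulrDr mulrA fu mulrCA gv msymM; apply/eqP; ring.
Qed.

Lemma msymC (s : 'S_n) c : msym s c%:MP = c%:MP :> {mpoly F[n]}.
Proof. by rewrite -[c%:MP]mulr1 mul_mpolyC msymZ msym1. Qed.

Variable t : F.

Lemma demazure_exists a b f : exists g, ('X_a - 'X_b) * g ==
  (t%:MP - 1) * 'X_b * f + ('X_a - t%:MP * 'X_b) * msym (tperm a b) f.
Proof.
have [u /eqP uE] := divided_difference_exists a b f.
by exists (f - ('X_a - t%:MP * 'X_b) * u); apply/eqP/hecke_def.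
Qed.

(* The Demazure-Lusztig operator, normalized by (T - 1) (T + t) = 0. *)
Fact demazure_sealed : {D : 'I_n -> 'I_n -> {mpoly F[n]} -> {mpoly F[n]} |
  forall a b f, ('X_a - 'X_b) * D a b f =
    (t%:MP - 1) * 'X_b * f + ('X_a - t%:MP * 'X_b) * msym (tperm a b) f}.
Proof.
exists (fun a b f => xchoose (demazure_exists a b f)) => a b f.
exact/eqP/(xchooseP (demazure_exists a b f)).
Qed.

Definition demazure := sval demazure_sealed.

Lemma demazureE a b f : ('X_a - 'X_b) * demazure a b f =
  (t%:MP - 1) * 'X_b * f + ('X_a - t%:MP * 'X_b) * msym (tperm a b) f.
Proof. exact: (svalP demazure_sealed). Qed.

(** Polynomials form an integral domain, so the defining equation determines the value of the
    operator; the relations that follow are checked against it. *)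
Lemma demazure_char a b f g : a != b -> ('X_a - 'X_b) * g =
  (t%:MP - 1) * 'X_b * f + ('X_a - t%:MP * 'X_b) * msym (tperm a b) f ->
  demazure a b f = g.
Proof.
by move=> ab; rewrite -demazureE => /(mulfI (var_sub_neq0 ab)).
Qed.

Lemma demazureD a b f g : a != b ->
  demazure a b (f + g) = demazure a b f + demazure a b g.
Proof.
move=> ab; apply: demazure_char => //; rewrite msymD.
exact: hecke_add (demazureE a b f) (demazureE a b g).
Qed.

Lemma demazureMl a b f g : a != b -> msym (tperm a b) f = f ->
  demazure a b (f * g) = f * demazure a b g.
Proof.
move=> ab sf; apply: demazure_char => //; rewrite msymM sf.
exact: hecke_mul (demazureE a b g).
Qed.

Lemma demazureZ a b c f : a != b -> demazure a b (c *: f) = c *: demazure a b f.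
Proof.
by move=> ab; rewrite -!mul_mpolyC demazureMl // msymC.
Qed.

Lemma demazure_fix a b f : a != b -> msym (tperm a b) f = f -> demazure a b f = f.
Proof. by move=> ab sf; apply: demazure_char => //; rewrite sf; apply: hecke_fix. Qed.

Lemma demazure_quad a b f : a != b ->
  demazure a b (demazure a b f) = (1 - t) *: demazure a b f + t *: f.
Proof.
move=> ab; have ba : b != a by rewrite eq_sym.
have E := demazureE a b f.
have E' : ('X_b - 'X_a) * msym (tperm a b) (demazure a b f) =
    (t%:MP - 1) * 'X_a * msym (tperm a b) f + ('X_b - t%:MP * 'X_a) * f.
  have := congr1 (msym (tperm a b)) E.
  rewrite msymD !msymM !msymB !msymM !msymC !msym_var tpermL tpermR rmorph1.
  by rewrite -[msym _ (msym _ f)]msymMm tperm2 msym1m.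
apply: demazure_char => //; apply: (@mulfI _ ('X_b - 'X_a)); first exact: var_sub_neq0.
rewrite -!mul_mpolyC mpolyCB mpolyC1; exact: hecke_quad_id E E'.
Qed.

Lemma demazure_msym (s : 'S_n) a b f : a != b ->
  msym s (demazure a b f) = demazure (s a) (s b) (msym s f).
Proof.
move=> ab; apply/esym/demazure_char; first by rewrite (inj_eq perm_inj).
rewrite -!msym_var -msymB -msymM demazureE msymD !msymM !msymB !msymM !msym_var.
rewrite !msymC rmorph1 -!msymMm; congr (_ + _ * msym _ f); apply/permP => i.
by rewrite !permM (inj_tperm _ _ _ (@perm_inj _ s)).
Qed.

Lemma demazure_frac a b f : a != b -> tofrac (demazure a b f) =
  ((tofrac t%:MP - 1) * tofrac 'X_b * tofrac f +
   (tofrac 'X_a - tofrac t%:MP * tofrac 'X_b) * tofrac (msym (tperm a b) f)) /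
  (tofrac 'X_a - tofrac 'X_b).
Proof.
move=> ab; have ne0 : tofrac 'X_a - tofrac 'X_b != 0 :> {fraction {mpoly F[n]}}.
  by rewrite -tofracB tofrac_eq0 var_sub_neq0.
apply: (canRL (mulfK ne0)); rewrite mulrC.
have := congr1 (@tofrac _) (demazureE a b f).
by rewrite tofracD !tofracM !tofracB !tofracM tofrac1.
Qed.

Lemma demazure_braid a b (c : 'I_n) f : a != b -> b != c -> a != c ->
  demazure a b (demazure b c (demazure a b f)) =
  demazure b c (demazure a b (demazure b c f)).
Proof.
move=> ab bc ac; have [ba cb ca] : [/\ b != a, c != b & c != a] by split; rewrite eq_sym.
have tabL := tpermL a b; have tabR := tpermR a b.
have tabc : tperm a b c = c by rewrite tpermD.
have tbca : tperm b c a = a by rewrite tpermD // eq_sym.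
have tacb : tperm a c b = b by rewrite tpermD // eq_sym.
have E : msym (tperm b c) (msym (tperm a c) (msym (tperm a b) f)) =
    msym (tperm a b) (msym (tperm a c) (msym (tperm b c) f)).
  rewrite -!msymMm; congr (msym _ f).
  apply/permP => i; rewrite !permM.
  have [->|ia] := eqVneq i a.
    by rewrite !(tpermL, tpermR, tbca, tabc, tacb).
  have [->|ib] := eqVneq i b.
    by rewrite !(tpermL, tpermR, tbca, tabc, tacb).
  have [->|ic] := eqVneq i c.
    by rewrite !(tpermL, tpermR, tbca, tabc, tacb).
  by rewrite !(tpermD, ia, ib, ic) // eq_sym.
have S2 (u v : 'I_n) g : msym (tperm u v) (msym (tperm u v) g) = g.
  by rewrite -msymMm tperm2 msym1m.
have S2' (u v : 'I_n) g : msym (tperm u v) (msym (tperm v u) g) = g.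
  by rewrite tpermC S2.
pose L := {fraction {mpoly F[n]}}.
pose x (i : 'I_n) : L := tofrac 'X_i.
have dE (u v : 'I_n) g (uv : u != v) := demazure_frac g uv.
have p (w w' u v : 'I_n) g (uv : u != v) := demazure_msym (tperm w w') g uv.
have p1 g : msym (tperm a b) (demazure b c g) = demazure a c (msym (tperm a b) g).
  by rewrite p // tabR tabc.
have p2 g : msym (tperm b c) (demazure a b g) = demazure a c (msym (tperm b c) g).
  by rewrite p // tbca tpermL.
have p3 g : msym (tperm a b) (demazure a b g) = demazure b a (msym (tperm a b) g).
  by rewrite p // tabR tabL.
have p4 g : msym (tperm a c) (demazure b a g) = demazure b c (msym (tperm a c) g).
  by rewrite p // tpermL tacb.
have p5 g : msym (tperm b c) (demazure b c g) = demazure c b (msym (tperm b c) g).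
  by rewrite p // tpermL tpermR.
have p6 g : msym (tperm a c) (demazure c b g) = demazure a b (msym (tperm a c) g).
  by rewrite p // tpermR tacb.
(* In the fraction field each operator becomes its explicit formula; transpositions are pushed
   through the operators until only the six images of f remain. *)
apply/eqP; rewrite -tofrac_eq; apply/eqP.
rewrite (dE a b _ ab) (dE b c _ bc) p1 p3 (dE a b _ ab) p2 (dE a c _ ac) (dE a c _ ac) p4 (dE b a _ ba) (dE b c _ bc).
rewrite (dE b c _ bc) (dE a b _ ab) p2 p5 (dE b c _ bc) p1 (dE a c _ ac) (dE a c _ ac) p6 (dE c b _ cb) (dE a b _ ab).
rewrite (tpermC b a) (tpermC c b) !S2 E.
apply: hecke_braid; rewrite subr_eq0 tofrac_eq -subr_eq0 var_sub_neq0 //.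
Qed.

End DividedDifference.

(** * The q-rotation and the evaluation at powers of t *)

Section HeckePolynomials.
Variables (F : fieldType) (q t : F).

Lemma demazure_comm n (a b c d : 'I_n) f : a != b -> c != d ->
  a != c -> a != d -> b != c -> b != d ->
  demazure t a b (demazure t c d f) = demazure t c d (demazure t a b f).
Proof.
move=> ab cd ac ad bc bd; apply/esym/demazure_char => //.
have sX e : e != a -> e != b -> msym (tperm a b) ('X_e : {mpoly F[n]}) = 'X_e.
  by move=> ea eb; rewrite msym_var tpermD // eq_sym.
have sC : msym (tperm a b) ('X_c : {mpoly F[n]}) = 'X_c by rewrite sX // eq_sym.
have sD : msym (tperm a b) ('X_d : {mpoly F[n]}) = 'X_d by rewrite sX // eq_sym.
have s1 : msym (tperm a b) ('X_c - 'X_d : {mpoly F[n]}) = 'X_c - 'X_d.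
  by rewrite msymB sC sD.
have s2 : msym (tperm a b) ((t%:MP - 1) * 'X_d) = (t%:MP - 1) * 'X_d.
  by rewrite msymM msymB msymC msym1 sD.
have s3 : msym (tperm a b) ('X_c - t%:MP * 'X_d) = 'X_c - t%:MP * 'X_d.
  by rewrite msymB msymM msymC sC sD.
rewrite -(demazureMl _ _ ab s1) demazureE demazureD //.
rewrite (demazureMl _ _ ab s2) (demazureMl _ _ ab s3); congr (_ + _ * _).
by rewrite demazure_msym // !tpermD // eq_sym.
Qed.

Lemma mpoly_morph_ext n m (u v : {mpoly F[n]} -> {mpoly F[m]}) :
  {morph u : f g / f + g} -> {morph u : f g / f * g} -> (forall c, u c%:MP = c%:MP) ->
  {morph v : f g / f + g} -> {morph v : f g / f * g} -> (forall c, v c%:MP = c%:MP) ->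
  (forall i, u 'X_i = v 'X_i) -> u =1 v.
Proof.
move=> uD uM uC vD vM vC uv; elim/mpoly_alg_ind => [c|//|f g fE gE|f g fE gE].
- by rewrite uC vC.
- by rewrite uD vD fE gE.
- by rewrite uM vM fE gE.
Qed.

(** The operator has degree 0 in the variables, so an algebra map that scales the two variables by
    the same nonzero c and intertwines the transpositions carries it along. The scalar is 1 for the
    rotation and q for its square. *)
Lemma demazure_morph n (u : {mpoly F[n]} -> {mpoly F[n]}) c a b a' b' f :
  (forall f g, u (f + g) = u f + u g) -> (forall f g, u (f * g) = u f * u g) ->
  (forall c, u c%:MP = c%:MP) ->
  a != b -> a' != b' -> c != 0 -> u 'X_a = c *: 'X_a' -> u 'X_b = c *: 'X_b' ->
  (forall i, u 'X_(tperm a b i) = msym (tperm a' b') (u 'X_i)) ->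
  u (demazure t a b f) = demazure t a' b' (u f).
Proof.
move=> uD uM uC ab ab' c0 ua ub us.
have us' g : u (msym (tperm a b) g) = msym (tperm a' b') (u g).
  apply: (@mpoly_morph_ext _ _ (fun g => u (msym _ g)) (fun g => msym _ (u g))).
  - by move=> x y; rewrite msymD uD.
  - by move=> x y; rewrite msymM uM.
  - by move=> e; rewrite msymC uC.
  - by move=> x y; rewrite uD msymD.
  - by move=> x y; rewrite uM msymM.
  - by move=> e; rewrite uC msymC.
  - by move=> i; rewrite msym_var us.
have uN g : u (- g) = - u g by rewrite -mulN1r uM -mpolyC1 -mpolyCN uC mpolyCN mpolyC1 mulN1r.
have u1 : u 1 = 1 by rewrite -mpolyC1 uC.
apply/esym/demazure_char => //.
have := congr1 u (demazureE t a b f).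
rewrite !(uM, uD, uN, uC, us', u1) ua ub -!mul_mpolyC.
have c0' : (c%:MP : {mpoly F[n]}) != 0 by rewrite mpolyC_eq0.
by move=> E; apply: (mulfI c0'); apply: hecke_scale E.
Qed.

Section Operators.
Variable K : nat.
Let P := {mpoly F[K.+1]}.
Implicit Types (f g : P) (i j : nat).

Definition xvar i : P := 'X_(inord i).
Definition hecke i : P -> P := demazure t (inord i) (inord i.+1).

Let inord_neq i j : (i <= K)%N -> (j <= K)%N -> i != j -> (inord i : 'I_K.+1) != inord j.
Proof. by move=> iK jK; apply: contra => /eqP/(congr1 val) /=; rewrite !inordK // => ->. Qed.

Let inordS_neq i : (i < K)%N -> (inord i : 'I_K.+1) != inord i.+1.
Proof. by move=> iK; rewrite inord_neq //; lia. Qed.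

Lemma heckeD i f g : (i < K)%N -> hecke i (f + g) = hecke i f + hecke i g.
Proof. by move=> iK; apply: demazureD; apply: inordS_neq. Qed.

Lemma heckeZ i c f : (i < K)%N -> hecke i (c *: f) = c *: hecke i f.
Proof. by move=> iK; apply: demazureZ; apply: inordS_neq. Qed.

Lemma hecke_quad i f : (i < K)%N -> hecke i (hecke i f) = (1 - t) *: hecke i f + t *: f.
Proof. by move=> iK; apply: demazure_quad; apply: inordS_neq. Qed.

Lemma hecke_comm i j f : (i.+1 < j)%N -> (j < K)%N -> hecke i (hecke j f) = hecke j (hecke i f).
Proof. by move=> ij jK; apply: demazure_comm; apply: inord_neq; lia. Qed.

Lemma hecke_braid_rel i f : (i.+1 < K)%N ->
  hecke i (hecke i.+1 (hecke i f)) = hecke i.+1 (hecke i (hecke i.+1 f)).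
Proof. by move=> iK; apply: demazure_braid; apply: inord_neq; lia. Qed.

Lemma hecke_sym i f g : (i < K)%N -> f \is symmetric -> hecke i (f * g) = f * hecke i g.
Proof. by move=> iK /issymP sf; apply: demazureMl; [apply: inordS_neq | apply: sf]. Qed.

Lemma hecke_var i j f : (i < K)%N -> (j <= K)%N -> j != i -> j != i.+1 ->
  hecke i (xvar j * f) = xvar j * hecke i f.
Proof.
move=> iK jK ji jSi; apply: demazureMl; first exact: inordS_neq.
by rewrite msym_var tpermD //; apply: inord_neq; lia.
Qed.

Lemma hecke_varl i f : (i < K)%N ->
  hecke i (xvar i * f) = xvar i.+1 * (hecke i f + (t - 1) *: f).
Proof.
move=> iK; apply: demazure_char; first exact: inordS_neq.
have := demazureE t (inord i) (inord i.+1) f.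
rewrite -/(hecke i f) msymM msym_var tpermL -mul_mpolyC mpolyCB mpolyC1 /xvar.
exact: hecke_varl_id.
Qed.

Lemma hecke_varr i f : (i < K)%N ->
  hecke i (xvar i.+1 * f) = xvar i * hecke i f + (1 - t) *: (xvar i.+1 * f).
Proof.
move=> iK; apply: demazure_char; first exact: inordS_neq.
have := demazureE t (inord i) (inord i.+1) f.
rewrite -/(hecke i f) msymM msym_var tpermR -mul_mpolyC mpolyCB mpolyC1 /xvar.
exact: hecke_varr_id.
Qed.

Lemma hecke1 i : (i < K)%N -> hecke i 1 = 1.
Proof. by move=> iK; apply: demazure_fix; rewrite ?msym1 //; apply: inordS_neq. Qed.

(** f(x_0, ..., x_K) becomes f(q x_K, x_0, ..., x_(K-1)). *)
Definition qrot f : P := f \mPo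
  [tuple (if i == ord0 then q *: xvar K else xvar i.-1) | i < K.+1].

Lemma qrotD : {morph qrot : f g / f + g}. Proof. exact: comp_mpolyD. Qed.
Lemma qrotM : {morph qrot : f g / f * g}. Proof. exact: rmorphM. Qed.
Lemma qrotZ c f : qrot (c *: f) = c *: qrot f. Proof. exact: comp_mpolyZ. Qed.
Lemma qrotC c : qrot c%:MP = c%:MP. Proof. exact: comp_mpolyC. Qed.

Lemma qrot_X (i : 'I_K.+1) : qrot 'X_i = if i == ord0 then q *: xvar K else xvar i.-1.
Proof. by rewrite /qrot comp_mpolyXU -tnth_nth tnth_mktuple. Qed.

Lemma qrot_var0 : qrot (xvar 0) = q *: xvar K.
Proof. by rewrite qrot_X -val_eqE /= inordK. Qed.

Lemma qrot_varS i : (i < K)%N -> qrot (xvar i.+1) = xvar i.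
Proof. by move=> iK; rewrite qrot_X -val_eqE /= inordK. Qed.

Definition qrotV f : P := f \mPo
  [tuple (if i == ord_max then q^-1 *: xvar 0 else xvar i.+1) | i < K.+1].

Lemma qrotV_X (i : 'I_K.+1) : qrotV 'X_i = if i == ord_max then q^-1 *: xvar 0 else xvar i.+1.
Proof. by rewrite /qrotV comp_mpolyXU -tnth_nth tnth_mktuple. Qed.

Hypothesis q_neq0 : q != 0.

Lemma qrotK : cancel qrot qrotV.
Proof.
apply: (@mpoly_morph_ext _ _ (fun f => qrotV (qrot f)) id) => //.
- by move=> f g; rewrite qrotD [qrotV _]comp_mpolyD.
- by move=> f g; rewrite qrotM [qrotV _]rmorphM.
- by move=> c; rewrite qrotC [qrotV _]comp_mpolyC.
- move=> i; rewrite qrot_X -val_eqE /=; case: eqP => i0.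
    rewrite [qrotV _]comp_mpolyZ -/(qrotV _) qrotV_X -val_eqE /= inordK // eqxx.
    by rewrite scalerA divff // scale1r /xvar -[0%N]i0 inord_val.
  rewrite qrotV_X -val_eqE /= inordK; last by have := ltn_ord i; lia.
  rewrite (_ : (_ == _) = false); last by have := ltn_ord i; lia.
  by rewrite /xvar prednK ?inord_val //; lia.
Qed.

Lemma qrotVK : cancel qrotV qrot.
Proof.
apply: (@mpoly_morph_ext _ _ (fun f => qrot (qrotV f)) id) => //.
- by move=> f g; rewrite [qrotV _]comp_mpolyD qrotD.
- by move=> f g; rewrite [qrotV _]rmorphM qrotM.
- by move=> c; rewrite [qrotV _]comp_mpolyC qrotC.
- move=> i; rewrite qrotV_X -val_eqE /=; case: eqP => i0.
    rewrite qrotZ qrot_var0 scalerA mulVf // scale1r.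
    by congr 'X_[U_(_)]; apply: val_inj; rewrite /= inordK.
  rewrite qrot_varS /xvar ?inord_val //; have := ltn_ord i; lia.
Qed.

Lemma qrot_hecke i f : (i.+1 < K)%N -> qrot (hecke i.+1 f) = hecke i (qrot f).
Proof.
move=> iK; apply: (@demazure_morph _ _ 1 _ _ _ _ _ qrotD qrotM qrotC).
- exact: inordS_neq.
- by apply: inordS_neq; lia.
- exact: oner_neq0.
- by rewrite scale1r -/(xvar i.+1) qrot_varS //; lia.
- by rewrite scale1r -/(xvar i.+2) qrot_varS //; lia.
move=> j; have jK := ltn_ord j; rewrite [qrot 'X_j]qrot_X; case: tpermP => [->|->|j1 j2].
- rewrite -/(xvar _) qrot_varS // -val_eqE /= !inordK //=; last by lia.
  by rewrite /xvar msym_var tpermL.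
- rewrite -/(xvar _) qrot_varS -?val_eqE /= ?inordK //=; last by lia.
  by rewrite /xvar msym_var tpermR.
- have ji1 : (j : nat) != i.+1 by apply: contra_not_neq j1 => <-; rewrite inord_val.
  have ji2 : (j : nat) != i.+2 by apply: contra_not_neq j2 => <-; rewrite inord_val.
  rewrite qrot_X -val_eqE /=; case: eqP => j0.
    by rewrite msymZ msym_var tpermD // inord_neq //; lia.
  by rewrite msym_var tpermD // inord_neq //; lia.
Qed.

Lemma qrot2_hecke f : (0 < K)%N -> qrot (qrot (hecke 0 f)) = hecke K.-1 (qrot (qrot f)).
Proof.
move=> K0; apply: (@demazure_morph _ (fun f => qrot (qrot f)) q).
- by move=> g h; rewrite !qrotD.
- by move=> g h; rewrite !qrotM.
- by move=> c; rewrite !qrotC.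
- exact: inordS_neq.
- by apply: inordS_neq; lia.
- exact: q_neq0.
- by rewrite -/(xvar 0) qrot_var0 qrotZ -[in xvar K](prednK K0) qrot_varS //; lia.
- by rewrite -/(xvar 1) qrot_varS // qrot_var0 (prednK K0).
rewrite prednK //.
move=> j; have jK := ltn_ord j.
have rS k : (1 < k <= K)%N -> qrot (qrot (xvar k)) = xvar k.-2.
  by case: k => [|[|k]] // kK; rewrite !qrot_varS //; lia.
have r0 : qrot (qrot (xvar 0)) = q *: xvar K.-1.
  by rewrite qrot_var0 qrotZ -[in xvar K](prednK K0) qrot_varS //; lia.
have r1 : qrot (qrot (xvar 1)) = q *: xvar K by rewrite qrot_varS // qrot_var0.
case: tpermP => [->|->|j1 j2].
- by rewrite -!/(xvar _) r0 r1 msymZ msym_var tpermL.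
- by rewrite -!/(xvar _) r0 r1 msymZ msym_var tpermR.
- have ji1 : (j : nat) != 0%N by apply: contra_not_neq j1 => <-; rewrite inord_val.
  have ji2 : (j : nat) != 1%N by apply: contra_not_neq j2 => <-; rewrite inord_val.
  rewrite -(inord_val j) -/(xvar j) rS; last by lia.
  by rewrite msym_var tpermD // inord_neq //; lia.
Qed.

Definition evt f : F := f.@[fun i : 'I_K.+1 => t ^+ (K - i)].

Lemma evtD : {morph evt : f g / f + g >-> f + g}. Proof. exact: mevalD. Qed.
Lemma evtM : {morph evt : f g / f * g >-> f * g}. Proof. exact: mevalM. Qed.
Lemma evtZ c f : evt (c *: f) = c * evt f. Proof. exact: mevalZ. Qed.
Lemma evt1 : evt 1 = 1. Proof. exact: meval1. Qed.

Lemma evt_var i : (i <= K)%N -> evt (xvar i) = t ^+ (K - i).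
Proof. by move=> iK; rewrite /evt mevalXU inordK. Qed.

Hypotheses (t_neq0 : t != 0) (t_neq1 : t != 1).

(** At x_i = t x_(i+1) the coefficient x_i - t x_(i+1) of the transposed term vanishes, and the
    coefficient of f becomes 1. *)
Lemma evt_hecke i f : (i < K)%N -> evt (hecke i f) = evt f.
Proof.
move=> iK; have := congr1 evt (demazureE t (inord i) (inord i.+1) f).
have eN g : evt (- g) = - evt g by rewrite /evt mevalN.
have eC c : evt c%:MP = c by rewrite /evt mevalC.
rewrite !(evtM, evtD, eN, eC, evt1) -/(xvar i) -/(xvar i.+1) !evt_var //; last by lia.
rewrite -/(hecke i f) (_ : (K - i = (K - i.+1).+1)%N); last by lia.
rewrite !exprS subrr mul0r addr0.
have -> y : t * y - y = (t - 1) * y by rewrite mulrBl mul1r.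
apply: mulfI; rewrite mulf_neq0 ?expf_neq0 // subr_eq0 //.
Qed.

End Operators.
End HeckePolynomials.

(** * The affine Hecke algebra and the recursion for g *)

Section TopCoefficients.
Variable F : fieldType.

Lemma top_coefM (p r : {poly F}) a b : (size p <= a.+1)%N -> (size r <= b.+1)%N ->
  (size (p * r)%R <= (a + b).+1)%N /\ (p * r)`_(a + b) = p`_a * r`_b.
Proof.
move=> pa rb; split.
  apply: leq_trans (size_polyMleq _ _) _; lia.
have ab : (a < (a + b).+1)%N by lia.
rewrite coefM (bigD1 (Ordinal ab)) //= addKn big1 ?addr0 // => i.
rewrite -val_eqE /= => ia; have [ai|ai] := ltnP a i.
  by rewrite (leq_sizeP _ _ pa) ?mul0r.
by rewrite [r`__](leq_sizeP _ _ rb) ?mulr0 //; lia.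
Qed.

Lemma top_coef_prod n (p : nat -> {poly F}) (d : nat -> nat) :
  (forall i, (size (p i) <= (d i).+1)%N) ->
  (size (\prod_(i < n) p i)%R <= (\sum_(i < n) d i).+1)%N /\
  (\prod_(i < n) p i)`_(\sum_(i < n) d i)%N = \prod_(i < n) (p i)`_(d i).
Proof.
move=> pd; elim: n => [|n [IH1 IH2]]; first by rewrite !big_ord0 size_poly1 coef1.
by rewrite !big_ord_recr /= -IH2; apply: top_coefM.
Qed.

End TopCoefficients.

(** * Elementary symmetric functions of commuting operators *)

Section LinearOperators.
Variables (F : fieldType) (P : lmodType F).
Implicit Types (A B : P -> P) (f g : P).

Definition lin A := forall c f g, A (c *: f + g) = c *: A f + A g.

Lemma linD A : lin A -> forall f g, A (f + g) = A f + A g.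
Proof. by move=> L f g; rewrite -[f]scale1r L !scale1r. Qed.
Lemma lin0 A : lin A -> A 0 = 0.
Proof. by move=> L; apply: (addIr (A 0)); rewrite -linD // !add0r. Qed.
Lemma linZ A : lin A -> forall c f, A (c *: f) = c *: A f.
Proof. by move=> L c f; rewrite -[c *: f]addr0 L (lin0 L) addr0. Qed.
Lemma linN A : lin A -> forall f, A (- f) = - A f.
Proof. by move=> L f; rewrite -scaleN1r linZ // scaleN1r. Qed.
Lemma linB A : lin A -> forall f g, A (f - g) = A f - A g.
Proof. by move=> L f g; rewrite linD // linN. Qed.
Lemma lin_sum A : lin A -> forall (I : Type) (r : seq I) (p : pred I) E,
  A (\sum_(i <- r | p i) E i) = \sum_(i <- r | p i) A (E i).
Proof.
by move=> L I r p E; apply: (big_morph A); [exact: linD | exact: lin0].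
Qed.

Lemma lin_id : lin id. Proof. by []. Qed.
Lemma lin_comp A B : lin A -> lin B -> lin (fun f => A (B f)).
Proof. by move=> LA LB c f g; rewrite LB LA. Qed.
Lemma lin_add A B : lin A -> lin B -> lin (fun f => A f + B f).
Proof. by move=> LA LB c f g; rewrite LA LB scalerDr addrACA. Qed.
Lemma lin_scale a A : lin A -> lin (fun f => a *: A f).
Proof. by move=> LA c f g; rewrite LA scalerDr !scalerA mulrC. Qed.
Lemma lin_zero : lin (fun=> 0). Proof. by move=> c f g; rewrite scaler0 addr0. Qed.
Lemma lin_bigsum (I : Type) (r : seq I) (E : I -> P -> P) :
  (forall i, lin (E i)) -> lin (fun f => \sum_(i <- r) E i f).
Proof.
move=> L c f g; rewrite scaler_sumr -big_split /=; apply: eq_bigr => i _.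
exact: L.
Qed.

Definition commute_op A B := forall f, A (B f) = B (A f).

Fixpoint esym_op (s : seq (P -> P)) (j : nat) (f : P) {struct s} : P :=
  match s, j with
  | [::], 0 => f
  | [::], _.+1 => 0
  | _ :: _, 0 => f
  | A :: s', j'.+1 => esym_op s' j'.+1 f + A (esym_op s' j' f)
  end.

Lemma esym_op0 s f : esym_op s 0 f = f. Proof. by case: s. Qed.

Lemma esym_op_lin s j : (forall i, lin (nth id s i)) -> lin (esym_op s j).
Proof.
elim: s j => [|A s IH] [|j] Ls //=; first exact: lin_zero.
have Ls' i : lin (nth id s i) by have := Ls i.+1.
by apply: lin_add (IH _ Ls') (lin_comp (Ls 0%N) (IH _ Ls')).
Qed.

Lemma esym_op1 s f : esym_op s 1 f = \sum_(A <- s) A f.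
Proof. by elim: s => [|A s IH] /=; rewrite ?big_nil // big_cons IH esym_op0 addrC. Qed.

Lemma esym_op_over s j f : (forall i, lin (nth id s i)) -> (size s < j)%N -> esym_op s j f = 0.
Proof.
elim: s j => [|A s IH] [|j] //= Ls sj.
have Ls' i : lin (nth id s i) by have := Ls i.+1.
have /= L0 := Ls 0%N; rewrite (IH j.+1) // ?(IH j) ?(lin0 L0) ?addr0 //; lia.
Qed.

Lemma esym_op_comm B s j : lin B -> (forall i, i < size s -> commute_op B (nth id s i))%N ->
  commute_op B (esym_op s j).
Proof.
move=> LB; elim: s j => [|A s IH] [|j] Cs f //=; first exact: lin0.
have Cs' i : (i < size s)%N -> commute_op B (nth id s i) by move=> si; apply: (Cs i.+1).
by rewrite linD // (Cs 0%N) // !IH.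
Qed.

Lemma esym_op_intertwine B s1 s2 j f : lin B -> size s1 = size s2 ->
  (forall i f, i < size s1 -> nth id s1 i (B f) = B (nth id s2 i f))%N ->
  esym_op s1 j (B f) = B (esym_op s2 j f).
Proof.
move=> LB; elim: s1 s2 j => [|A1 s1 IH] [|A2 s2] // [|j] //= => [_ _|[ss] h]; first by rewrite lin0.
have h' i g : (i < size s1)%N -> nth id s1 i (B g) = B (nth id s2 i g) by move=> si; apply: (h i.+1).
have /= h0 g : A1 (B g) = B (A2 g) by apply: (h 0%N).
by rewrite (IH s2 _ ss h') (IH s2 _ ss h') h0 linD.
Qed.

Lemma esym_op_rcons s A j f : (forall i, lin (nth id s i)) -> lin A ->
  (forall i, i < size s -> commute_op A (nth id s i))%N ->
  esym_op (rcons s A) j.+1 f = esym_op s j.+1 f + A (esym_op s j f).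
Proof.
elim: s j => [|B s IH] j Ls LA Cs; first by [].
have Ls' i : lin (nth id s i) by have := Ls i.+1.
have Cs' i : (i < size s)%N -> commute_op A (nth id s i) by move=> si; apply: (Cs i.+1).
have /= LB := Ls 0%N; have /= CB := Cs 0%N isT.
rewrite /= IH //; case: j => [|j].
  by rewrite !esym_op0 addrAC.
rewrite IH // (linD LB) (linD LA) CB.
by rewrite !addrA; congr (_ + _); rewrite addrAC.
Qed.

(** With the other factors fixed, e_j depends on the two adjacent operators only through their sum
    and product. This is applied to T_i, with Y_i and Y_(i+1) as the pair. *)
Lemma esym_op_pair B A1 A2 s1 s2 j : lin B -> lin A1 -> lin A2 ->
  (forall i, lin (nth id s2 i)) ->
  (forall i, i < size s1 -> commute_op B (nth id s1 i))%N ->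
  (forall i, i < size s2 -> commute_op B (nth id s2 i))%N ->
  commute_op B (fun f => A1 f + A2 f) -> commute_op B (fun f => A1 (A2 f)) ->
  commute_op B (esym_op (s1 ++ A1 :: A2 :: s2) j).
Proof.
move=> LB L1 L2 Ls2 C1 C2 CD CM.
elim: s1 j C1 => [|A s1 IH] j C1 f; last first.
  case: j => [|j] //=; have C1' i : (i < size s1)%N -> commute_op B (nth id s1 i).
    by move=> si; apply: (C1 i.+1).
  by rewrite linD // (C1 0%N) // !IH.
have C2' k g : B (esym_op s2 k g) = esym_op s2 k (B g) by apply: esym_op_comm.
have CD' g : B (A1 g) + B (A2 g) = A1 (B g) + A2 (B g) by rewrite -(linD LB) CD.
have CM' g : B (A1 (A2 g)) = A1 (A2 (B g)) by rewrite CM.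
case: j => [|[|j]] //=; rewrite ?esym_op0.
  by rewrite !(linD LB) C2' -!addrA; congr (_ + _); rewrite addrC CD' addrC.
rewrite !(linD L1) !(linD LB) CM' !C2' -!addrA; congr (_ + _).
by rewrite !addrA -!C2' [B (A2 _) + _]addrC CD' [A1 _ + _]addrC.
Qed.

End LinearOperators.

(** * Relations of the affine Hecke algebra and Cherednik operators *)

Section AffineHecke.
Variables (F : fieldType) (q t : F) (P : comAlgType F) (K : nat).
Variables (x : nat -> P) (T : nat -> P -> P) (w wV : P -> P).
Implicit Types (f g h : P) (i j k n a b : nat).

Hypothesis t_neq0 : t != 0.
Hypothesis q_neq0 : q != 0.
Hypothesis q_nroot : forall k, 1 - q ^+ k.+1 != 0.
Hypothesis T_lin : forall i, (i < K)%N -> lin (T i).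
Hypothesis T_quad : forall i f, (i < K)%N -> T i (T i f) = (1 - t) *: T i f + t *: f.
Hypothesis T_comm : forall i j f, (i.+1 < j)%N -> (j < K)%N -> T i (T j f) = T j (T i f).
Hypothesis T_braid : forall i f, (i.+1 < K)%N ->
  T i (T i.+1 (T i f)) = T i.+1 (T i (T i.+1 f)).
Hypothesis T_var : forall i j f, (i < K)%N -> (j <= K)%N -> j != i -> j != i.+1 ->
  T i (x j * f) = x j * T i f.
Hypothesis T_varl : forall i f, (i < K)%N ->
  T i (x i * f) = x i.+1 * (T i f + (t - 1) *: f).
Hypothesis T_varr : forall i f, (i < K)%N ->
  T i (x i.+1 * f) = x i * T i f + (1 - t) *: (x i.+1 * f).
Hypothesis T_one : forall i, (i < K)%N -> T i 1 = 1.
Hypothesis w_lin : lin w.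
Hypothesis w_one : w 1 = 1.
Hypothesis w_var0 : forall f, w (x 0 * f) = q *: (x K * w f).
Hypothesis w_varS : forall i f, (i < K)%N -> w (x i.+1 * f) = x i * w f.
Hypothesis wK : cancel w wV.
Hypothesis wVK : cancel wV w.
Hypothesis w_T : forall i f, (i.+1 < K)%N -> w (T i.+1 f) = T i (w f).
Hypothesis w2_T : forall f, (0 < K)%N -> w (w (T 0 f)) = T K.-1 (w (w f)).

(** By the quadratic relation this is t T_i^(-1), see [T_Tb] and [Tb_T]. *)
Definition Tb i f := T i f + (t - 1) *: f.

Lemma Tb_lin i : (i < K)%N -> lin (Tb i).
Proof. by move=> iK; apply: lin_add (T_lin iK) (lin_scale _ (@lin_id _ _)). Qed.

Lemma TbE i f : (i < K)%N -> T i f = Tb i f + (1 - t) *: f.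
Proof. by move=> iK; rewrite /Tb -addrA -scalerDl addrC; rewrite addrA subrK subrr scale0r add0r. Qed.

Lemma T_Tb i f : (i < K)%N -> T i (Tb i f) = t *: f.
Proof.
move=> iK; rewrite /Tb (linD (T_lin iK)) (linZ (T_lin iK)) T_quad // addrAC -scalerDl.
by rewrite addrC -opprB addNr scale0r addr0.
Qed.

Lemma Tb_T i f : (i < K)%N -> Tb i (T i f) = t *: f.
Proof.
by move=> iK; rewrite /Tb T_quad // addrAC -scalerDl -(opprB t 1) addNr scale0r add0r.
Qed.

Lemma T_inj i : (i < K)%N -> injective (T i).
Proof.
move=> iK f g /(congr1 (Tb i)); rewrite !Tb_T // => /(congr1 (fun h => t^-1 *: h)).
by rewrite !scalerA mulVf // !scale1r.
Qed.

Lemma Tb_comm A i : lin A -> commute_op A (T i) -> commute_op A (Tb i).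
Proof. by move=> LA C f; rewrite /Tb linD // linZ // C. Qed.

Lemma x_Tb i f : (i < K)%N -> x i.+1 * Tb i f = T i (x i * f).
Proof. by move=> iK; rewrite T_varl. Qed.

Lemma x_T i f : (i < K)%N -> x i * T i f = Tb i (x i.+1 * f).
Proof. by move=> iK; rewrite /Tb T_varr // -addrA -scalerDl -(opprB t 1) addNr scale0r addr0. Qed.

Lemma Tb_var i j f : (i < K)%N -> (j <= K)%N -> j != i -> j != i.+1 ->
  Tb i (x j * f) = x j * Tb i f.
Proof. by move=> *; rewrite /Tb T_var // mulrDr scalerAr. Qed.

Fixpoint tup a n f := if n is n'.+1 then T a (tup a.+1 n' f) else f.
Fixpoint tbup a n f := if n is n'.+1 then Tb a (tbup a.+1 n' f) else f.

Lemma tup_lin a n : (a + n <= K)%N -> lin (tup a n).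
Proof.
elim: n a => [|n IH] a an; first exact: lin_id.
by apply: lin_comp; [apply: T_lin | apply: IH]; lia.
Qed.

Lemma tbup_lin a n : (a + n <= K)%N -> lin (tbup a n).
Proof.
elim: n a => [|n IH] a an; first exact: lin_id.
by apply: lin_comp; [apply: Tb_lin | apply: IH]; lia.
Qed.

Lemma tup_rcons a n f : tup a n (T (a + n) f) = tup a n.+1 f.
Proof. by elim: n a => [|n IH] a /=; rewrite ?addn0 // -addSnnS IH. Qed.

Lemma tbup_rcons a n f : tbup a n (Tb (a + n) f) = tbup a n.+1 f.
Proof. by elim: n a => [|n IH] a /=; rewrite ?addn0 // -addSnnS IH. Qed.

Lemma tup_inj a n : (a + n <= K)%N -> injective (tup a n).
Proof.
elim: n a => [|n IH] a an f g //= /T_inj; first by rewrite /=; move=> E; apply: (IH a.+1); [lia | apply: E; lia].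
Qed.

Lemma tup_comm A a n : (forall i, a <= i < a + n -> commute_op A (T i))%N ->
  commute_op A (tup a n).
Proof.
elim: n a => [|n IH] a C f //=; rewrite C; last by lia.
by rewrite IH // => i ai; apply: C; lia.
Qed.

Lemma tup_T_far a n j f : (j.+1 < a)%N -> (a + n <= K)%N ->
  T j (tup a n f) = tup a n (T j f).
Proof. by move=> ja an; apply: tup_comm => i ai g; apply: T_comm; lia. Qed.

(** Conjugation form of the braid relation: an ascending word moves past an interior T_j and raises
    its index by one. *)
Lemma tup_T a n j f : (a <= j)%N -> (j.+1 < a + n)%N -> (a + n <= K)%N ->
  tup a n (T j f) = T j.+1 (tup a n f).
Proof.
elim: n a => [|n IH] a aj jn an; first by lia.
have [ja|ja] := eqVneq j a; last first.
  by rewrite /= IH ?[T a (T _ _)]T_comm //; lia.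
subst j; case: n IH jn an => [|n] IH jn an; first by lia.
by rewrite /= -tup_T_far ?T_braid //; lia.
Qed.

Lemma tup_shift a n b m f : (a <= b)%N -> (b + m < a + n)%N -> (a + n <= K)%N ->
  tup a n (tup b m f) = tup b.+1 m (tup a n f).
Proof.
elim: m b => [|m IH] b ab bm an //=.
by rewrite tup_T ?IH //; lia.
Qed.

Lemma w_tup a n f : (a.+1 + n <= K)%N -> w (tup a.+1 n f) = tup a n (w f).
Proof.
elim: n a => [|n IH] a an //=; rewrite w_T ?IH //; lia.
Qed.

Lemma x_tup a n f : (a + n <= K)%N -> x a * tup a n f = tbup a n (x (a + n) * f).
Proof.
elim: n a => [|n IH] a an /=; first by rewrite addn0.
by rewrite x_T ?IH 1?addSnnS //; lia.
Qed.

Lemma tup_var a n j f : (a + n <= K)%N -> (j <= K)%N -> (j < a)%N || (a + n < j)%N ->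
  tup a n (x j * f) = x j * tup a n f.
Proof.
elim: n a => [|n IH] a an jK ja //=; rewrite IH ?T_var //; lia.
Qed.

Lemma tup_one a n : (a + n <= K)%N -> tup a n 1 = 1.
Proof. by elim: n a => [|n IH] a an //=; rewrite IH ?T_one //; lia. Qed.

(** Cherednik operators: Y_0 = T_0 ... T_(K-1) w and Y_(i+1) = t T_i^(-1) Y_i T_i^(-1). *)
Fixpoint Y i f := if i is i'.+1 then t^-1 *: Tb i' (Y i' (Tb i' f)) else tup 0 K (w f).

Lemma Y_lin i : (i <= K)%N -> lin (Y i).
Proof.
elim: i => [|i IH] iK /=; first by apply: lin_comp w_lin; apply: tup_lin.
apply: lin_scale; apply: lin_comp; first exact: Tb_lin.
by apply: lin_comp; [apply: IH; lia | apply: Tb_lin].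
Qed.

Lemma YE i f : (i <= K)%N -> Y i f = tup i (K - i) (w (tbup 0 i f)).
Proof.
elim: i f => [|i IH] f iK; first by rewrite subn0.
rewrite [LHS]/= IH; last by lia.
rewrite -[Tb i f]/(Tb (0 + i) f) tbup_rcons (_ : (K - i = (K - i.+1).+1)%N); last by lia.
by rewrite [tup i _ _]/= Tb_T // scalerA mulVf // scale1r.
Qed.

Lemma T_YS i f : (i < K)%N -> T i (Y i.+1 f) = Y i (Tb i f).
Proof. by move=> iK; rewrite /= (linZ (T_lin iK)) T_Tb // scalerA mulVf // scale1r. Qed.

Lemma YS_T i f : (i < K)%N -> Y i.+1 (T i f) = Tb i (Y i f).
Proof.
move=> iK; rewrite /= Tb_T // (linZ (Y_lin (ltnW iK))) (linZ (Tb_lin iK)) scalerA mulVf //.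
by rewrite scale1r.
Qed.

Lemma TTb2 j f : (j.+1 < K)%N -> T j (Tb j.+1 (Tb j f)) = Tb j.+1 (Tb j (T j.+1 f)).
Proof.
move=> jK; have jK' : (j < K)%N by lia.
rewrite /Tb !(linD (T_lin jK), linD (T_lin jK'), linZ (T_lin jK), linZ (T_lin jK')).
rewrite T_braid // !T_quad // !scalerDr.
have Z z : (t - 1) *: ((1 - t) *: z) + (t - 1) *: ((t - 1) *: z) = 0 :> P.
  by rewrite -scalerDr -scalerDl addrA subrK subrr scale0r scaler0.
by rewrite [RHS]addrACA (addrAC (_ *: (_ *: T j.+1 f))) (addrAC (_ *: (_ *: T j f))) !Z.
Qed.

Lemma TTb2' j f : (j.+1 < K)%N -> T j.+1 (Tb j (Tb j.+1 f)) = Tb j (Tb j.+1 (T j f)).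
Proof.
move=> jK; have jK' : (j < K)%N by lia.
rewrite /Tb !(linD (T_lin jK), linD (T_lin jK'), linZ (T_lin jK), linZ (T_lin jK')).
rewrite T_braid // !T_quad // !scalerDr.
have Z z : (t - 1) *: ((1 - t) *: z) + (t - 1) *: ((t - 1) *: z) = 0 :> P.
  by rewrite -scalerDr -scalerDl addrA subrK subrr scale0r scaler0.
by rewrite [RHS]addrACA (addrAC (_ *: (_ *: T j f))) (addrAC (_ *: (_ *: T j.+1 f))) !Z.
Qed.

Lemma T_Y_gt i j f : (i < j)%N -> (j < K)%N -> T j (Y i f) = Y i (T j f).
Proof.
move=> ij jK; elim: i ij f => [|i IH] ij f /=.
  case: j ij jK => // j _ jK.
  by rewrite w_T // tup_T.
have iK : (i < K)%N by lia.
have C : commute_op (T j) (Tb i).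
  by apply: Tb_comm; [apply: T_lin | move=> g; rewrite -T_comm //; lia].
rewrite (linZ (T_lin jK)) C IH ?C //; lia.
Qed.

Lemma T_Y_lt i j f : (j.+1 < i)%N -> (i <= K)%N -> T j (Y i f) = Y i (T j f).
Proof.
move=> ji; elim: i ji f => // i IH ji f iK.
have [ij|ij] := eqVneq i j.+1.
  subst i; have jK : (j < K)%N by lia.
  rewrite /= !(linZ (T_lin jK)) !(linZ (Tb_lin iK)) !(linZ (T_lin jK)) TTb2 //.
  by rewrite T_Y_gt // TTb2'.
have C : commute_op (T j) (Tb i).
  by apply: Tb_comm; [apply: T_lin; lia | move=> g; rewrite T_comm //; lia].
rewrite /= (linZ (T_lin _)) ?C ?IH ?C //; lia.
Qed.

(** With Q = T_1 ... T_(K-1) w one has Y_0 = T_0 Q and Y_1 = Q Tb_0, and T_0 commutes with Q Q; both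
    products are therefore t Q Q. *)
Lemma Y01_comm f : (0 < K)%N -> Y 0 (Y 1 f) = Y 1 (Y 0 f).
Proof.
move=> K0; pose Q g := tup 1 K.-1 (w g).
have Y0E g : Y 0 g = T 0 (Q g) by rewrite /= -[in tup 0 _](prednK K0).
have LQ : lin Q by apply: lin_comp w_lin; apply: tup_lin; lia.
have Y1E g : Y 1 g = Q (Tb 0 g) by rewrite YE // subn1.
have TQQ g : T 0 (Q (Q g)) = Q (Q (T 0 g)).
  have QQ h : Q (Q h) = tup 1 K.-1 (tup 0 K.-1 (w (w h))).
    by rewrite /Q w_tup //; lia.
  rewrite !QQ -[LHS]/(tup 0 K.-1.+1 _) prednK // tup_shift //; try lia.
  rewrite w2_T // -{3}[K.-1]add0n tup_rcons prednK //.
by rewrite Y0E !Y1E Y0E Tb_T // (linZ LQ) TQQ T_Tb // !(linZ LQ).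
Qed.

Lemma Y_comm_lt i j f : (i < j)%N -> (j <= K)%N -> Y i (Y j f) = Y j (Y i f).
Proof.
(* Commutation with the next operator propagates upwards, because Y_(l+1) is built from Y_l and
   Tb_l, and Tb_l commutes with Y_k for k < l. *)
have ext k : (forall g, (k < K)%N -> Y k (Y k.+1 g) = Y k.+1 (Y k g)) ->
    forall l g, (k < l)%N -> (l <= K)%N -> Y k (Y l g) = Y l (Y k g).
  move=> H; elim=> // l IH g kl lK.
  have [kl'|kl'] := eqVneq l k; first by subst l; apply: H.
  have C : commute_op (Y k) (Tb l).
    apply: Tb_comm; first by apply: Y_lin; lia.
    by move=> h; rewrite T_Y_gt //; lia.
  rewrite [Y l.+1 g]/= [Y l.+1 (Y k g)]/= (linZ (Y_lin _)) ?C ?IH ?C //; lia.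
move=> ij jK; apply: (ext) => // {j ij jK}.
elim: i => [|i IH] g iK; first by rewrite Y01_comm.
have C1 h : Y i.+2 (Y i h) = Y i (Y i.+2 h) by rewrite (ext i) // => k kK; apply: IH.
have C2 : commute_op (Y i.+2) (Tb i).
  apply: Tb_comm; first by apply: Y_lin.
  by move=> h; rewrite T_Y_lt.
rewrite [Y i.+1 (Y i.+2 g)]/= [Y i.+1 g]/= (linZ (Y_lin iK)) C2 C1 C2 //.
Qed.

Lemma Y_comm i j f : (i <= K)%N -> (j <= K)%N -> Y i (Y j f) = Y j (Y i f).
Proof.
move=> iK jK; have [ij|ji|->] := ltngtP i j; last by [].
- exact: Y_comm_lt.
- by rewrite [RHS]Y_comm_lt.
Qed.

Lemma T_Y_sum i f : (i < K)%N -> T i (Y i f + Y i.+1 f) = Y i (T i f) + Y i.+1 (T i f).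
Proof.
move=> iK; have LY := Y_lin (ltnW iK).
have E : Y i (Tb i f) = Y i (T i f) + (t - 1) *: Y i f by rewrite /Tb (linD LY) (linZ LY).
rewrite (linD (T_lin iK)) T_YS // YS_T // (TbE (Y i f) iK) E addrACA -scalerDl.
by rewrite addrA subrK subrr scale0r addr0 addrC.
Qed.

Lemma T_Y_prod i f : (i < K)%N -> T i (Y i (Y i.+1 f)) = Y i (Y i.+1 (T i f)).
Proof.
by move=> iK; rewrite (Y_comm _ (ltnW iK) iK) T_YS // -YS_T.
Qed.

(** A raising operator in the manner of Knop and Sahi: it shifts the Y_i cyclically, multiplying one
    of them by q ([Y_ypi], [YK_ypi]), and raises the degree by one. *)
Definition ypi f := x K * w f.

Lemma ypi_lin : lin ypi.
Proof. by move=> c f g; rewrite /ypi w_lin mulrDr scalerAr. Qed.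

Lemma Y_ypi i f : (i < K)%N -> Y i (ypi f) = ypi (Y i.+1 f).
Proof.
have Tpi j g : (j.+1 < K)%N -> T j (ypi g) = ypi (T j.+1 g).
  by move=> jK; rewrite /ypi w_T // T_var //; lia.
elim: i f => [|i IH] f iK.
  have wx : w (x K * w f) = x K.-1 * w (w f).
    by rewrite -{1}(prednK iK) w_varS //; lia.
  rewrite [LHS]/= /ypi wx -[in tup 0 K](prednK iK) -tup_rcons add0n -x_Tb; last by lia.
  rewrite prednK // tup_var; try lia.
  congr (_ * _); rewrite YE // subn1 w_tup; last by lia.
  by congr tup; rewrite /Tb /= /Tb !(linD w_lin) !(linZ w_lin) w2_T.
have Tbpi g : Tb i (ypi g) = ypi (Tb i.+1 g).
  by rewrite /Tb Tpi // (linD ypi_lin) (linZ ypi_lin).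
by rewrite /= Tbpi IH ?(ltnW iK) // Tbpi (linZ ypi_lin).
Qed.

Lemma YK_ypi f : Y K (ypi f) = q *: ypi (Y 0 f).
Proof.
by rewrite YE // subnn /= /ypi -[K in x K]add0n -x_tup // w_var0.
Qed.

(** * Symmetric functions of the Y_i and the homogeneous Gaussian operators *)

Definition Yseq := [seq Y i | i <- iota 0 K.+1].
Definition YSseq := [seq Y i | i <- iota 1 K].
Definition eY j := esym_op Yseq j.
Definition eYS j := esym_op YSseq j.

Fixpoint esym_scalar (s : seq F) (j : nat) {struct s} : F :=
  match s, j with
  | [::], 0 => 1
  | [::], _.+1 => 0
  | _ :: _, 0 => 1
  | a :: s', j'.+1 => esym_scalar s' j'.+1 + a * esym_scalar s' j'
  end.

Definition cT j := esym_scalar [seq t ^+ i | i <- iota 0 K.+1] j.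

Lemma nth_Yseq i : (i <= K)%N -> nth id Yseq i = Y i.
Proof. by move=> iK; rewrite (nth_map 0%N) ?size_iota // nth_iota. Qed.

Lemma nth_YSseq i : (i < K)%N -> nth id YSseq i = Y i.+1.
Proof. by move=> iK; rewrite (nth_map 0%N) ?size_iota // nth_iota. Qed.

Lemma nth_Yseq_lin i : lin (nth id Yseq i).
Proof.
have [iK|iK] := leqP i K; first by rewrite nth_Yseq //; apply: Y_lin.
by rewrite nth_default ?size_map ?size_iota //; apply: lin_id.
Qed.

Lemma nth_YSseq_lin i : lin (nth id YSseq i).
Proof.
have [iK|iK] := ltnP i K; first by rewrite nth_YSseq //; apply: Y_lin.
by rewrite nth_default ?size_map ?size_iota //; apply: lin_id.
Qed.

Lemma eY_lin j : lin (eY j). Proof. exact: esym_op_lin nth_Yseq_lin. Qed.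
Lemma eYS_lin j : lin (eYS j). Proof. exact: esym_op_lin nth_YSseq_lin. Qed.

Lemma eYE j f : eY j.+1 f = eYS j.+1 f + Y 0 (eYS j f).
Proof. by []. Qed.

Lemma eY_Y i j f : (i <= K)%N -> Y i (eY j f) = eY j (Y i f).
Proof.
move=> iK; apply: esym_op_comm => [|k]; first exact: Y_lin.
by rewrite size_map size_iota ltnS => kK g; rewrite nth_Yseq // Y_comm.
Qed.

Lemma eYS_Y i j f : (i <= K)%N -> Y i (eYS j f) = eYS j (Y i f).
Proof.
move=> iK; apply: esym_op_comm => [|k]; first exact: Y_lin.
by rewrite size_map size_iota => kK g; rewrite nth_YSseq // Y_comm.
Qed.

Lemma eY_T i j f : (i < K)%N -> T i (eY j f) = eY j (T i f).
Proof.
move=> iK.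
have E : Yseq = [seq Y k | k <- iota 0 i] ++ Y i :: Y i.+1 :: [seq Y k | k <- iota i.+2 (K - i.+1)].
  rewrite /Yseq (_ : K.+1 = i + (K - i.+1).+2)%N; last by lia.
  by rewrite iotaD map_cat.
rewrite /eY E; apply: esym_op_pair; first exact: T_lin.
- exact/Y_lin/ltnW.
- exact: Y_lin.
- move=> k; have [kK|kK] := ltnP k (K - i.+1); last first.
    by rewrite nth_default ?size_map ?size_iota //; apply: lin_id.
  by rewrite (nth_map 0%N) ?size_iota // nth_iota //; apply: Y_lin; lia.
- move=> k; rewrite size_map size_iota => kK g.
  by rewrite (nth_map 0%N) ?size_iota // nth_iota // T_Y_gt.
- move=> k; rewrite size_map size_iota => kK g.
  by rewrite (nth_map 0%N) ?size_iota // nth_iota // T_Y_lt //; lia.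
- by move=> g; apply: T_Y_sum.
- by move=> g; apply: T_Y_prod.
Qed.

Lemma eY_ypi j f : eY j.+1 (ypi f) = ypi (eYS j.+1 f + q *: Y 0 (eYS j f)).
Proof.
have E : Yseq = rcons [seq Y k | k <- iota 0 K] (Y K).
  by rewrite /Yseq -addn1 iotaD map_cat cats1.
have H k g : esym_op [seq Y k | k <- iota 0 K] k (ypi g) = ypi (eYS k g).
  apply: esym_op_intertwine; [exact: ypi_lin | by rewrite !size_map !size_iota |].
  move=> i h; rewrite size_map size_iota => iK.
  by rewrite nth_YSseq // (nth_map 0%N) ?size_iota // nth_iota // Y_ypi.
rewrite /eY E esym_op_rcons ?H ?YK_ypi -?(linZ ypi_lin) -?(linD ypi_lin) //.
- move=> i; have [iK|iK] := ltnP i K; last first.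
    by rewrite nth_default ?size_map ?size_iota //; apply: lin_id.
  by rewrite (nth_map 0%N) ?size_iota // nth_iota //; apply/Y_lin/ltnW.
- exact: Y_lin.
- move=> i; rewrite size_map size_iota => iK g.
  by rewrite (nth_map 0%N) ?size_iota // nth_iota // Y_comm //; lia.
Qed.

(* On polynomials of degree n, the operator u_n = utab n n is the Gaussian       *)
(* operator which implements nabla. The family u is the solution of              *)
(* sum_j (q^(k-j) c_j - e_j) u_(k-j) = 0, where e_j and c_j are the elementary   *)
(* symmetric functions of the Y_i and of the t^i.                                *)
Fixpoint utab n k f : P :=
  if n is n'.+1 then
    if (k <= n')%N then utab n' k f else (1 - q ^+ n'.+1)^-1 *:
      \sum_(j < n'.+1) ((q ^+ (n' - j) * cT j.+1) *: utab n' (n' - j) f -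
                         eY j.+1 (utab n' (n' - j) f))
  else f.
Definition u k f := utab k k f.

Lemma utabE n k f : (k <= n)%N -> utab n k f = u k f.
Proof.
elim: n => [|n IH]; first by case: k.
rewrite leq_eqVlt => /predU1P[->//|kn] /=.
by rewrite -ltnS kn IH.
Qed.

Lemma u0 f : u 0 f = f. Proof. by []. Qed.

Lemma uS k f : (1 - q ^+ k.+1) *: u k.+1 f =
  \sum_(j < k.+1) ((q ^+ (k - j) * cT j.+1) *: u (k - j) f - eY j.+1 (u (k - j) f)).
Proof.
rewrite {1}/u /= ltnn scalerA mulfV // scale1r.
by apply: eq_bigr => j _; rewrite !utabE // leq_subr.
Qed.

Lemma u_ind (Q : nat -> Prop) : Q 0%N ->
  (forall k, (forall j, (j <= k)%N -> Q j) -> Q k.+1) -> forall k, Q k.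
Proof.
move=> Q0 QS k; have [n] := ubnP k; elim: n k => // n IH [|k] kn //.
by apply: QS => j jk; apply: IH; lia.
Qed.

Lemma scale_inj (a : F) : a != 0 -> injective (fun f : P => a *: f).
Proof.
by move=> a0 f g /(congr1 (fun h => a^-1 *: h)); rewrite !scalerA mulVf // !scale1r.
Qed.

Lemma u_lin k : lin (u k).
Proof.
elim/u_ind: k => [|k IH]; first exact: lin_id.
move=> c f g; apply: (scale_inj (q_nroot k)); rewrite scalerDr scalerA mulrC -scalerA !uS.
rewrite scaler_sumr -big_split; apply: eq_bigr => j _.
have L : lin (u (k - j)) by apply: IH; apply: leq_subr.
rewrite /= L (eY_lin j.+1) scalerDr scalerBr !scalerA mulrC opprD addrACA.
by rewrite mulrC.
Qed.

Lemma u_comm A k : lin A -> (forall j, commute_op A (eY j)) -> commute_op A (u k).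
Proof.
move=> LA C; elim/u_ind: k => [|k IH] f //.
apply: (scale_inj (q_nroot k)); rewrite -(linZ LA) !uS (lin_sum LA).
by apply: eq_bigr => j _; rewrite (linB LA) (linZ LA) C IH // leq_subr.
Qed.

Lemma u_T i k f : (i < K)%N -> T i (u k f) = u k (T i f).
Proof. by move=> iK; apply: u_comm => [|j g]; [apply: T_lin | apply: eY_T]. Qed.

Lemma u_Y i k f : (i <= K)%N -> Y i (u k f) = u k (Y i f).
Proof. by move=> iK; apply: u_comm => [|j g]; [apply: Y_lin | apply: eY_Y]. Qed.

#[local] Arguments Y : simpl never.

(** Put U(z) = sum u_k z^k, C(z) = sum cT_j z^j and E(z) = sum e_j(Y) z^j. The recursion reads C(z)
    U(q z) = E(z) U(z), and the claim is U(z) ypi = ypi (1 + Y_0 z) U(z). By [eY_ypi] the right-hand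
    side satisfies the same equation with the same constant term, and the solution is unique because
    no 1 - q^(k+1) vanishes. *)
Lemma u_ypi k f : u k.+1 (ypi f) = ypi (u k.+1 f + Y 0 (u k f)).
Proof.
suff : u k (ypi f) = ypi (u k f + (if k is k'.+1 then Y 0 (u k' f) else 0)) /\
    u k.+1 (ypi f) = ypi (u k.+1 f + Y 0 (u k f)) by case.
elim/u_ind: k => [|k IH].
  split; first by rewrite !u0 addr0.
  apply: (scale_inj (q_nroot 0)); rewrite -(linZ ypi_lin) scalerDr !uS !big_ord1 !subn0 !u0.
  rewrite -(linZ ypi_lin) eY_ypi -(linB ypi_lin); congr ypi.
  have e0 : eYS 0 f = f by apply: esym_op0.
  rewrite eYE /= e0 expr1 scalerBl scale1r !opprD -!addrA; congr (_ + (_ + _)).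
  by rewrite addKr.
have [_ IHk] := IH _ (leqnn k); split; first exact: IHk.
set m := k.+1; rewrite -/m in IHk.
(* [um j] is u_(k-j), with 0 in place of the missing u_(-1) at j = m. *)
pose um j := if (j < m)%N then u (k - j) f else 0.
have B j : (j <= m)%N -> u (m - j) (ypi f) = ypi (u (m - j) f + Y 0 (um j)).
  rewrite /um leq_eqVlt => /predU1P[->|jm].
    by rewrite ltnn subnn !u0 (lin0 (Y_lin _)) // addr0.
  rewrite jm (_ : (m - j = (k - j).+1)%N); last by rewrite /m; lia.
  by have [_ ->] := IH (k - j)%N (leq_subr _ _).
have L0 := Y_lin (leq0n K).
pose A1 := \sum_(j < m.+1) (q ^+ (m - j) * cT j.+1) *: u (m - j) f.
pose A2 := \sum_(j < m) (q ^+ (k - j) * cT j.+1) *: u (k - j) f.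
pose D1 := \sum_(j < m.+1) eYS j.+1 (u (m - j) f).
pose D0 := \sum_(j < m.+1) eYS j (u (m - j) f).
pose D1' := \sum_(j < m) eYS j.+1 (u (k - j) f).
pose D0' := \sum_(j < m) eYS j (u (k - j) f).
have E1 : (1 - q ^+ m.+1) *: u m.+1 f = A1 - (D1 + Y 0 D0).
  by rewrite /D0 (lin_sum L0) uS sumrB -big_split.
have E2 : (1 - q ^+ m) *: u m f = A2 - (D1' + Y 0 D0').
  by rewrite /D0' (lin_sum L0) uS sumrB -big_split.
have E3 : D0 = u m f + D1'.
  rewrite /D0 big_ord_recl subn0 [eYS _ _]esym_op0; congr (_ + _).
have um0 (E : nat -> P -> P) : (forall j, lin (E j)) ->
    \sum_(j < m.+1) E j (um j) = \sum_(j < m) E j (u (k - j) f).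
  move=> LE; rewrite big_ord_recr /= /um ltnn (lin0 (LE _)) addr0.
  by apply: eq_bigr => j _; rewrite ltn_ord.
apply: (scale_inj (q_nroot m)); rewrite uS -(linZ ypi_lin).
transitivity (ypi (A1 + q *: Y 0 A2 - (D1 + Y 0 D1') - q *: (Y 0 D0 + Y 0 (Y 0 D0')))).
  have F1 : A1 + q *: Y 0 A2 =
      \sum_(j < m.+1) (q ^+ (m - j) * cT j.+1) *: (u (m - j) f + Y 0 (um j)).
    under [RHS]eq_bigr do rewrite scalerDr; rewrite big_split /=; congr (_ + _).
    rewrite (um0 (fun j h => (q ^+ (m - j) * cT j.+1) *: Y 0 h)); last first.
      by move=> j; apply: lin_scale.
    rewrite (lin_sum L0) scaler_sumr; apply: eq_bigr => j _.
    rewrite (linZ L0) scalerA mulrA -exprS; congr ((q ^+ _ * _) *: _).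
    by rewrite /m subSn // -ltnS; apply: ltn_ord.
  have F2 : D1 + Y 0 D1' = \sum_(j < m.+1) eYS j.+1 (u (m - j) f + Y 0 (um j)).
    under [RHS]eq_bigr do rewrite (linD (eYS_lin _)); rewrite big_split /=; congr (_ + _).
    rewrite (um0 (fun j h => eYS j.+1 (Y 0 h))); last first.
      by move=> j; apply: lin_comp (L0); apply: eYS_lin.
    by rewrite (lin_sum L0); apply: eq_bigr => j _; rewrite eYS_Y.
  have F3 : Y 0 D0 + Y 0 (Y 0 D0') =
      \sum_(j < m.+1) Y 0 (eYS j (u (m - j) f + Y 0 (um j))).
    under [RHS]eq_bigr do rewrite (linD (eYS_lin _)) (linD L0); rewrite big_split /=.
    rewrite (lin_sum L0); congr (_ + _).
    rewrite (um0 (fun j h => Y 0 (eYS j (Y 0 h)))); last first.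
      by move=> j; apply: lin_comp (L0) _; apply: lin_comp (L0); apply: eYS_lin.
    by rewrite !(lin_sum L0); apply: eq_bigr => j _; rewrite eYS_Y.
  rewrite F1 F2 F3 scaler_sumr -addrA -opprD -big_split -sumrB (lin_sum ypi_lin).
  apply: eq_bigr => j _; rewrite B -1?ltnS //= -(linZ ypi_lin) eY_ypi.
  by rewrite -(linB ypi_lin).
congr ypi; rewrite [RHS]scalerDr E1.
have {}E2 : Y 0 A2 = (1 - q ^+ m) *: Y 0 (u m f) + (Y 0 D1' + Y 0 (Y 0 D0')).
  by rewrite -(linZ L0) E2 -!(linD L0) subrK.
rewrite E2 E3 (linD L0).
move: (Y 0 (u m f)) (Y 0 D1') (Y 0 (Y 0 D0')) => a b c.
rewrite exprS; move: (q ^+ m) A1 D1 {E1 E2 E3} => Z A1 D1.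
have E z v : z *: v = in_alg P z * v by rewrite mulr_algl.
rewrite !E !rmorphB !rmorphM rmorph1 /=; move: (q%:A : P) (Z%:A : P) => Q' Z'; ring.
Qed.

#[local] Arguments Y : simpl nomatch.

Lemma Y_one i : (i <= K)%N -> Y i 1 = t ^+ i *: 1.
Proof.
elim: i => [|i IH] iK; first by rewrite /= w_one tup_one // scale1r.
have Tb1 : Tb i 1 = t *: 1 by rewrite /Tb T_one // -[X in X + _]scale1r -scalerDl addrC subrK.
rewrite /= Tb1 (linZ (Y_lin _)) ?IH ?(ltnW iK) // !(linZ (Tb_lin iK)) Tb1 !scalerA.
by rewrite exprS mulKf // mulrC.
Qed.

Lemma esym_op_eigen (s : seq (P -> P)) (r : seq F) j f : size s = size r ->
  (forall i, lin (nth id s i)) ->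
  (forall i, (i < size s)%N -> nth id s i f = nth 0 r i *: f) ->
  esym_op s j f = esym_scalar r j *: f.
Proof.
elim: s r j => [|A s IH] [|a r] // [|j] //=; rewrite ?scale1r ?scale0r // => - [sr] Ls h.
have Ls' i : lin (nth id s i) by have := Ls i.+1.
have h' i : (i < size s)%N -> nth id s i f = nth 0 r i *: f by move=> si; apply: (h i.+1).
have /= L0 := Ls 0%N; have /= h0 := h 0%N isT.
by rewrite !(IH r) // (linZ L0) h0 scalerA scalerDl mulrC.
Qed.

Lemma eY_eigen (r : seq F) j f : size r = K.+1 ->
  (forall i, (i <= K)%N -> Y i f = nth 0 r i *: f) -> eY j f = esym_scalar r j *: f.
Proof.
move=> sr h; apply: esym_op_eigen; rewrite ?size_map ?size_iota ?sr //.
- exact: nth_Yseq_lin.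
- by move=> i iK; rewrite nth_Yseq // h.
Qed.

Lemma eY_one j : eY j 1 = cT j *: 1.
Proof.
apply: eY_eigen; first by rewrite size_map size_iota.
by move=> i iK; rewrite Y_one // (nth_map 0%N) ?size_iota // nth_iota.
Qed.

(** On 1 the series E(z) and C(z) agree, so the constant series solves C(z) U(q z) = E(z) U(z). *)
Lemma u_one k : u k.+1 1 = 0.
Proof.
elim/u_ind: k => [|k IH].
  apply: (scale_inj (q_nroot 0)); rewrite scaler0 uS big_ord_recr /=.
  by rewrite big_ord0 add0r subnn u0 expr0 mul1r eY_one subrr.
apply: (scale_inj (q_nroot k.+1)); rewrite scaler0 uS big_ord_recr /=.
rewrite subnn u0 expr0 mul1r eY_one subrr addr0 big1 // => j _.
rewrite (_ : (k.+1 - j = (k - j).+1)%N) ?IH ?leq_subr ?scaler0 ?(lin0 (eY_lin _)) ?subr0 //.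
by have := ltn_ord j; lia.
Qed.

(** * Degrees and the Gaussian operator on all polynomials *)

Variables (pr : nat -> P -> P) (bd : P -> nat).
Hypothesis pr_lin : forall d, lin (pr d).
Hypothesis pr_T : forall d i f, (i < K)%N -> pr d (T i f) = T i (pr d f).
Hypothesis pr_w : forall d f, pr d (w f) = w (pr d f).
Hypothesis pr_varS : forall d i f, (i <= K)%N -> pr d.+1 (x i * f) = x i * pr d f.
Hypothesis pr_var0 : forall i f, (i <= K)%N -> pr 0 (x i * f) = 0.
Hypothesis pr_pr_if : forall d e f, pr d (pr e f) = if d == e then pr d f else 0.
Hypothesis pr_bd : forall d f, (bd f <= d)%N -> pr d f = 0.
Hypothesis pr_decomp : forall f, exists c (g : nat -> P), f = c *: 1 + \sum_(i < K.+1) x i * g i.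
Hypothesis pr_one : pr 0 1 = 1.
Hypothesis pr_oneS : forall d, pr d.+1 1 = 0.

Lemma pr_pr d f : pr d (pr d f) = pr d f. Proof. by rewrite pr_pr_if eqxx. Qed.

Definition deg d f := pr d f = f.

Lemma deg_T n i f : (i < K)%N -> deg n f -> deg n (T i f).
Proof. by rewrite /deg => iK fn; rewrite pr_T // fn. Qed.
Lemma degD n f g : deg n f -> deg n g -> deg n (f + g).
Proof. by rewrite /deg (linD (pr_lin n)) => -> ->. Qed.
Lemma degZ n c f : deg n f -> deg n (c *: f).
Proof. by rewrite /deg (linZ (pr_lin n)) => ->. Qed.
Lemma deg_wV n f : deg n f -> deg n (wV f).
Proof. by rewrite /deg => fn; rewrite -{2}fn -{2}(wVK f) pr_w wK. Qed.

Lemma deg_0 f : deg 0 f -> exists c, f = c *: 1.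
Proof.
move=> f0; have [c [g fE]] := pr_decomp f; exists c.
rewrite -f0 fE (linD (pr_lin 0)) (linZ (pr_lin 0)) pr_one (lin_sum (pr_lin 0)).
by rewrite big1 ?addr0 // => i _; rewrite pr_var0 // -ltnS.
Qed.

Lemma deg_S n f : deg n.+1 f ->
  exists2 g, (forall i, deg n (g i)) & f = \sum_(i < K.+1) x i * g i.
Proof.
move=> fn; have [c [g fE]] := pr_decomp f; exists (fun i => pr n (g i)).
  by move=> i; apply: pr_pr.
rewrite -fn fE (linD (pr_lin _)) (linZ (pr_lin _)) pr_oneS scaler0 add0r (lin_sum (pr_lin _)).
by apply: eq_bigr => i _; rewrite pr_varS // -ltnS.
Qed.

(** Induction on the degree. Through the T_i, which are injective and commute with u, any variable
    is replaced by x_K; then [u_ypi] passes to lower degree. *)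
Lemma u_vanish n k f : deg n f -> (n < k)%N -> u k f = 0.
Proof.
elim: n k f => [|n IH] [|k] f //.
  by move=> /deg_0[c ->] _; rewrite (linZ (u_lin _)) u_one scaler0.
move=> /deg_S[g gn ->]; rewrite ltnS => nk; rewrite (lin_sum (u_lin _)) big1 // => i _.
suff H d h : (d <= K)%N -> deg n h -> u k.+1 (x (K - d) * h) = 0.
  by rewrite -[i : nat](@subKn _ K) ?H ?leq_subr // -ltnS.
elim: d h => [|d IHd] h dK hn; last first.
  have jK : (K - d.+1 < K)%N by lia.
  apply: (T_inj jK); rewrite u_T // (lin0 (T_lin jK)) T_varl // (_ : (K - d.+1).+1 = K - d)%N; last by lia.
  by rewrite IHd ?(ltnW dK) //; apply: degD; [apply: deg_T | apply: degZ].
have [h' hE hn'] : exists2 h', h = w h' & deg n h' by exists (wV h); rewrite ?wVK //; apply: deg_wV.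
rewrite subn0 hE u_ypi !IH ?(lin0 (Y_lin _)) ?addr0 ?(lin0 ypi_lin) //.
by rewrite ltnS ltnW.
Qed.

Lemma u_ypi_deg n f : deg n f -> u n.+1 (ypi f) = ypi (Y 0 (u n f)).
Proof. by move=> fn; rewrite u_ypi (u_vanish fn) // add0r. Qed.

(** Both Y_0 = T_0 ... T_(K-1) w and the T_i commute with u, and the T_i are injective. *)
Lemma u_w k f : u k (w f) = w (u k f).
Proof.
apply: (@tup_inj 0 K) => //; rewrite -[RHS]/(Y 0 (u k f)) u_Y //=.
by rewrite (@tup_comm (u k)) // => i iK g; rewrite u_T //; lia.
Qed.

Lemma u_varK n f : deg n f -> u n.+1 (x K * f) = x K * w (tup 0 K (u n f)).
Proof.
move=> fn; have := u_ypi_deg (deg_wV fn); rewrite /ypi wVK => ->.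
by rewrite /= -u_w wVK.
Qed.

Lemma tup_surj a n d f : (a + n <= K)%N -> deg d f -> exists2 g, f = tup a n g & deg d g.
Proof.
move=> an; elim: n a an f => [|n IH] a an f fd /=; first by exists f.
have aK : (a < K)%N by lia.
have Tbd : deg d (t^-1 *: Tb a f).
  by apply/degZ/degD; [apply: deg_T | apply: degZ].
have [|g E gd] := IH a.+1 _ _ Tbd; first by lia.
by exists g => //; rewrite -E (linZ (T_lin aK)) T_Tb // scalerA mulVf // scale1r.
Qed.

(** Since x_0 T_0 ... T_(K-1) = Tb_0 ... Tb_(K-1) x_K ([x_tup]), this reduces to [u_varK]. *)
Lemma u_var0 n f : deg n f -> u n.+1 (x 0 * f) = tbup 0 K (x K * w (u n f)).
Proof.
move=> fn; have [|g -> gn] := @tup_surj 0 K n f _ fn; first by [].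
rewrite x_tup // add0n.
have uTb i h : (i < K)%N -> u n.+1 (Tb i h) = Tb i (u n.+1 h).
  by move=> iK; rewrite /Tb (linD (u_lin _)) (linZ (u_lin _)) u_T.
have utb a m h : (a + m <= K)%N -> u n.+1 (tbup a m h) = tbup a m (u n.+1 h).
  elim: m a => [|m IH] a am //=; rewrite uTb ?IH //; lia.
rewrite utb // (u_varK gn); congr (tbup _ _ (_ * w _)).
by rewrite (@tup_comm (u n)) // => i iK h; rewrite u_T //; lia.
Qed.

(** The component of degree d is acted on by u_d; [bd] bounds the degree, and any larger bound gives
    the same sum ([GE]). *)
Definition G f := \sum_(d < bd f) u d (pr d f).

Lemma GE n f : (bd f <= n)%N -> G f = \sum_(d < n) u d (pr d f).
Proof.
move=> fn; rewrite /G (big_ord_widen n (fun d => u d (pr d f))) //.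
rewrite [in RHS](bigID (fun d : 'I_n => d < bd f)%N) /= [X in _ + X]big1 ?addr0 // => d.
by rewrite -leqNgt => fd; rewrite pr_bd // (lin0 (u_lin _)).
Qed.

Lemma G_lin : lin G.
Proof.
move=> c f g; pose n := maxn (bd (c *: f + g)) (maxn (bd f) (bd g)).
have n1 : (bd (c *: f + g) <= n)%N by rewrite leq_maxl.
have n2 : (bd f <= n)%N by rewrite !leq_max leqnn orbT.
have n3 : (bd g <= n)%N by rewrite !leq_max leqnn !orbT.
rewrite (GE n1) (GE n2) (GE n3) scaler_sumr -big_split; apply: eq_bigr => d _.
by rewrite pr_lin u_lin.
Qed.

Lemma G_comm A : lin A -> (forall d f, u d (A f) = A (u d f)) ->
  (forall d f, pr d (A f) = A (pr d f)) -> forall f, G (A f) = A (G f).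
Proof.
move=> LA uA prA f; pose n := maxn (bd f) (bd (A f)).
have n1 : (bd f <= n)%N by rewrite leq_maxl.
have n2 : (bd (A f) <= n)%N by rewrite leq_maxr.
rewrite (GE n1) (GE n2) (lin_sum LA); apply: eq_bigr => d _.
by rewrite prA uA.
Qed.

Lemma G_T i f : (i < K)%N -> G (T i f) = T i (G f).
Proof.
by move=> iK; apply: G_comm => [|d g|d g]; [apply: T_lin | rewrite u_T | apply: pr_T].
Qed.

Lemma G_w f : G (w f) = w (G f).
Proof. by apply: G_comm => [|d g|d g]; [apply: w_lin | apply: u_w | apply: pr_w]. Qed.

Lemma G_var A i f : (i <= K)%N -> lin A ->
  (forall d f, deg d f -> u d.+1 (x i * f) = A (u d f)) -> G (x i * f) = A (G f).
Proof.
move=> iK LA uA; pose n := maxn (bd f) (bd (x i * f)).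
have n1 : (bd f <= n)%N by rewrite leq_maxl.
have n2 : (bd (x i * f) <= n.+1)%N by rewrite leqW // leq_maxr.
rewrite (GE n1) (GE n2) big_ord_recl pr_var0 // (lin0 (u_lin _)) add0r (lin_sum LA).
by apply: eq_bigr => d _; rewrite pr_varS // uA //; apply: pr_pr.
Qed.

Lemma G_var0 f : G (x 0 * f) = tbup 0 K (x K * w (G f)).
Proof.
apply: (@G_var (fun f => tbup 0 K (x K * w f))) => // [|d g]; last exact: u_var0.
by move=> c f' g; rewrite w_lin mulrDr -scalerAr tbup_lin.
Qed.

Lemma G_varK f : G (x K * f) = x K * w (tup 0 K (G f)).
Proof.
apply: (@G_var (fun f => x K * w (tup 0 K f))) => // [|d g]; last exact: u_varK.
by move=> c f' g; rewrite tup_lin // w_lin mulrDr -scalerAr.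
Qed.

Lemma G_one : G 1 = 1.
Proof.
have n1 : (bd 1 <= (bd 1).+1)%N by [].
rewrite (GE n1) big_ord_recl pr_one big1 ?addr0 // => d _.
by rewrite pr_oneS (lin0 (u_lin _)).
Qed.

Lemma G_deg n f : deg n f -> G f = u n f.
Proof.
move=> fn; have n1 : (bd f <= maxn (bd f) n.+1)%N by rewrite leq_maxl.
have n2 : (n < maxn (bd f) n.+1)%N by rewrite leq_max leqnn orbT.
rewrite (GE n1) (bigD1 (Ordinal n2)) //= fn big1 ?addr0 // => d.
rewrite -val_eqE /= => dn.
have -> : pr d f = 0 by rewrite -[X in pr _ X]fn pr_pr_if (negbTE dn).
exact: lin0 (u_lin _).
Qed.

(** * Evaluation of words in the T_i, w, the x_i and G *)

Variables (ev : P -> F) (m : nat).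
Hypothesis evD : forall f g, ev (f + g) = ev f + ev g.
Hypothesis evZ : forall c f, ev (c *: f) = c * ev f.
Hypothesis ev_T : forall i f, (i < K)%N -> ev (T i f) = ev f.
Hypothesis ev_var : forall i f, (i <= K)%N -> ev (x i * f) = t ^+ (K - i) * ev f.
Hypothesis ev_one : ev 1 = 1.

Lemma ev_Tb i f : (i < K)%N -> ev (Tb i f) = t * ev f.
Proof.
by move=> iK; rewrite /Tb evD evZ ev_T // mulrBl mul1r addrCA subrr addr0.
Qed.

Fixpoint tdown p f := if p is p'.+1 then T p' (tdown p' f) else f.

(** Any variable is expressed through x_0, which has the exchange rule [G_var0] with G. *)
Lemma x_down p f : (p <= K)%N -> x p * f = t ^- p *: tdown p (x 0 * tup 0 p f).
Proof.
elim: p f => [|p IH] f pK; first by rewrite expr0 invr1 scale1r.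
have E : T p (x p * T p f) = t *: (x p.+1 * f).
  by rewrite T_varl // T_quad // addrAC -scalerDl -(opprB t 1) addNr scale0r add0r scalerAr.
have -> : x p.+1 * f = t^-1 *: T p (x p * T p f) by rewrite E scalerA mulVf // scale1r.
rewrite IH ?(ltnW pK) // (linZ (T_lin pK)) scalerA -[T p f]/(T (0 + p) f) tup_rcons.
by rewrite exprS invfM mulrC.
Qed.

Lemma tdown_comm A p f : (forall i, i < p -> commute_op A (T i))%N ->
  A (tdown p f) = tdown p (A f).
Proof.
elim: p f => [|p IH] f C //=; rewrite C // IH // => i ip; apply: C; lia.
Qed.

Lemma ev_tdown p f : (p <= K)%N -> ev (tdown p f) = ev f.
Proof. by elim: p f => [|p IH] f pK //=; rewrite ev_T // IH // ltnW. Qed.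

(** An ascending word whose letters flagged false are Tb. Such words arise when variables cross a
    word in the Tb: by x_(i+1) Tb_i = T_i x_i each crossing turns one flag to true. *)
Fixpoint tmix i (a : seq bool) f :=
  if a is b :: a' then (if b then T i else Tb i) (tmix i.+1 a' f) else f.

Lemma tmix_false i n f : tmix i (nseq n false) f = tbup i n f.
Proof. by elim: n i => [|n IH] i //=; rewrite IH. Qed.

Lemma ev_tmix i (s : seq bool) f : (i + size s <= K)%N -> ev (tmix i s f) = t ^+ count negb s * ev f.
Proof.
elim: s i => [|b s IH] i ia /=; first by rewrite expr0 mul1r.
have iK : (i < K)%N by move: ia => /=; lia.
rewrite exprD -mulrA -(IH i.+1); last by move: ia => /=; lia.
by case: b {ia}; rewrite ?ev_T ?ev_Tb //= ?expr0 ?expr1 ?mul1r.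
Qed.

(** The list s gives the levels of x_i, x_(i+1), ...; later, level m + 1 marks an inactive variable,
    which occurs at none of the levels 0, ..., m. *)
Fixpoint xlev i (s : seq nat) l : P :=
  if s is c :: s' then (if c == l then x i else 1) * xlev i.+1 s' l else 1.

Lemma xlev_T i s l j f : (j.+1 < i)%N -> (i + size s <= K.+1)%N ->
  T j (xlev i s l * f) = xlev i s l * T j f.
Proof.
elim: s i f => [|c s IH] i f ji iK /=; first by rewrite !mul1r.
move: iK => /= iK; rewrite -!mulrA; case: eqP => _; rewrite ?mul1r ?T_var ?IH //; lia.
Qed.

Lemma xlev_Tb i s l j f : (j.+1 < i)%N -> (i + size s <= K.+1)%N ->
  Tb j (xlev i s l * f) = xlev i s l * Tb j f.
Proof. by move=> ji iK; rewrite /Tb xlev_T // mulrDr scalerAr. Qed.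

Lemma xlev_none i s l : l \notin s -> xlev i s l = 1.
Proof.
elim: s i => [|c s IH] i //=; rewrite inE negb_or eq_sym => /andP[/negPf -> ls].
by rewrite mul1r IH.
Qed.

Lemma xlev_cat i s1 s2 l : xlev i (s1 ++ s2) l = xlev i s1 l * xlev (i + size s1) s2 l.
Proof.
elim: s1 i => [|c s IH] i /=; first by rewrite addn0 mul1r.
by rewrite IH mulrA addSnnS.
Qed.

Lemma w_xlev i s l f : (i + size s <= K)%N -> w (xlev i.+1 s l * f) = xlev i s l * w f.
Proof.
elim: s i f => [|c s IH] i f iK /=; first by rewrite !mul1r.
move: iK => /= iK; rewrite -!mulrA; case: eqP => _; rewrite ?mul1r ?w_varS ?IH //; lia.
Qed.

Lemma tmix_var i (a : seq bool) j f : (j < i)%N -> (i + size a <= K)%N ->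
  tmix i a (x j * f) = x j * tmix i a f.
Proof.
elim: a i f => [|b a IH] i f ji ia //=; move: ia => /= ia.
rewrite IH; try lia.
by case: b; rewrite ?T_var ?Tb_var //; lia.
Qed.

Definition orlev (l : nat) (a : seq bool) (s : seq nat) := [seq p.1 || (p.2 == l) | p <- zip a s].

Lemma xlev_tmix i (s : seq nat) (l : nat) (a : seq bool) f : size a = size s -> (i + size s <= K)%N ->
  all (fun p => p.1 ==> (p.2 != l)) (zip a s) ->
  xlev i.+1 s l * tmix i a f = tmix i (orlev l a s) (xlev i s l * f).
Proof.
elim: s i a f => [|c s IH] i [|b a] f //=.
move=> [sa] iK /andP[bc dis].
have iK' : (i < K)%N by lia.
rewrite -mulrA.
have -> : xlev i.+2 s l * (if b then T i else Tb i) (tmix i.+1 a f) =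
    (if b then T i else Tb i) (xlev i.+2 s l * tmix i.+1 a f).
  by case: b {bc}; rewrite ?xlev_T ?xlev_Tb //; lia.
rewrite (IH i.+1) //; last by lia.
have szo : size (orlev l a s) = size s by rewrite /orlev size_map size_zip sa minnn.
move: bc; case: eqP => [_|_] /=; last by rewrite orbF !mul1r.
rewrite implybF orbT => /negPf ->.
by rewrite x_Tb // -[x i * xlev _ _ _ * f]mulrA tmix_var // szo; lia.
Qed.

(** With X_l the product of the variables of level l, [out s l] is the outer part X_0 G X_1 G ...
    X_(l-1) G of a word and [mid s c n] the part X_c G X_(c+1) ... G X_(c+n). The whole word is
    [mid s 0 m]. *)
Fixpoint out s l f := if l is l'.+1 then out s l' (xlev 0 s l' * G f) else f.

Fixpoint mid s c n f :=
  if n is n'.+1 then xlev 0 s c * G (mid s c.+1 n' f) else xlev 0 s c * f.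

Lemma mid_split s c n f : mid s 0 (c + n) f = out s c (mid s c n f).
Proof.
elim: c n f => [|c IH] n f //; by rewrite addSnnS IH.
Qed.

Definition flag c l (s : seq nat) := [seq (l <= e < c)%N | e <- s].

Lemma flag_or c l s : (l < c)%N -> orlev l (flag c l.+1 s) s = flag c l s.
Proof.
move=> lc; rewrite /orlev /flag; elim: s => //= e s ->; congr (_ :: _).
by case: (ltngtP l e) => [||<-]; rewrite ?lc ?orbT ?orbF ?andbT.
Qed.

Lemma flag_disj c l s : all (fun p => p.1 ==> (p.2 != l)) (zip (flag c l.+1 s) s).
Proof.
elim: s => //= e s ->; rewrite andbT; apply/implyP => /andP[le _].
by rewrite neq_ltn le orbT.
Qed.

Lemma flag_none c s : flag c c s = nseq (size s) false.
Proof. by elim: s => //= e s ->; rewrite leqNgt andNb. Qed.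

Lemma tmix_G (a : seq bool) f : (size a <= K)%N -> G (tmix 0 a f) = tmix 0 a (G f).
Proof.
have H i (b : bool) g : (i < K)%N -> G ((if b then T i else Tb i) g) = (if b then T i else Tb i) (G g).
  by move=> iK; case: b; rewrite /Tb ?(linD G_lin) ?(linZ G_lin) G_T.
move=> aK; move: (leq_add (leqnn 0) aK); move: {1 3 4}0%N => i.
by elim: a i {aK} => [|b a IH] i //= ia; rewrite H ?IH //; lia.
Qed.

(** Each level crossed sets the flags of its variables to true. Once all outer levels are crossed,
    the letters over variables of level at least c are still Tb, and each of them evaluates to t. *)
Lemma out_tmix s0 s l c f : size s = K -> (l <= c)%N -> (c <= s0)%N ->
  out (s0 :: s) l (tmix 0 (flag c l s) f) = tmix 0 (flag c 0 s) (out s l f).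
Proof.
move=> sK; elim: l f => [|l IH] f lc cs0 //=.
have szf : size (flag c l.+1 s) = K by rewrite size_map.
rewrite (_ : (s0 == l) = false); last by apply/negbTE; lia.
rewrite mul1r tmix_G ?szf // xlev_tmix ?flag_disj ?sK ?szf // flag_or // IH //.
exact: ltnW.
Qed.

Lemma eq_out s s' c f : (forall l, (l < c)%N -> xlev 0 s l = xlev 0 s' l) ->
  out s c f = out s' c f.
Proof.
elim: c f => [|c IH] f E //=; rewrite E // IH // => l lc; apply: E.
exact: leqW.
Qed.

Lemma eq_mid s s' c n f : (forall l, (c <= l <= c + n)%N -> xlev 0 s l = xlev 0 s' l) ->
  mid s c n f = mid s' c n f.
Proof.
elim: n c => [|n IH] c E /=; rewrite E ?leqnn ?leq_addr // IH // => l lc; apply: E.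
lia.
Qed.

Lemma midS s c n f : mid s c n.+1 f = xlev 0 s c * G (mid s c.+1 n f).
Proof. by []. Qed.

Lemma out_lin s c : lin (out s c).
Proof.
elim: c => [|c IH] /=; first exact: lin_id.
apply: lin_comp (IH) _ => a f g; rewrite G_lin mulrDr scalerAr //.
Qed.

Lemma mid_lin s c n : lin (mid s c n).
Proof.
elim: n c => [|n IH] c a f g /=; first by rewrite mulrDr scalerAr.
by rewrite IH G_lin mulrDr scalerAr.
Qed.

Lemma xlev_inactive p r s l : (l < r)%N -> xlev 0 (nseq p r ++ s) l = xlev p s l.
Proof.
move=> lr; rewrite xlev_cat size_nseq add0n xlev_none ?mul1r //.
by rewrite mem_nseq negb_and neq_ltn lr orbT.
Qed.

Lemma out_T p s c i f : (i.+1 < p)%N -> (p + size s <= K.+1)%N -> (c <= m.+1)%N ->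
  out (nseq p m.+1 ++ s) c (T i f) = T i (out (nseq p m.+1 ++ s) c f).
Proof.
move=> ip ps; elim: c f => [|c IH] f cm //=.
by rewrite G_T ?xlev_inactive -?xlev_T ?IH //; lia.
Qed.

Lemma mid_T p s c n i f : (i.+1 < p)%N -> (p + size s <= K.+1)%N -> (c + n <= m)%N ->
  mid (nseq p m.+1 ++ s) c n (T i f) = T i (mid (nseq p m.+1 ++ s) c n f).
Proof.
move=> ip ps; elim: n c => [|n IH] c cm /=; rewrite xlev_inactive; try lia.
  by rewrite xlev_T //; lia.
by rewrite IH ?G_T ?xlev_T //; lia.
Qed.

Lemma w_mid s0 s c n f : size s = K -> (c + n < s0)%N ->
  w (mid (s0 :: s) c n f) = mid s c n (w f).
Proof.
move=> sK; elim: n c => [|n IH] c cn /=.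
  by rewrite (_ : (s0 == c) = false) ?mul1r ?w_xlev ?sK //; apply/negbTE; lia.
rewrite (_ : (s0 == c) = false) ?mul1r ?w_xlev ?sK //; last by apply/negbTE; lia.
by rewrite -G_w IH //; lia.
Qed.

Lemma xlev_rcons i s c l :
  xlev i (rcons s c) l = xlev i s l * (if c == l then x (i + size s) else 1).
Proof. by rewrite -cats1 xlev_cat /= mulr1. Qed.

(* The rule g_(k,v) = t^#{i : v_i < k} g_(v,k-1): the variable x_p of level c is *)
(* moved to x_0, crosses the Gaussian operator, and comes back as x_K, one level *)
(* lower.                                                                        *)
Lemma ev_mid_rotate p c cs f : (p + size cs)%N = K -> (0 < c <= m)%N ->
  ev (mid (nseq p m.+1 ++ c :: cs) 0 m f) = t ^+ count (leq c) cs *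
  ev (mid (nseq p m.+1 ++ rcons cs c.-1) 0 m (w (tup 0 p f))).
Proof.
case: c => // c pK /= cm; pose s1 := nseq p m.+1 ++ cs; pose s0 := m.+1 :: s1.
have sz1 : size s1 = K by rewrite size_cat size_nseq.
have s0E : s0 = nseq p.+1 m.+1 ++ cs by [].
have pleK : (p <= K)%N by rewrite -pK leq_addr.
have mE : (m = c.+1 + (m - c.+1))%N by rewrite subnKC.
have mE' : (m = c + (m - c.+1).+1)%N by rewrite addnS -addSn.
have lt_s l : (l <= m)%N -> l != c.+1 -> xlev 0 (nseq p m.+1 ++ c.+1 :: cs) l = xlev 0 s0 l.
  move=> lm lc; rewrite s0E !xlev_inactive //= eq_sym (negbTE lc) mul1r //.
have at_s : xlev 0 (nseq p m.+1 ++ c.+1 :: cs) c.+1 = x p * xlev 0 s0 c.+1.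
  by rewrite s0E !xlev_inactive //= eqxx.
have s_out g : out (nseq p m.+1 ++ c.+1 :: cs) c.+1 g = out s0 c.+1 g.
  by apply: eq_out => l lc; apply: lt_s; lia.
have s_mid n g : (c.+1 + n <= m)%N ->
    mid (nseq p m.+1 ++ c.+1 :: cs) c.+1 n g = x p * mid s0 c.+1 n g.
  case: n => [|n] cn /=; rewrite at_s -mulrA //; congr (_ * (_ * G _)).
  by apply: eq_mid => l lc; apply: lt_s; lia.
have -> : mid (nseq p m.+1 ++ c.+1 :: cs) 0 m f =
    mid (nseq p m.+1 ++ c.+1 :: cs) 0 (c.+1 + (m - c.+1)) f by rewrite -mE.
rewrite mid_split s_out s_mid -?mE //.
(* x_p is t^(-p) T_(p-1) ... T_0 x_0 T_0 ... T_(p-1). The T_i on the left commute with the outer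
   part, as x_0, ..., x_p are inactive in [s0], and evaluate to 1; those on the right pass to the
   innermost factor. *)
rewrite x_down // (linZ (out_lin _ _)) evZ.
have outT i g : (i < p)%N -> out s0 c.+1 (T i g) = T i (out s0 c.+1 g).
  by move=> ip; rewrite s0E out_T //; lia.
rewrite (tdown_comm (A := out s0 c.+1)) => [|i ip g]; last exact: outT.
rewrite ev_tdown // /out -/out.
have -> : tup 0 p (mid s0 c.+1 (m - c.+1) f) = mid s0 c.+1 (m - c.+1) (tup 0 p f).
  apply/esym/(tup_comm (A := mid s0 c.+1 (m - c.+1))) => i ip g.
  by rewrite s0E mid_T //; lia.
(* Crossing G turns x_0 into Tb_0 ... Tb_(K-1) x_K w. The w goes inward and lowers the index of
   every variable; the word in the Tb goes outward and restores the shift on the outer part. *)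
rewrite G_var0 -G_w w_mid // -?mE //.
set h := x K * _; rewrite -tmix_false.
have -> : xlev 0 s0 c = xlev 1 s1 c.
  by rewrite /s0 /= (_ : (m.+1 == c) = false) ?mul1r //; apply/negbTE; lia.
rewrite -[X in nseq X _]sz1 -(flag_none c.+1) xlev_tmix ?flag_disj ?size_map ?sz1 //.
rewrite flag_or // out_tmix ?leqnSn //; last by lia.
rewrite ev_tmix ?size_map ?sz1 //.
have -> : out s1 c (xlev 0 s1 c * h) =
    mid (nseq p m.+1 ++ rcons cs c) 0 m (w (tup 0 p f)).
  rewrite -rcons_cat -/s1.
  transitivity (mid (rcons s1 c) 0 (c + (m - c.+1).+1) (w (tup 0 p f))); last by rewrite -mE'.
  rewrite mid_split midS xlev_rcons eqxx sz1.
  rewrite (@eq_out _ s1) => [|l lc]; last first.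
    by rewrite xlev_rcons gtn_eqF // mulr1.
  congr (out _ _ _); rewrite /h -mulrA; congr (_ * (_ * G _)).
  apply: eq_mid => l lc; rewrite xlev_rcons ltn_eqF ?mulr1 //; lia.
rewrite mulrA; congr (_ * _).
(* The p inactive variables contribute t^p, which cancels the factor t^(-p) of [x_down]. *)
have -> : count negb (flag c.+1 0 s1) = (p + count (leq c.+1) cs)%N.
  rewrite /flag count_map (@eq_count _ _ (leq c.+1)) => [|e]; last by rewrite /= -leqNgt.
  by rewrite count_cat count_nseq (leqW cm) mul1n.
by rewrite exprD mulKf ?expf_neq0.
Qed.

Lemma xlev_shift p r c cs l : (l < r)%N -> xlev 0 (nseq p r ++ c :: cs) l =
  (if c == l then x p else 1) * xlev 0 (nseq p.+1 r ++ cs) l.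
Proof. by move=> lr; rewrite !xlev_inactive. Qed.

Lemma mid_var p r c n cs f : (c + n < r)%N ->
  x p * mid (nseq p.+1 r ++ cs) c n f = mid (nseq p r ++ c :: cs) c n f.
Proof.
case: n => [|n] cr; first by rewrite /mid xlev_shift ?eqxx ?mulrA //; lia.
rewrite !midS xlev_shift ?eqxx; last by lia.
rewrite -[RHS]mulrA; congr (x p * (_ * G _)); apply: eq_mid => l lc.
rewrite xlev_shift ?ltn_eqF ?mul1r //; lia.
Qed.

Lemma mid_last p r c n cs f : (c + n < r)%N ->
  mid (nseq p.+1 r ++ cs) c n (x p * f) = mid (nseq p r ++ (c + n)%N :: cs) c n f.
Proof.
elim: n c => [|n IH] c cr.
  rewrite addn0 in cr *; rewrite /mid xlev_shift ?eqxx //.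
  by rewrite [LHS]mulrCA [LHS]mulrA.
rewrite !midS xlev_shift; last by lia.
by rewrite IH ?addSnnS // gtn_eqF ?mul1r //; lia.
Qed.

(** * Evaluated words and the rules of the recursion *)

Fixpoint mono i (bs : seq nat) : P :=
  if bs is b :: bs' then x i ^+ b * mono i.+1 bs' else 1.

Lemma mono_rcons i bs d : mono i (rcons bs d) = mono i bs * x (i + size bs) ^+ d.
Proof.
elim: bs i => [|b bs IH] i /=; first by rewrite addn0 mul1r mulr1.
by rewrite IH mulrA addSnnS.
Qed.

Lemma mulX_comm A y : (forall f, A (y * f) = y * A f) -> forall k f, A (y ^+ k * f) = y ^+ k * A f.
Proof.
by move=> C; elim=> [|k IH] f; rewrite ?expr0 ?mul1r // exprS -!mulrA C IH.
Qed.

Lemma tup_mono a n i bs f : (a + n < i)%N -> (i + size bs <= K.+1)%N ->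
  tup a n (mono i bs * f) = mono i bs * tup a n f.
Proof.
elim: bs i f => [|b bs IH] i f ai iK /=; first by rewrite !mul1r.
move: iK => /= iK; rewrite -!mulrA mulX_comm ?IH //; try lia.
move=> g; apply: tup_var; lia.
Qed.

Lemma w_mono i bs f : (i + size bs <= K)%N -> w (mono i.+1 bs * f) = mono i bs * w f.
Proof.
elim: bs i f => [|b bs IH] i f iK /=; first by rewrite !mul1r.
move: iK => /= iK; rewrite -!mulrA -IH; last by lia.
by elim: b => [|b IHb]; rewrite ?expr0 ?mul1r // !exprS -!mulrA w_varS ?IHb //; lia.
Qed.

(** Here b counts the leading entries m still to be treated and d those already at the end of the
    word. For b = 0 a plain monomial remains ([inner0]); for d = 0 this is what a rotation produces
    ([inner_rot]). *)
Definition inner p b bs d := x K ^+ d * w (tup 0 p (mono p (b :: bs))).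

Lemma inner0 p bs d : (p + size bs)%N = K -> inner p 0 bs d = mono p (rcons bs d).
Proof.
move=> pK; rewrite /inner /= expr0 mul1r -[mono p.+1 bs]mulr1 tup_mono //; try lia.
by rewrite tup_one ?w_mono ?w_one ?mulr1 ?mono_rcons ?pK 1?mulrC //; lia.
Qed.

Lemma inner_rot p b bs : inner p b bs 0 = w (tup 0 p (mono p (b :: bs))).
Proof. by rewrite /inner expr0 mul1r. Qed.

Lemma tup_varr a n f : (a + n <= K)%N -> tup a n (x (a + n) * f) = x a * tup a n f +
  (1 - t) *: \sum_(i < n) tup a i (x (a + i.+1) * tup (a + i.+1) (n - i.+1) f).
Proof.
elim: n a => [|n IH] a an.
  by rewrite /= big_ord0 addn0 scaler0 addr0.
have aK : (a < K)%N by lia.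
rewrite [LHS]/= -addSnnS IH; last by lia.
rewrite (linD (T_lin aK)) (linZ (T_lin aK)) (lin_sum (T_lin aK)) T_varr // -addrA -scalerDr.
congr (_ + _ *: _); rewrite big_ord_recl /= addn1 subn1; congr (_ + _).
by apply: eq_bigr => i _; rewrite /= addSnnS.
Qed.

Fixpoint inversions (cs : seq nat) : nat :=
  if cs is c :: cs' then (count (fun e => e < c)%N cs' + inversions cs')%N else 0%N.

Lemma inversions_rcons cs c : inversions (rcons cs c) = (inversions cs + count (fun e => c < e)%N cs)%N.
Proof.
elim: cs => //= e cs ->; rewrite -cats1 count_cat /= addn0; lia.
Qed.

(** This is the value at a = - t^(K+1) of g on the word m^b c_1 m^(b_1) ... c_k m^d, see [g_word],
    where p = K + 1 - k variables are inactive. The product and the inversion number of cs are the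
    normalization under which the relations between words become the recursion. *)
Definition state_val p cs b bs d : F :=
  (\prod_(j < size cs) (1 - t ^+ (K.+1 - j))) * t ^+ inversions cs *
  ev (mid (nseq p m.+1 ++ cs) 0 m (inner p b bs d)).

Hypothesis m_gt0 : (0 < m)%N.

(** The inversions lost by removing c from the front give the power of t in the rule; those gained
    by appending c - 1 match the power in [ev_mid_rotate]. *)
Lemma state_val_pos p c cs bs d b' bs' : rcons bs d = b' :: bs' ->
  (p + size bs)%N = K -> size cs = size bs -> (0 < c < m)%N ->
  state_val p (c :: cs) 0 bs d =
  t ^+ count (fun e => e < c)%N cs * state_val p (rcons cs c.-1) b' bs' 0.
Proof.
move=> bsE pK cK /andP[c0 cm]; rewrite /state_val inner0 // ev_mid_rotate ?cK ?c0 ?(ltnW cm) //.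
rewrite size_rcons inversions_rcons /= inner_rot -bsE.
rewrite (@eq_count _ (fun e => c.-1 < e)%N (leq c)); last by move=> e /=; rewrite prednK.
by rewrite !exprD; ring.
Qed.

Lemma inversions_rcons_max cs : all (fun e => e < m)%N cs -> inversions (rcons cs m.-1) = inversions cs.
Proof.
move=> csm; rewrite inversions_rcons; apply/eqP; rewrite -[X in _ == X]addn0 eqn_add2l.
rewrite -leqn0 leqNgt -has_count -all_predC; apply: sub_all csm => e /=; lia.
Qed.

Lemma count_max cs : all (fun e => e < m)%N cs -> count (leq m) cs = 0%N.
Proof.
move=> csm; apply/eqP; rewrite -leqn0 leqNgt -has_count -all_predC.
by apply: sub_all csm => e /=; rewrite ltnNge.
Qed.

Lemma ev_mid_zero p cs f : (p + size cs)%N = K ->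
  ev (mid (nseq p m.+1 ++ 0%N :: cs) 0 m f) = t ^+ size cs * ev (mid (nseq p.+1 m.+1 ++ cs) 0 m f).
Proof.
move=> pK; rewrite -mid_var // ev_var; last by lia.
by rewrite -pK addKn.
Qed.

(** The variable x_p of level 0 evaluates to t^(K-p). One factor x_p of the innermost monomial, that
    is one entry m, takes its place at level m ([mid_last]) and is rotated to level m - 1. *)
Lemma state_val_0m p cs bs d b' bs' : rcons bs d = b'.+1 :: bs' ->
  (p + size bs)%N = K -> size cs = size bs -> all (fun e => e < m)%N cs ->
  state_val p (0%N :: cs) 0 bs d = t ^+ size cs * state_val p (rcons cs m.-1) b' bs' 0.
Proof.
move=> bsE pK cK csm; rewrite /state_val inner0 // bsE ev_mid_zero ?cK //.
rewrite (_ : mono p _ = x p * mono p (b' :: bs')); last by rewrite /= exprS mulrA.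
rewrite mid_last // add0n ev_mid_rotate ?cK ?m_gt0 ?leqnn //.
rewrite inner_rot count_max // size_rcons inversions_rcons_max //= expr0 mul1r.
rewrite (@eq_count _ _ pred0) // count_pred0 add0n cK; ring.
Qed.

(** The variable of level 0 evaluates to t^(size cs) and becomes inactive. Together with the last
    factor 1 - t^(K+1-size cs) of the normalization this gives t^(size cs) + a at a = - t^(K+1). *)
Lemma state_val_0 p cs bs d : (p + (size bs).+1)%N = K -> size cs = (size bs).+1 ->
  state_val p (0%N :: cs) 0 (0%N :: bs) d =
  (t ^+ size cs - t ^+ K.+1) * state_val p.+1 cs 0 bs d.
Proof.
move=> pK cK; rewrite /state_val !inner0 //=; last by lia.
rewrite ev_mid_zero ?cK // expr0 mul1r big_ord_recr /=.
rewrite (@eq_count _ _ pred0) // count_pred0 add0n.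
have -> : t ^+ K.+1 = t ^+ (size bs).+1 * t ^+ (K.+1 - (size bs).+1).
  by rewrite -exprD; congr (_ ^+ _); lia.
by ring.
Qed.

Lemma mid_one r c n s : (forall l, (l <= c + n)%N -> xlev 0 s l = 1) -> r = mid s c n 1 -> r = 1.
Proof.
move=> H ->; elim: n c H => [|n IH] c H /=; first by rewrite H ?addn0 // mul1r.
by rewrite H ?leq_addr // mul1r IH ?G_one // => l lc; apply: H; rewrite -addSnnS.
Qed.

Lemma state_val_nil : state_val K [:: 0%N] 0 [::] 0 = 1 - t ^+ K.+1.
Proof.
rewrite /state_val inner0 ?addn0 //= big_ord_recl big_ord0 /= mulr1 subn0 expr0 !mulr1.
rewrite ev_mid_zero ?addn0 //= expr0 mul1r.
rewrite (@mid_one _ 0 m (nseq K.+1 m.+1 ++ [::]) _ erefl) ?ev_one ?mulr1 // => l lm.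
by rewrite xlev_inactive.
Qed.

Lemma tbup_comm A a n f : (forall i, a <= i < a + n -> commute_op A (Tb i))%N ->
  A (tbup a n f) = tbup a n (A f).
Proof.
elim: n a => [|n IH] a C //=; rewrite C; last by lia.
by rewrite IH // => i ai; apply: C; lia.
Qed.

Lemma w_tbup a n f : (a.+1 + n <= K)%N -> w (tbup a.+1 n f) = tbup a n (w f).
Proof.
elim: n a => [|n IH] a an //=.
rewrite -IH; last by lia.
by rewrite /Tb (linD w_lin) (linZ w_lin) w_T //; lia.
Qed.

Lemma ev_tbup a n f : (a + n <= K)%N -> ev (tbup a n f) = t ^+ n * ev f.
Proof. by move=> an; rewrite -tmix_false ev_tmix ?count_nseq ?mul1n ?size_nseq. Qed.

Lemma geometric_shift k : \sum_(i < k) (1 - t) * t ^+ (k.-1 - i) = 1 - t ^+ k.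
Proof.
rewrite -mulr_sumr (reindex_inj rev_ord_inj) /= -opprB mulNr -[RHS]opprB subrX1.
by congr (- (_ * _)); apply: eq_bigr => i _; congr (_ ^+ _); have := ltn_ord i; lia.
Qed.

(** Moving x_(p+1) to the left through T_0 ... T_p and w gives q x_K, which raises d, and a sum of
    terms that differ from one word by letters Tb ([tup_varr]). The evaluated sum is geometric, with
    value 1 - t^(p+1): this is the new factor of the normalization, as x_p becomes active at level m
    and is rotated to level m - 1. *)
Lemma state_val_m p cs b bs d : (p.+1 + size bs)%N = K -> size cs = (size bs).+1 ->
  all (fun e => e < m)%N cs ->
  state_val p.+1 cs b.+1 bs d =
  state_val p (rcons cs m.-1) b (rcons bs d) 0 + q * state_val p.+1 cs b bs d.+1.
Proof.
move=> pK cK csm; rewrite /state_val.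
set g := mono p.+1 (b :: bs); set M := mid (nseq p.+1 m.+1 ++ cs) 0 m.
have LM : lin M := mid_lin _ _ _.
have pK' : (p.+1 <= K)%N by lia.
pose h := mono p (b :: rcons bs d).
have hE : h = x K ^+ d * w g.
  rewrite /g -[mono _ _]mulr1 w_mono; last by rewrite /=; lia.
  by rewrite w_one mulr1 /h -rcons_cons mono_rcons /= addnS -addSn pK mulrC.
have E : inner p.+1 b.+1 bs d = q *: inner p.+1 b bs d.+1 +
   (1 - t) *: \sum_(i < p.+1) tbup i (p - i) (x p * h).
  rewrite /inner (_ : mono p.+1 (b.+1 :: bs) = x p.+1 * g); last by rewrite /g /= exprS mulrA.
  rewrite -{2}[p.+1]add0n tup_varr // (linD w_lin) (linZ w_lin) w_var0 mulrDr.
  congr (_ + _); first by rewrite -scalerAr exprS mulrA [x K * _]mulrC.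
  rewrite -scalerAr; congr (_ *: _); rewrite (lin_sum w_lin) mulr_sumr.
  apply: eq_bigr => i _; rewrite !add0n x_tup subSS ?subnKC; try by have := ltn_ord i; lia.
  have ip := ltn_ord i.
  rewrite (_ : i.+1 + (p - i) = p.+1)%N; last by lia.
  have mE : x p.+1 * g = mono p.+1 (b.+1 :: bs) by rewrite /g /= exprS mulrA.
  have -> : tup 0 i (tbup i.+1 (p - i) (x p.+1 * g)) = tbup i.+1 (p - i) (x p.+1 * g).
    rewrite (tbup_comm (A := tup 0 i)) => [|j ij f]; last first.
      apply/esym; apply: (tup_comm (A := Tb j)) => k ki f'.
      have kK : (k < K)%N by lia.
      by rewrite /Tb (linD (T_lin kK)) (linZ (T_lin kK)) (@T_comm k j) //; lia.
    by rewrite mE -[mono _ _]mulr1 tup_mono ?tup_one //=; lia.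
  rewrite w_tbup; last by lia.
  rewrite (tbup_comm (A := fun f => x K ^+ d * f)) => [|j ij f]; last first.
    by rewrite mulX_comm // => f'; rewrite Tb_var //; lia.
  rewrite w_varS ?hE //; congr (tbup _ _ _); exact: mulrCA.
rewrite E LM evD evZ linZ // evZ lin_sum //.
have evsum : {morph ev : f f' / f + f'} by [].
have ev0 : ev 0 = 0 by rewrite -(scale0r 0) evZ mul0r.
rewrite (big_morph ev evsum ev0) mulr_sumr.
have -> : \sum_(i < p.+1) (1 - t) * ev (M (tbup i (p - i) (x p * h))) =
    (1 - t ^+ p.+1) * ev (M (x p * h)).
  rewrite -geometric_shift mulr_suml; apply: eq_bigr => i _; rewrite -mulrA; congr (_ * _).
  have ip := ltn_ord i.
  rewrite (tbup_comm (A := M)) => [|j ij f]; first by rewrite ev_tbup //; lia.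
  by apply: Tb_comm => // f'; rewrite /M mid_T //; lia.
rewrite /M mid_last // add0n ev_mid_rotate ?cK ?m_gt0 ?leqnn //; last by lia.
rewrite inner_rot count_max // size_rcons inversions_rcons_max // expr0 mul1r -/h.
rewrite cK (_ : \prod_(j < (size bs).+2) _ =
  \prod_(j < (size bs).+1) (1 - t ^+ (K.+1 - j)) * (1 - t ^+ p.+1)); last first.
  by rewrite big_ord_recr; congr (_ * (1 - t ^+ _)); rewrite /=; lia.
move: (\prod_(_ < _) _) (t ^+ _) (ev _) (ev _) (t ^+ _) => *; ring.
Qed.

(** The only active variable is x_K, at level m - 1, and the innermost factor is w T_0 ... T_(K-1)
    x_K^n. By [G_varK], x_K times G of that factor is G x_K^(n+1). *)
Lemma state_val_start n : state_val K [:: m.-1] n [::] 0 = (1 - t ^+ K.+1) * ev (iter m G (x K ^+ n.+1)).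
Proof.
rewrite /state_val big_ord_recl big_ord0 mulr1 subn0 /= expr0 mulr1; congr (_ * ev _).
have xl l : (l <= m)%N -> xlev 0 (nseq K m.+1 ++ [:: m.-1]) l = if m.-1 == l then x K else 1.
  by move=> lm; rewrite xlev_inactive //= mulr1.
have below c k f : (c + k)%N = m.-1 ->
    mid (nseq K m.+1 ++ [:: m.-1]) c k.+1 f = iter k G (x K * G f).
  elim: k c => [|k IH] c ck.
    rewrite midS /mid !xl; try lia.
    by rewrite -ck addn0 eqxx ltn_eqF // mul1r.
  by rewrite midS xl ?gtn_eqF ?mul1r ?IH -?iterSr //; lia.
rewrite (_ : mid _ 0 m _ = iter m.-1 G (x K * G (inner K n [::] 0))); last first.
  by rewrite -(below 0%N) // prednK.
rewrite (_ : iter m G _ = iter m.-1 G (G (x K ^+ n.+1))); last by rewrite -iterSr prednK.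
congr (iter _ _ _); rewrite /inner expr0 mul1r exprS G_varK G_w; congr (_ * w _).
rewrite (tup_comm (A := G)) => [|i iK g]; last by rewrite G_T.
by rewrite /= mulr1.
Qed.

(** * Symmetrization and joint eigenvectors of the symmetric functions of the Y_i *)

Definition symmetrize f := (1 - t) *: \sum_(i < K.+1) t ^+ i *: tup i (K - i) f.

Lemma symmetrize_lin : lin symmetrize.
Proof.
apply: lin_scale; apply: lin_bigsum => i; apply: lin_scale; apply: tup_lin.
by rewrite subnKC // -ltnS.
Qed.

Lemma symmetrize_comm A : lin A -> (forall i f, (i < K)%N -> A (T i f) = T i (A f)) ->
  forall f, A (symmetrize f) = symmetrize (A f).
Proof.
move=> LA AT f; rewrite /symmetrize (linZ LA) (lin_sum LA); congr (_ *: _).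
apply: eq_bigr => i _; rewrite (linZ LA); congr (_ *: _).
by apply: (tup_comm (A := A)) => j ij h; apply: AT; have := ltn_ord i; lia.
Qed.

Lemma ev_tup a n f : (a + n <= K)%N -> ev (tup a n f) = ev f.
Proof. by elim: n a => [|n IH] a an //=; rewrite ev_T ?IH //; lia. Qed.

Lemma ev_sum n (E : 'I_n -> P) : ev (\sum_(i < n) E i) = \sum_(i < n) ev (E i).
Proof. by apply: big_morph => //; rewrite -(scale0r 0) evZ mul0r. Qed.

Lemma ev_symmetrize f : ev (symmetrize f) = (1 - t ^+ K.+1) * ev f.
Proof.
rewrite /symmetrize evZ ev_sum -opprB -[in RHS]opprB subrX1 -mulNr -mulrA mulr_suml.
congr (_ * _); apply: eq_bigr => i _; rewrite evZ ev_tup ?subnKC //.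
by rewrite -ltnS.
Qed.

Lemma G_symmetrize f : iter m G (symmetrize f) = symmetrize (iter m G f).
Proof.
elim: m => //= k ->; apply: symmetrize_comm; [exact: G_lin | exact: G_T].
Qed.

Definition fixed f := forall i, (i < K)%N -> T i f = f.

Lemma fixed_tup f a n : fixed f -> (a + n <= K)%N -> tup a n f = f.
Proof. by move=> sf; elim: n a => [|n IH] a an //=; rewrite IH ?sf //; lia. Qed.

Lemma fixed_Tb f i : fixed f -> (i < K)%N -> Tb i f = t *: f.
Proof. by move=> sf iK; rewrite /Tb sf // -[X in X + _]scale1r -scalerDl addrC subrK. Qed.

Lemma fixed_Y f i : fixed f -> (i <= K)%N -> Y i f = t ^+ i *: tup i (K - i) (w f).
Proof.
move=> sf iK; rewrite YE //.
have L : lin (fun g => tup i (K - i) (w g)) by apply: lin_comp w_lin; apply: tup_lin; lia.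
rewrite -(linZ L); congr (tup _ _ (w _)).
elim: i iK {L} => [|i IH] iK; first by rewrite scale1r.
rewrite -tbup_rcons add0n fixed_Tb // (linZ (tbup_lin _)) ?IH ?scalerA //; try lia.
by rewrite exprSr mulrC.
Qed.

Lemma symmetrize_w f : fixed f -> symmetrize (w f) = (1 - t) *: eY 1 f.
Proof.
move=> sf; congr (_ *: _); transitivity (\sum_(i < K.+1) Y i f).
  by apply: eq_bigr => i _; rewrite fixed_Y // -ltnS.
by rewrite /eY esym_op1 /Yseq big_map -[iota 0 K.+1]/(index_iota 0 K.+1) big_mkord.
Qed.

Definition prodY (c : nat -> F) (s : seq nat) f := foldr (fun i g => g + c i *: Y i g) f s.

Lemma prodY_cat c s1 s2 f : prodY c (s1 ++ s2) f = prodY c s1 (prodY c s2 f).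
Proof. by rewrite /prodY foldr_cat. Qed.

Lemma eq_prodY c c' s f : (forall i, i \in s -> c i = c' i) -> prodY c s f = prodY c' s f.
Proof.
elim: s => //= i s IH E; rewrite E ?mem_head // IH // => j js; apply: E.
by rewrite inE js orbT.
Qed.

Lemma prodY_lin c s : all (fun i => i <= K)%N s -> lin (prodY c s).
Proof.
elim: s => [|i s IH] /=; first by move=> _; apply: lin_id.
move=> /andP[iK sK]; apply: (@lin_add _ _ (prodY c s) (fun f => c i *: Y i (prodY c s f))).
  exact: IH.
by apply: lin_scale; apply: lin_comp (IH sK); apply: Y_lin.
Qed.

Lemma prodY_comm A c s : lin A -> (forall i, i \in s -> commute_op A (Y i)) ->
  commute_op A (prodY c s).
Proof.
move=> LA; elim: s => [|i s IH] C f //=.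
rewrite (linD LA) (linZ LA) (C i) ?mem_head // IH // => j js; apply: C.
by rewrite inE js orbT.
Qed.

Lemma prodY_esym z s f : all (fun i => i <= K)%N s ->
  prodY (fun=> z) s f = \sum_(j < (size s).+1) z ^+ j *: esym_op [seq Y i | i <- s] j f.
Proof.
elim: s => [|i s IH] /=; first by rewrite big_ord1 scale1r.
move=> /andP[iK sK]; rewrite IH //; have LY := Y_lin iK.
set E := esym_op _; rewrite [RHS]big_ord_recl /= scale1r (lin_sum LY) scaler_sumr.
under [X in _ = _ + X]eq_bigr do rewrite scalerDr; rewrite big_split addrA; congr (_ + _).
  transitivity (\sum_(j < (size s).+2) z ^+ j *: E j f); last first.
    by rewrite big_ord_recl scale1r [E _ f]esym_op0.
  rewrite [RHS]big_ord_recr /=.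
  rewrite /E esym_op_over ?scaler0 ?addr0 // ?size_map // => k.
  have [ks|ks] := ltnP k (size s); last by rewrite nth_default ?size_map //; apply: lin_id.
  by rewrite (nth_map 0%N) //; apply/Y_lin/(allP sK)/mem_nth.
by apply: eq_bigr => j _; rewrite exprS -scalerA (linZ LY).
Qed.

Definition espoly n (y : nat -> F) : {poly F} := \prod_(i < n) (1 + y i *: 'X).

Lemma coef_linM (c : F) (p : {poly F}) j :
  ((1 + c *: 'X) * p)`_j = p`_j + c * (if j is j'.+1 then p`_j' else 0).
Proof.
rewrite mulrDl mul1r coefD -scalerAl coefZ mulrC ['X * p]mulrC coefMX; congr (_ + _).
by case: j => [|j]; rewrite mulrC.
Qed.

Lemma size_espoly n y : (size (espoly n y) <= n.+1)%N.
Proof.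
elim: n => [|n IH]; first by rewrite /espoly big_ord0 size_poly1.
rewrite /espoly big_ord_recr /= mulrC -/(espoly n y); apply/leq_sizeP => j nj; rewrite coef_linM.
by case: j nj => // j nj; rewrite !(leq_sizeP _ _ IH) ?mulr0 ?addr0 //; lia.
Qed.

Lemma esym_scalarE (s : seq F) j : esym_scalar s j = (\prod_(a <- s) (1 + a *: 'X))`_j.
Proof.
elim: s j => [|a s IH] j /=; first by rewrite big_nil coef1; case: j.
rewrite big_cons coef_linM -IH; case: j => [|j]; last by rewrite -IH.
by rewrite mulr0 addr0; case: (s).
Qed.

Lemma cTE j : cT j = (espoly K.+1 (fun i => t ^+ i))`_j.
Proof. by rewrite /cT esym_scalarE big_map -[iota 0 K.+1]/(index_iota 0 K.+1) big_mkord. Qed.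

(** The condition concerns only symmetric functions of the Y_i, which commute with the T_i ([eY_T])
    and hence with symmetrization. *)
Definition has_type y f := forall j, eY j f = (espoly K.+1 y)`_j *: f.

Lemma one_type : has_type (fun i => t ^+ i) 1.
Proof. by move=> j; rewrite eY_one cTE. Qed.

Lemma iota_le a n : (a + n <= K.+1)%N -> all (fun i => i <= K)%N (iota a n).
Proof. by move=> an; apply/allP => i; rewrite mem_iota; lia. Qed.

Lemma prodY_type y f z : has_type y f ->
  prodY (fun=> z) (iota 0 K.+1) f = (\prod_(i < K.+1) (1 + z * y i)) *: f.
Proof.
move=> fy; rewrite prodY_esym ?iota_le // size_iota.
have E j : esym_op [seq Y i | i <- iota 0 K.+1] j f = (espoly K.+1 y)`_j *: f by apply: fy.
under eq_bigr do rewrite E scalerA; rewrite -scaler_suml; congr (_ *: _).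
transitivity (espoly K.+1 y).[z].
  by rewrite (horner_coef_wide _ (size_espoly _ _)); apply: eq_bigr => j _; rewrite mulrC.
rewrite horner_prod; apply: eq_bigr => i _.
by rewrite hornerD hornerZ hornerX -polyC1 hornerC mulrC.
Qed.

(** At z = - 1 / y_r the product of all 1 + z Y_i kills an f of type y, so without its factor for
    Y_0 it gives an eigenvector of Y_0 with eigenvalue y_r ([component_Y0]). *)
Definition component z f := prodY (fun=> z) (iota 1 K) f.

Lemma component_lin z : lin (component z).
Proof. exact/prodY_lin/iota_le. Qed.

Lemma component_type y z f : has_type y f -> has_type y (component z f).
Proof.
move=> fy j; rewrite -(linZ (component_lin z)) -fy.
apply: (prodY_comm (A := eY j)); first exact: eY_lin.
move=> i; rewrite mem_iota => iK g; rewrite eY_Y //; lia.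
Qed.

Lemma component_Y0 y r f : has_type y f -> (r <= K)%N -> y r != 0 ->
  Y 0 (component (- (y r)^-1) f) = y r *: component (- (y r)^-1) f.
Proof.
move=> fy; rewrite -ltnS => rK yr.
have : prodY (fun=> - (y r)^-1) (iota 0 K.+1) f = 0.
  rewrite (prodY_type _ fy) (bigD1 (Ordinal rK)) //= mulNr mulVf // subrr mul0r.
  by rewrite scale0r.
rewrite /= -/(component _ f) scaleNr => /eqP; rewrite subr_eq0 => /eqP {2}->.
by rewrite scalerA mulfV // scale1r.
Qed.

Definition add_box y r i := if i == r then q * y r else y i : F.

(** On h the factor of Y_0 in the product of the 1 + z Y_i is 1 + y_r z; by [eY_ypi] the operator
    [ypi] replaces it by 1 + q y_r z. *)
Lemma ypi_type y r h : has_type y h -> (r <= K)%N -> Y 0 h = y r *: h ->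
  has_type (add_box y r) (ypi h).
Proof.
move=> hy; rewrite -ltnS => rK Yh.
pose p := \prod_(i < K.+1 | i != Ordinal rK) (1 + y i *: 'X).
have pE : espoly K.+1 y = (1 + y r *: 'X) * p by rewrite /espoly (bigD1 (Ordinal rK)).
have pE' : espoly K.+1 (add_box y r) = (1 + (q * y r) *: 'X) * p.
  rewrite /espoly (bigD1 (Ordinal rK)) //= /add_box eqxx; congr (_ * _).
  by apply: eq_bigr => i; rewrite -val_eqE /= => /negbTE ->.
have p0 : p`_0 = 1.
  rewrite -horner_coef0 horner_prod big1 // => i _.
  by rewrite hornerD hornerZ hornerX mulr0 addr0 -polyC1 hornerC.
have eYSh j : eYS j h = p`_j *: h.
  elim: j => [|j IH]; first by rewrite /eYS esym_op0 p0 scale1r.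
  have := hy j.+1; rewrite eYE IH (linZ (Y_lin _)) // Yh pE coef_linM scalerDl !scalerA.
  by rewrite [y r * _]mulrC => /addIr.
move=> [|j]; rewrite pE' coef_linM.
  by rewrite mulr0 addr0 p0 scale1r /eY esym_op0.
rewrite eY_ypi eYSh eYSh (linZ (Y_lin _)) // Yh -(linZ ypi_lin); congr ypi.
by rewrite scalerDl !scalerA -!mulrA [p`_j * _]mulrC.
Qed.

(** Lagrange interpolation of X^j at the nodes z_r, read at 0. *)
Lemma lagrange_at_0 n (z : nat -> F) j : (j < n)%N -> (forall r s : 'I_n, z r = z s -> r = s) ->
  \sum_(r < n) (\prod_(s < n | s != r) (- z s / (z r - z s))) * z r ^+ j = (j == 0%N)%:R.
Proof.
move=> jn zinj.
pose l (r : 'I_n) : {poly F} := \prod_(s < n | s != r) ((z r - z s)^-1 *: ('X - (z s)%:P)).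
pose p : {poly F} := \sum_(r < n) z r ^+ j *: l r - 'X^j.
have zneq (r s : 'I_n) : s != r -> z r - z s != 0.
  by rewrite eq_sym subr_eq0; apply: contra => /eqP/zinj ->.
have lz (r s : 'I_n) : (l r).[z s] = (s == r)%:R.
  rewrite horner_prod; case: (eqVneq s r) => [->|sr].
    by rewrite big1 // => i ir; rewrite hornerZ hornerXsubC mulVf // zneq.
  by rewrite (bigD1 s) //= hornerZ hornerXsubC subrr mulr0 mul0r.
have pz (s : 'I_n) : p.[z s] = 0.
  rewrite hornerD hornerN hornerXn horner_sum (bigD1 s) //= hornerZ lz eqxx mulr1.
  rewrite big1 ?addr0 ?subrr // => r rs; rewrite hornerZ lz eq_sym (negbTE rs) mulr0 //.
have sl (r : 'I_n) : (size (l r) <= n)%N.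
  have nE : n = #|[pred s : 'I_n | s != r]|.+1.
    by rewrite (@eq_card _ _ (predC1 r)) // cardC1 card_ord prednK // (leq_ltn_trans _ jn).
  suff: (size (l r) <= #|[pred s : 'I_n | s != r]|.+1)%N by rewrite -nE.
  apply: leq_trans (size_poly_prod_leq _ _) _.
  rewrite leq_subLR addnS ltnS addnn -muln2 -sum_nat_const; apply: leq_sum => s _.
  by apply: leq_trans (size_scale_leq _ _) _; rewrite size_XsubC.
have p0 : p = 0.
  apply: (@roots_geq_poly_eq0 _ p [seq z i | i : 'I_n]).
  - by apply/allP => _ /mapP[i _ ->]; rewrite /root pz.
  - by rewrite map_inj_uniq ?enum_uniq // => r s /zinj.
  rewrite size_map size_enum_ord; apply: leq_trans (size_polyD _ _) _.
  rewrite geq_max size_polyN size_polyXn jn andbT; apply: leq_trans (size_sum _ _ _) _.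
  by apply/bigmax_leqP => i _; apply: leq_trans (size_scale_leq _ _) (sl i).
have : p.[0] = 0 by rewrite p0 horner0.
rewrite hornerD hornerN hornerXn horner_sum expr0n => /eqP; rewrite subr_eq0 => /eqP <-.
apply: eq_bigr => r _; rewrite hornerZ horner_prod mulrC; congr (_ * _).
by apply: eq_bigr => s _; rewrite hornerZ hornerXsubC sub0r mulrC.
Qed.

(** Pass from z to t z one factor at a time with 1 + t z Y = t (1 + z Y) + (1 - t). The leftover
    terms [Q k] omit one factor, and their evaluation does not depend on which: Y_(k+1) agrees with
    Tb_k Y_k on functions fixed by T_k, and Tb_k evaluates to t. *)
Lemma ev_rotate_component y f z : fixed f -> has_type y f ->
  ev (\prod_(i < K.+1) (1 + t * z * y i) *: f) =
  t ^+ K.+1 * ev (\prod_(i < K.+1) (1 + z * y i) *: f) + (1 - t ^+ K.+1) * ev (component z f).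
Proof.
move=> sf fy; rewrite -!prodY_type //.
pose c k i := if (i < k)%N then t * z else z.
pose R k := ev (prodY (c k) (iota 0 K.+1) f).
pose Q k := ev (prodY (c k) (iota 0 k) (prodY (c k) (iota k.+1 (K - k)) f)).
have R0 : R 0%N = ev (prodY (fun=> z) (iota 0 K.+1) f) by [].
have RN : R K.+1 = ev (prodY (fun=> t * z) (iota 0 K.+1) f).
  by congr (ev _); apply: eq_prodY => i; rewrite mem_iota /c => /andP[_ ->].
have Q0 : Q 0%N = ev (component z f) by rewrite /Q subn0.
have split k : (k <= K)%N -> iota 0 K.+1 = iota 0 k ++ k :: iota k.+1 (K - k).
  by move=> kK; rewrite -[in LHS](subnKC (leqW kK)) iotaD add0n subSn.
have RS k : (k <= K)%N -> R k.+1 = t * R k + (1 - t) * Q k.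
  move=> kK; rewrite /R /Q (split k) // !prodY_cat /=.
  have E : prodY (c k.+1) (iota k.+1 (K - k)) f = prodY (c k) (iota k.+1 (K - k)) f.
    apply: eq_prodY => i; rewrite mem_iota /c => /andP[ki _].
    by do 2![case: ifP] => //; lia.
  have E' g : prodY (c k.+1) (iota 0 k) g = prodY (c k) (iota 0 k) g.
    apply: eq_prodY => i; rewrite mem_iota /c => /andP[_ ik].
    by do 2![case: ifP] => //; lia.
  rewrite E E'; have L : lin (prodY (c k) (iota 0 k)) by apply/prodY_lin/iota_le; lia.
  rewrite /c ltnn ltnSn !(linD L) !(linZ L) !evD !evZ.
  by move: (ev _) (ev _) => a b; ring.
have QS k : (k < K)%N -> Q k.+1 = Q k.
  move=> kK; pose A := prodY (c k) (iota 0 k); pose B := prodY (c k) (iota k.+2 (K - k.+1)) f.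
  have LA : lin A by apply/prodY_lin/iota_le; lia.
  have YA i g : (i <= K)%N -> Y i (A g) = A (Y i g).
    move=> iK; apply: prodY_comm; first exact: Y_lin.
    by move=> j; rewrite mem_iota => jk h; rewrite Y_comm //; lia.
  have TA g : T k (A g) = A (T k g).
    apply: prodY_comm; first exact: T_lin.
    by move=> j; rewrite mem_iota => jk h; rewrite T_Y_gt //; lia.
  have TB : T k B = B.
    rewrite /B (prodY_comm (A := T k)) ?sf //; first exact: T_lin.
    by move=> j; rewrite mem_iota => jk h; rewrite T_Y_lt //; lia.
  have -> : Q k.+1 = ev (A (B + (t * z) *: Y k B)).
    rewrite /Q (_ : iota 0 k.+1 = iota 0 k ++ [:: k]); last by rewrite -addn1 iotaD.
    rewrite prodY_cat /= {2 3}/c ltnSn.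
    have -> : prodY (c k.+1) (iota k.+2 (K - k.+1)) f = B.
      apply: eq_prodY => i; rewrite mem_iota /c => ki.
      by do 2![case: ifP] => //; lia.
    congr (ev _); apply: eq_prodY => i; rewrite mem_iota /c => ik.
    by do 2![case: ifP] => //; lia.
  have -> : Q k = ev (A (B + z *: Y k.+1 B)).
    rewrite /Q (_ : iota k.+1 (K - k) = k.+1 :: iota k.+2 (K - k.+1)); last first.
      by rewrite -[in LHS](subnSK kK).
    by rewrite /= {3}/c ltnNge leqnSn.
  have EA e h : ev (A (B + e *: h)) = ev (A B) + e * ev (A h).
    by rewrite (linD LA) (linZ LA) evD evZ.
  rewrite !EA; congr (_ + _); rewrite -!YA //; try lia.
  have -> : Y k.+1 (A B) = Tb k (Y k (A B)).
    by rewrite -YS_T // TA TB.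
  by rewrite ev_Tb //; ring.
have QE k : (k <= K)%N -> Q k = Q 0%N.
  by elim: k => // k IH kK; rewrite QS // IH // ltnW.
have RE k : (k <= K.+1)%N -> R k = t ^+ k * R 0%N + (1 - t ^+ k) * Q 0%N.
  elim: k => [|k IH] kK; first by rewrite expr0 mul1r subrr mul0r addr0.
  by rewrite RS // QE // IH ?exprS; [ring | lia].
by rewrite -RN RE // R0 Q0.
Qed.

Definition box_weight y r : F :=
  \prod_(s < K.+1 | (s : nat) != r) (y r / (y r - y s)).

(** The components of f, polynomial in z, are interpolated from z_r = - 1 / y_r to z = 0, where they
    give f. Dividing each by its Y_0-eigenvalue gives h with Y_0 h = f, hence w h = f and x_K f =
    ypi h, and [ypi_type] applies to each term. *)
Lemma symmetrize_varK y f : fixed f -> has_type y f ->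
  (forall i, (i <= K)%N -> y i != 0) ->
  (forall i j, (i <= K)%N -> (j <= K)%N -> y i = y j -> i = j) ->
  exists g : nat -> P, [/\ symmetrize (x K * f) = \sum_(r < K.+1) g r,
    forall r, (r <= K)%N -> has_type (add_box y r) (g r) &
    forall r, (r <= K)%N -> ev (g r) =
      box_weight y r * \prod_(i < K.+1) (1 - t * (y i / y r)) * ev f].
Proof.
move=> sf fy y0 yinj; pose z r := - (y r)^-1.
have zinj (r s : 'I_K.+1) : z r = z s -> r = s.
  by move/oppr_inj/invr_inj => /yinj E; apply: val_inj; apply: E; rewrite -ltnS.
pose fr r := component (z r) f.
have wE (r : 'I_K.+1) : box_weight y r = \prod_(s < K.+1 | s != r) (- z s / (z r - z s)).
  apply: eq_bigr => s sr; rewrite /z opprK.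
  have ys : y s != 0 by rewrite y0 // -ltnS.
  have yr : y r != 0 by rewrite y0 // -ltnS.
  have ysr : y r - y s != 0.
    rewrite subr_eq0; apply/negP => /eqP/yinj E; case/negP: sr; apply/eqP.
    by try apply: val_inj; rewrite /= E // -ltnS.
  have -> : - (y r)^-1 + (y s)^-1 = (y r - y s) / (y r * y s).
    by field; rewrite ys yr.
  by rewrite invf_div; field; rewrite ysr ys.
have lagr : \sum_(r < K.+1) box_weight y r *: fr r = f.
  under eq_bigr do rewrite wE /fr /component prodY_esym ?iota_le // scaler_sumr size_iota.
  rewrite exchange_big /= (bigD1 ord0) //= [X in _ + X]big1 ?addr0 => [|j j0].
    under eq_bigr do rewrite expr0 scale1r esym_op0.
    rewrite -scaler_suml.
    have := @lagrange_at_0 K.+1 z 0 isT zinj; under eq_bigr do rewrite expr0 mulr1.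
    by move->; rewrite scale1r.
  under eq_bigr do rewrite scalerA.
  rewrite -scaler_suml lagrange_at_0 //.
  by move: j0; rewrite -val_eqE /= => /negbTE ->; rewrite scale0r.
exists (fun r => (box_weight y r / y r) *: symmetrize (ypi (fr r))); split.
- pose h := \sum_(r < K.+1) (box_weight y r / y r) *: fr r.
  have Yh : Y 0 h = f.
    rewrite /h (lin_sum (Y_lin _)) // -[RHS]lagr; apply: eq_bigr => r _.
    have rK : (r <= K)%N by rewrite -ltnS.
    by rewrite (linZ (Y_lin _)) // component_Y0 ?y0 // scalerA mulfVK ?y0.
  have wh : w h = f.
    by apply: (@tup_inj 0 K) => //; rewrite (fixed_tup sf).
  have L : lin (fun g => symmetrize (ypi g)) by apply: lin_comp symmetrize_lin ypi_lin.
  transitivity (symmetrize (ypi h)); first by rewrite /ypi wh.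
  by rewrite /h (lin_sum L); apply: eq_bigr => r _; rewrite (linZ L).
- move=> r rK j; rewrite (linZ (eY_lin j)) (symmetrize_comm (A := eY j)); first last.
  + by move=> i g iK; rewrite eY_T.
  + exact: eY_lin.
  rewrite (@ypi_type y r (fr r)) // ?component_Y0 ?y0 //; last exact: component_type.
  rewrite (linZ symmetrize_lin) !(scalerA _ _ (symmetrize _)); congr (_ *: _); exact: mulrC.
- move=> r rK; rewrite evZ ev_symmetrize /ypi ev_var // subnn expr0 mul1r.
  have -> : ev (w (fr r)) = y r * ev (fr r).
    by rewrite -evZ -component_Y0 ?y0 // /= ev_tup.
  have := @ev_rotate_component y f (z r) sf fy.
  (* At z_r the untwisted product vanishes, so [ev_rotate_component] gives the evaluation of the
     component alone. *)
  have -> : \prod_(i < K.+1) (1 + z r * y i) = 0.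
    have rK' : (r < K.+1)%N by [].
    by rewrite (bigD1 (Ordinal rK')) //= /z mulNr mulVf ?y0 // subrr mul0r.
  rewrite !evZ mul0r mulr0 add0r => E.
  have -> : \prod_(i < K.+1) (1 - t * (y i / y r)) = \prod_(i < K.+1) (1 + t * z r * y i).
    by apply: eq_bigr => i _; rewrite /z; ring.
  rewrite -[RHS]mulrA E; field; exact: y0.
Qed.

(** * Eigenvalues of the Gaussian operator *)

Definition row_weight (al : nat -> nat) i := q ^+ al i * t ^+ i : F.

(** One factor for each cell of the diagram with rows al_i, the cell j of row i having weight q^j
    t^i. *)
Definition cell_poly (al : nat -> nat) : {poly F} :=
  \prod_(i < K.+1) \prod_(j < al i) (1 + (q ^+ j * t ^+ i) *: 'X).

Lemma coef_comp_scale (p : {poly F}) (c : F) j : (p \Po (c *: 'X))`_j = c ^+ j * p`_j.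
Proof.
rewrite comp_polyE coef_sum.
under eq_bigr do rewrite exprZn coefZ coefZ coefXn.
have [jp|jp] := ltnP j (size p).
  rewrite (bigD1 (Ordinal jp)) //= eqxx mulr1 mulrC big1 ?addr0 // => i.
  by rewrite -val_eqE /= eq_sym => /negbTE ->; rewrite !mulr0.
rewrite nth_default // mulr0 big1 // => i _.
by rewrite gtn_eqF ?mulr0 // (leq_trans (ltn_ord i)).
Qed.

Lemma cell_poly_shift al : espoly K.+1 (fun i => t ^+ i) * (cell_poly al \Po (q *: 'X)) =
  espoly K.+1 (row_weight al) * cell_poly al.
Proof.
rewrite /cell_poly rmorph_prod /espoly -!big_split; apply: eq_bigr => i _ /=.
rewrite rmorph_prod /= /row_weight.
have E j : (1 + (q ^+ j * t ^+ i) *: 'X) \Po (q *: 'X) = 1 + (q ^+ j.+1 * t ^+ i) *: 'X.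
  rewrite comp_polyD comp_polyZ comp_polyX -polyC1 comp_polyC scalerA.
  by rewrite exprSr mulrAC.
under eq_bigr do rewrite E.
elim: (al i) => [|a IH]; first by rewrite !big_ord0 expr0 mul1r.
rewrite !big_ord_recr /= mulrA IH [RHS]mulrC; congr (_ * _); exact: mulrC.
Qed.

(** By [cell_poly_shift] the polynomial V = [cell_poly al] satisfies C(z) V(q z) = E(z) V(z), the
    scalar form of the recursion for u. *)
Lemma u_type al f k : has_type (row_weight al) f -> u k f = (cell_poly al)`_k *: f.
Proof.
move=> fy; elim/u_ind: k => [|k IH].
  rewrite u0 -horner_coef0 horner_prod big1 ?scale1r // => i _.
  rewrite horner_prod big1 // => j _.
  by rewrite hornerD hornerZ hornerX mulr0 addr0 -polyC1 hornerC.
apply: (scale_inj (q_nroot k)); rewrite uS scalerA.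
set V := cell_poly al; have e0 y : (espoly K.+1 y)`_0 = 1.
  rewrite -horner_coef0 horner_prod big1 // => i _.
  by rewrite hornerD hornerZ hornerX mulr0 addr0 -polyC1 hornerC.
have E : (1 - q ^+ k.+1) * V`_k.+1 = \sum_(j < k.+1)
   (q ^+ (k - j) * cT j.+1 - (espoly K.+1 (row_weight al))`_j.+1) * V`_(k - j).
  have := congr1 (fun p : {poly F} => p`_k.+1) (cell_poly_shift al).
  rewrite !coefM big_ord_recl [in RHS]big_ord_recl !e0 !mul1r coef_comp_scale !subn0 => E.
  under [RHS]eq_bigr do rewrite mulrBl.
  rewrite sumrB; have -> : \sum_(j < k.+1) q ^+ (k - j) * cT j.+1 * V`_(k - j) =
      \sum_(i < k.+1) (espoly K.+1 (fun i => t ^+ i))`_(lift ord0 i) *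
      (V \Po (q *: 'X))`_(k.+1 - lift ord0 i).
    by apply: eq_bigr => j _; rewrite cTE coef_comp_scale /= subSS mulrCA mulrA.
  rewrite mulrBl mul1r; move: E; rewrite -/V.
  move: (q ^+ k.+1 * _) (\sum_(j < _) _) (\sum_(j < _) _) => a S1 S2 E.
  have -> : V`_k.+1 = a + S2 - S1 by rewrite E addrK.
  by ring.
rewrite E scaler_suml; apply: eq_bigr => j _.
by rewrite IH ?leq_subr // (linZ (eY_lin _)) fy !scalerA -scalerBl mulrBl [V`__ * _]mulrC.
Qed.

(** In degree |al| the eigenvalue is the top coefficient of [cell_poly], the product of all cell
    weights. *)
Lemma G_type al f : has_type (row_weight al) f -> deg (\sum_(i < K.+1) al i)%N f ->
  G f = (\prod_(i < K.+1) \prod_(j < al i) (q ^+ j * t ^+ i)) *: f.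
Proof.
move=> fy fd; rewrite (G_deg fd) (u_type _ fy) /cell_poly; congr (_ *: _).
have lin1 (c : F) : (size (1 + c *: 'X : {poly F})%R <= 2)%N.
  apply: leq_trans (size_polyD _ _) _; rewrite geq_max size_poly1 /=.
  by apply: leq_trans (size_scale_leq _ _) _; rewrite size_polyX.
have row i := @top_coef_prod F (al i) (fun j => 1 + (q ^+ j * t ^+ i) *: 'X) (fun=> 1%N) (fun=> lin1 _).
have rowsize i : (size (\prod_(j < al i) (1 + (q ^+ j * t ^+ i) *: 'X) : {poly F})%R <= (al i).+1)%N.
  by have [] := row i; rewrite sum1_card card_ord.
have [_ ->] := @top_coef_prod F K.+1 (fun i => \prod_(j < al i) (1 + (q ^+ j * t ^+ i) *: 'X)) al rowsize.
apply: eq_bigr => i _; have [_] := row i; rewrite sum1_card card_ord => ->.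
by apply: eq_bigr => j _; rewrite coefD coef1 coefZ coefX mulr1 add0r.
Qed.

(* The word m^b c_1 m^(b_1) c_2 m^(b_2) ... *)
Definition word b (cs bs : seq nat) :=
  nseq b m ++ flatten [seq z.1 :: nseq z.2 m | z <- zip cs bs].

Lemma word_rcons b cs bs c d : size cs = size bs ->
  word b (rcons cs c) (rcons bs d) = word b cs bs ++ c :: nseq d m.
Proof.
by move=> cb; rewrite /word zip_rcons // map_rcons flatten_rcons catA.
Qed.

Lemma word_rcons_m b cs bs d : size cs = (size bs).+1 ->
  rcons (word b cs (rcons bs d)) m = word b cs (rcons bs d.+1).
Proof.
case/lastP: cs => // cs c; rewrite size_rcons => -[cb].
by rewrite !word_rcons // rcons_cat rcons_cons -cats1 -[[:: m]]/(nseq 1 m) -nseqD addn1.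
Qed.

Lemma word_cons b c cs b' bs : word b (c :: cs) (b' :: bs) = nseq b m ++ c :: word b' cs bs.
Proof. by []. Qed.

Lemma num_lt_word c b cs bs : (c <= m)%N -> size cs = size bs ->
  num_lt c (word b cs bs) = count (fun e => e < c)%N cs.
Proof.
move=> cm cb; rewrite /num_lt /word count_cat count_nseq ltnNge cm mul0n add0n.
elim: cs bs cb => [|e cs IH] [|d bs] //= [cb].
by rewrite count_cat count_nseq [(m < c)%N]ltnNge cm mul0n add0n IH.
Qed.

Lemma entries_le_word b cs bs : all (fun e => e < m)%N cs -> entries_le m (word b cs bs).
Proof.
move=> csm; rewrite /entries_le /word all_cat all_nseq leqnn orbT /=.
elim: cs bs csm => [|e cs IH] [|d bs] //= /andP[em csm].
by rewrite all_cat all_nseq leqnn orbT ltnW //= IH.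
Qed.

Lemma word_not_all b cs bs d : all (fun e => e < m)%N cs -> size cs = (size bs).+1 ->
  ~~ all (pred1 m) (word b cs (rcons bs d)).
Proof.
case/lastP: cs => // cs c; rewrite all_rcons size_rcons => /andP[cm _] [cb].
by rewrite word_rcons // all_cat negb_and /= ltn_eqF ?orbT.
Qed.

Lemma size_word b cs bs : size cs = size bs -> (size bs <= size (word b cs bs))%N.
Proof.
rewrite /word size_cat => cb; apply: leq_trans (leq_addl _ _).
elim: cs bs cb => [|e cs IH] [|d bs] //= [/IH cb].
by rewrite ltnS size_cat; apply: leq_trans cb (leq_addl _ _).
Qed.

Lemma num_lt_word_m b cs bs : all (fun e => e < m)%N cs -> size cs = size bs ->
  num_lt m (word b cs bs) = size cs.
Proof. by move=> csm cb; rewrite num_lt_word //; apply/eqP; rewrite -all_count. Qed.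

(** * Values of a solution of the recursion at a = - t^(K+1) *)

Variable g : seq nat -> {poly F}.
Hypothesis g_rec : g_recursion q t m g.

(** Induction on the measure that makes the recursion terminate; each rule is matched by one of the
    [state_val] lemmas. The bound on the length of the word keeps at least one variable inactive. *)
Lemma g_word b cs bs d : all (fun e => e < m)%N cs -> size cs = (size bs).+1 ->
  (size (word b cs (rcons bs d)) <= K)%N ->
  (g (word b cs (rcons bs d))).[- t ^+ K.+1] = state_val (K - size bs) cs b bs d.
Proof.
have [k] := ubnP (Defs.g_measure m (word b cs (rcons bs d))).
elim: k b cs bs d => // k IH b cs bs d wk csm cb wK'.
have m1 : (m.-1 < m)%N by rewrite prednK.
have bsK : (size bs < K)%N.
  by apply: leq_trans wK'; rewrite -(size_rcons bs d) size_word // size_rcons.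
case: b wk wK' => [|b] wk wK'; last first.
  move: wk wK'; rewrite /word [nseq b.+1 m ++ _]/= -/(word b cs (rcons bs d)) => wk wK'.
  have em := entries_le_word b (rcons bs d) csm.
  rewrite (g_m g_rec) // hornerD hornerM hornerC.
  have E1 : rcons (word b cs (rcons bs d)) m.-1 = word b (rcons cs m.-1) (rcons (rcons bs d) 0%N).
    by rewrite word_rcons ?size_rcons // cats1.
  have M1 := Defs.measure_pos m_gt0 (q_nroot 0) (word b cs (rcons bs d)) m_gt0.
  have M2 := Defs.g_measure_rot (word_not_all b d csm cb).
  rewrite (_ : K - size bs = (K - (size bs).+1).+1)%N; last by lia.
  rewrite state_val_m //; last by lia.
  rewrite E1 in M1 *; rewrite word_rcons_m // in M2 *; congr (_ + _ * _).
    rewrite IH ?all_rcons ?m1 ?size_rcons ?cb //; first exact: leq_trans M1 _.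
    by rewrite -E1 size_rcons.
  rewrite IH // 1?subnS ?prednK ?subn_gt0 //; first exact: leq_trans M2 _.
  by rewrite -word_rcons_m // size_rcons.
case: cs csm cb wk wK' => // c cs /andP[cm csm] [cb].
have {}csm : all (fun e => e < m)%N cs by [].
case bsE : (rcons bs d) => [|b' bs']; first by case: (bs) bsE.
have sb : size bs' = size bs by have := congr1 size bsE; rewrite size_rcons /= => -[].
rewrite word_cons /= => wk wK'.
have em := entries_le_word b' bs' csm.
have rot c' : rcons (word b' cs bs') c' = word b' (rcons cs c') (rcons bs' 0%N).
  by rewrite word_rcons ?sb // cats1.
have [c0|c0] := posnP c; last first.
  have M1 := Defs.measure_pos m_gt0 (q_nroot 0) (word b' cs bs') c0.
  rewrite (g_mid g_rec) ?c0 // hornerM hornerC num_lt_word ?sb ?(ltnW cm) //.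
  rewrite (state_val_pos bsE) ?c0 // ?subnK 1?ltnW //; congr (_ * _).
  rewrite rot in M1 *; rewrite IH ?sb //; first exact: leq_trans M1 _.
  - by rewrite all_rcons csm andbT; lia.
  - by rewrite size_rcons cb.
  - by rewrite -rot size_rcons.
subst c; case: b' bsE rot em wk wK' => [|b'] bsE rot em wk wK'; last first.
  have em' := entries_le_word b' bs' csm.
  have M1 := Defs.measure_0_m em'.
  move: wk wK'; rewrite /word [nseq _ _ ++ _]/= -/(word b' cs bs') => wk wK'.
  rewrite (g_0_m g_rec) // hornerM hornerC num_lt_word_m ?sb //.
  rewrite (state_val_0m bsE) // ?subnK 1?ltnW //; congr (_ * _).
  have rot' : rcons (word b' cs bs') m.-1 = word b' (rcons cs m.-1) (rcons bs' 0%N).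
    by rewrite word_rcons ?sb // cats1.
  rewrite rot' in M1; rewrite rot' IH ?sb //; first exact: leq_trans M1 _.
  - by rewrite all_rcons m1.
  - by rewrite size_rcons cb.
  - by rewrite -rot' size_rcons; apply: ltnW.
case: cs csm cb rot em wk wK' => [|k0 cs] csm cb rot em wk wK'.
  case: bs bs' cb bsE sb {rot em wk wK' bsK} => // -[|//] _ [->] _.
  by rewrite (g_0 g_rec) subn0 state_val_nil hornerD hornerX hornerC.
case: bs bsE sb cb bsK => [|e bs] //= [-> bsE] sb [cb] bsK.
case: bs' bsE sb rot em wk wK' => [|b1 bs1] bsE sb rot em wk wK'; first by case: (bs) bsE.
case/andP: (em) => k0m em'; have k0m' : (k0 < m)%N by case/andP: csm.
have M1 := Defs.measure_0_lt em; rewrite word_cons in M1 wk wK' em *.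
rewrite [nseq 0 m ++ _]/= in M1 wk wK' em *.
have E : k0 :: word b1 cs bs1 = word 0 (k0 :: cs) (rcons bs d) by rewrite bsE.
rewrite (g_0_lt g_rec) // hornerM hornerD hornerX hornerC E num_lt_word_m //; last first.
  by rewrite /= size_rcons cb.
rewrite E in M1 wk wK' em; rewrite state_val_0 ?cb ?IH //=; try lia.
by congr (_ * state_val _ _ _ _ _); lia.
Qed.

Lemma g_start n : (n < K)%N ->
  (g (rcons (nseq n m) m.-1)).[- t ^+ K.+1] = (1 - t ^+ K.+1) * ev (iter m G (x K ^+ n.+1)).
Proof.
move=> nK; rewrite -state_val_start -cats1 -[_ ++ _]/(word n [:: m.-1] (rcons [::] 0%N)).
by rewrite g_word ?subn0 //= ?prednK ?leqnn // size_cat size_nseq addn1.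
Qed.

End AffineHecke.

(** * The polynomial representation *)

Section Homogeneous.
Variables (F : fieldType) (n : nat).
Implicit Types (f g : {mpoly F[n]}).

Lemma pihomog_varM d (i : 'I_n) f :
  pihomog mdeg d.+1 ('X_i * f) = 'X_i * pihomog mdeg d f.
Proof.
rewrite (mpolyE f) mulr_sumr !raddf_sum /= mulr_sumr; apply: eq_bigr => m _.
rewrite -scalerAr !linearZ /= -scalerAr -mpolyXD !pihomogX /= mdegD mdeg1 add1n eqSS.
by case: eqP => _; rewrite ?mulr0 // -mpolyXD.
Qed.

Lemma pihomog_varM0 (i : 'I_n) f : pihomog mdeg 0 ('X_i * f) = 0.
Proof.
rewrite (mpolyE f) mulr_sumr !raddf_sum /= big1 // => m _.
by rewrite -scalerAr linearZ /= -mpolyXD pihomogX /= mdegD mdeg1 add1n scaler0.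
Qed.

Lemma pihomogC d c : pihomog mdeg d (c%:MP : {mpoly F[n]}) = if d is 0 then c%:MP else 0.
Proof.
rewrite -[c%:MP]mulr1 mul_mpolyC linearZ /= -mpolyX0 pihomogX /= mdeg0.
by case: d => [|d]; rewrite /= ?scaler0.
Qed.

Lemma mpoly_var_ind (P : {mpoly F[n]} -> Prop) :
  (forall c, P c%:MP) -> (forall f g, P f -> P g -> P (f + g)) ->
  (forall i f, P f -> P ('X_i * f)) -> forall f, P f.
Proof.
move=> PC PD PX; elim/mpolyind => [|c m f _ _ Pf]; first by rewrite -mpolyC0; apply: PC.
apply: (PD) => //; rewrite -mul_mpolyC mulrC mpolyXE_id.
apply: (@big_rec _ (fun p => P (p * c%:MP))) => [|i p _ Pp]; first by rewrite mul1r; apply: PC.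
by elim: (m i) => [|k IH]; rewrite ?expr0 ?mul1r // exprS -!mulrA; apply: PX; rewrite mulrA.
Qed.

End Homogeneous.

(** * The abstract relations in the polynomial ring, and symmetrized generating functions *)

Section GaussOperator.
Variables (F : fieldType) (q t : F).
Hypotheses (t_neq0 : t != 0) (t_neq1 : t != 1) (q_neq0 : q != 0).
Hypothesis q_nroot : forall k, 1 - q ^+ k.+1 != 0.

Section FixedRank.
Variable K : nat.
Let P : comAlgType F := {mpoly F[K.+1]}.
Let T : nat -> P -> P := @hecke F t K.
Let w : P -> P := @qrot F q K.
Let wV : P -> P := @qrotV F q K.
Let pr d : P -> P := pihomog mdeg d.

Let T_lin i : (i < K)%N -> lin (T i).
Proof. by move=> iK c f g; rewrite /T heckeD // heckeZ. Qed.
Let w_lin : lin w.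
Proof. by move=> c f g; rewrite /w qrotD qrotZ. Qed.
Let w_one : w 1 = 1.
Proof. by rewrite /w -mpolyC1 qrotC. Qed.
Let w_var0 f : w (xvar F K 0 * f) = q *: (xvar F K K * w f).
Proof. by rewrite /w qrotM qrot_var0 scalerAl. Qed.
Let w_varS i f : (i < K)%N -> w (xvar F K i.+1 * f) = xvar F K i * w f.
Proof. by move=> iK; rewrite /w qrotM qrot_varS. Qed.
Let pr_lin d : lin (pr d).
Proof. by move=> c f g; rewrite /pr linearP. Qed.

Let pr_T d i f : (i < K)%N -> pr d (T i f) = T i (pr d f).
Proof.
move=> iK; apply/esym; have ab : (inord i : 'I_K.+1) != inord i.+1.
  by apply/negP => /eqP/(congr1 val) /=; rewrite !inordK; lia.
apply: demazure_char => //.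
have pZ (c : F) a g : pr d.+1 (c%:MP * 'X_a * g) = c%:MP * 'X_a * pr d g.
  by rewrite -!mulrA !mul_mpolyC /pr linearZ /= pihomog_varM.
have pB (c : F) a b g : ('X_a - c%:MP * 'X_b) * pr d g = pr d.+1 (('X_a - c%:MP * 'X_b) * g).
  by rewrite mulrBl [in RHS]mulrBl -pZ /pr [in RHS]pihomogB pihomog_varM.
have := pB 1 (inord i) (inord i.+1); rewrite mpolyC1 mul1r => ->.
rewrite [X in pr _ X]demazureE [pr _ _]pihomogD -[1]mpolyC1 -mpolyCB; congr (_ + _); first exact: pZ.
by rewrite -[LHS]/(pr _ _) -pB /pr msym_pihomog.
Qed.

Let pr_w d f : pr d (w f) = w (pr d f).
Proof.
elim/mpoly_var_ind: f d => [c d|f g IHf IHg d|i f IH [|d]].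
- by rewrite /w qrotC /pr pihomogC; case: d => [|d]; rewrite ?qrotC // -mpolyC0 qrotC.
- by rewrite /w qrotD /pr !pihomogD qrotD -!/(pr _ _) -!/(w _) IHf IHg.
- rewrite /pr pihomog_varM0 /w qrotM qrot_X -mpolyC0 qrotC mpolyC0.
  case: ifP => _; rewrite ?pihomog_varM0 // -scalerAl.
  by rewrite /xvar linearZ /= pihomog_varM0 scaler0.
rewrite /pr pihomog_varM /w !qrotM qrot_X.
case: ifP => _; rewrite -?scalerAl ?linearZ /= pihomog_varM -/(pr _ _) -/(w _) IH //.
Qed.

Let pr_varS d i f : (i <= K)%N -> pr d.+1 (xvar F K i * f) = xvar F K i * pr d f.
Proof. by move=> _; apply: pihomog_varM. Qed.
Let pr_var0 i f : (i <= K)%N -> pr 0 (xvar F K i * f) = 0.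
Proof. by move=> _; apply: pihomog_varM0. Qed.

Let pr_pr_if d e f : pr d (pr e f) = if d == e then pr d f else 0.
Proof.
case: eqP => [->|/eqP de]; first exact: pihomog_id.
by rewrite /pr (@pihomog_ne0 _ _ mdeg e) ?pihomogP // eq_sym.
Qed.

Let pr_bd d f : (msize f <= d)%N -> pr d f = 0.
Proof.
move=> fd; rewrite /pr pihomogE big_seq_cond big1 // => m /andP[mf /eqP md].
by have := msize_mdeg_lt mf; rewrite (md : mdeg m = d) ltnNge fd.
Qed.

Let pr_decomp f : exists c (g : nat -> P), f = c *: 1 + \sum_(i < K.+1) xvar F K i * g i.
Proof.
elim/mpoly_var_ind: f => [c|f g [c [u ->]] [d [v ->]]|i f [c [u fE]]].
- exists c, (fun=> 0); rewrite big1 => [|i _]; last by rewrite mulr0.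
  by rewrite addr0 -mul_mpolyC mulr1.
- exists (c + d), (fun i => u i + v i); rewrite scalerDl addrACA -big_split.
  by congr (_ + _); apply: eq_bigr => i _; rewrite mulrDr.
- exists 0, (fun j => if j == i :> nat then f else 0); rewrite scale0r add0r (bigD1 i) //= eqxx.
  rewrite big1 => [|j ji]; last by rewrite val_eqE (negbTE ji) mulr0.
  by rewrite addr0 /xvar inord_val.
Qed.

Let pr_one : pr 0 1 = 1.
Proof. by rewrite /pr -mpolyC1 pihomogC. Qed.
Let pr_oneS d : pr d.+1 1 = 0.
Proof. by rewrite /pr -mpolyC1 pihomogC. Qed.

Definition gauss : P -> P := G q t K T w pr (fun f => msize f).
Definition symm : P -> P := symmetrize t K T.
Definition symm_type (y : nat -> F) (f : P) := has_type t K T w y f.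

Let ev_var i f : (i <= K)%N -> evt t (xvar F K i * f) = t ^+ (K - i) * evt t f.
Proof. by move=> iK; rewrite evtM evt_var. Qed.

Let T_quad i f : (i < K)%N -> T i (T i f) = (1 - t) *: T i f + t *: f.
Proof. exact: hecke_quad. Qed.
Let T_comm i j f : (i.+1 < j)%N -> (j < K)%N -> T i (T j f) = T j (T i f).
Proof. exact: hecke_comm. Qed.
Let T_braid i f : (i.+1 < K)%N -> T i (T i.+1 (T i f)) = T i.+1 (T i (T i.+1 f)).
Proof. exact: hecke_braid_rel. Qed.
Let T_var i j f : (i < K)%N -> (j <= K)%N -> j != i -> j != i.+1 ->
  T i (xvar F K j * f) = xvar F K j * T i f.
Proof. exact: hecke_var. Qed.
Let T_varl i f : (i < K)%N ->
  T i (xvar F K i * f) = xvar F K i.+1 * (T i f + (t - 1) *: f).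
Proof. exact: hecke_varl. Qed.
Let T_varr i f : (i < K)%N ->
  T i (xvar F K i.+1 * f) = xvar F K i * T i f + (1 - t) *: (xvar F K i.+1 * f).
Proof. exact: hecke_varr. Qed.
Let T_one i : (i < K)%N -> T i 1 = 1.
Proof. exact: hecke1. Qed.
Let wK : cancel w wV. Proof. exact: qrotK. Qed.
Let wVK : cancel wV w. Proof. exact: qrotVK. Qed.
Let w_T i f : (i.+1 < K)%N -> w (T i.+1 f) = T i (w f).
Proof. exact: qrot_hecke. Qed.
Let w2_T f : (0 < K)%N -> w (w (T 0 f)) = T K.-1 (w (w f)).
Proof. exact: qrot2_hecke. Qed.
Let evD (f g : P) : evt t (f + g) = evt t f + evt t g. Proof. exact: evtD. Qed.
Let evZ c (f : P) : evt t (c *: f) = c * evt t f. Proof. exact: evtZ. Qed.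
Let ev_T i f : (i < K)%N -> evt t (T i f) = evt t f.
Proof. exact: (evt_hecke q_neq0 t_neq0 t_neq1). Qed.
Let ev_one : evt t (1 : P) = 1. Proof. exact: evt1. Qed.

Lemma gauss_lin : lin gauss.
Proof. exact: (G_lin t_neq0 q_neq0 q_nroot T_lin w_lin pr_lin pr_bd). Qed.

Lemma symm_lin : lin symm.
Proof. exact: (symmetrize_lin t_neq0 q_neq0 T_lin). Qed.

Lemma evt_symm f : evt t (symm f) = (1 - t ^+ K.+1) * evt t f.
Proof. exact: (ev_symmetrize t_neq0 q_neq0 (m := 1%N) evD evZ ev_T isT). Qed.

Lemma gauss_symm m f : iter m gauss (symm f) = symm (iter m gauss f).
Proof.
case: m => // m; rewrite /symm /gauss.
exact: (G_symmetrize t_neq0 q_neq0 q_nroot T_lin T_quad T_comm T_braid w_lin w_T w2_T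
  pr_lin pr_T pr_bd (m := m.+1)).
Qed.

Lemma gauss_start m g n : (0 < m)%N -> g_recursion q t m g -> (n < K)%N ->
  (g (rcons (nseq n m) m.-1)).[- t ^+ K.+1] = evt t (iter m gauss (symm (xvar F K K ^+ n.+1))).
Proof.
move=> m0 gP nK; rewrite gauss_symm evt_symm.
exact: (g_start t_neq0 q_neq0 q_nroot T_lin T_quad T_comm T_braid T_var T_varl T_varr T_one
  w_lin w_one w_var0 w_varS wK wVK w_T w2_T pr_lin pr_T pr_w pr_varS pr_var0 pr_pr_if pr_bd
  pr_decomp pr_one pr_oneS evD evZ ev_T ev_var ev_one m0 gP nK).
Qed.

Lemma symm_mul f g : f \is symmetric -> symm (f * g) = f * symm g.
Proof.
move=> sf; apply/esym; apply: (@symmetrize_comm F q t P K T t_neq0 q_neq0 1 isT (fun h => f * h)).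
  by move=> c u v; rewrite mulrDr scalerAr.
by move=> i h iK; rewrite /T hecke_sym.
Qed.

Lemma sym_fixed f : f \is symmetric -> fixed K T f.
Proof. by move=> sf i iK; rewrite /T -[f]mulr1 hecke_sym // hecke1. Qed.

Lemma coef1_espoly n (y : nat -> F) : (espoly n y)`_1 = \sum_(i < n) y i.
Proof.
elim: n => [|n IH]; first by rewrite /espoly !big_ord0 coef1.
rewrite /espoly !big_ord_recr /= mulrC coef_linM -/(espoly n y) IH; congr (_ + _).
rewrite -horner_coef0 horner_prod big1 ?mulr1 // => i _.
by rewrite hornerD hornerZ hornerX mulr0 addr0 -polyC1 hornerC.
Qed.

(** On symmetric polynomials this is the symmetrization of the q-rotation ([macdonald_op_sym]). *)
Definition macdonald_op (f : P) : P := (1 - t) *: eY t K T w 1 f.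

Lemma macdonald_op_lin : lin macdonald_op.
Proof. exact/lin_scale/(eY_lin t_neq0 q_neq0 T_lin w_lin). Qed.

Lemma macdonald_op_sym f : f \is symmetric -> macdonald_op f = symm (w f).
Proof.
move=> sf; apply/esym.
exact: (symmetrize_w t_neq0 q_neq0 T_lin T_quad w_lin (m := 1%N) isT (sym_fixed sf)).
Qed.

Lemma macdonald_op_type f y : symm_type y f ->
  macdonald_op f = ((1 - t) * \sum_(i < K.+1) y i) *: f.
Proof. by move=> fy; rewrite /macdonald_op fy scalerA coef1_espoly. Qed.

Lemma symm_type1 : symm_type (fun i => t ^+ i) 1.
Proof. exact: (one_type t_neq0 q_neq0 T_lin T_one w_lin w_one). Qed.

Lemma gauss_type al f : symm_type (row_weight q t al) f ->
  f \is (\sum_(i < K.+1) al i)%N.-homog ->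
  gauss f = (\prod_(i < K.+1) \prod_(j < al i) (q ^+ j * t ^+ i)) *: f.
Proof.
move=> fy fd.
exact: (G_type t_neq0 q_neq0 q_nroot T_lin w_lin pr_pr_if pr_bd fy (pihomog_dE fd)).
Qed.

Lemma symm_varK y f : f \is symmetric -> symm_type y f ->
  (forall i, (i <= K)%N -> y i != 0) ->
  (forall i j, (i <= K)%N -> (j <= K)%N -> y i = y j -> i = j) ->
  exists g : nat -> P, [/\ symm (xvar F K K * f) = \sum_(r < K.+1) g r,
    forall r, (r <= K)%N -> symm_type (add_box q y r) (g r) &
    forall r, (r <= K)%N -> evt t (g r) =
      box_weight K y r * \prod_(i < K.+1) (1 - t * (y i / y r)) * evt t f].
Proof.
move=> /sym_fixed sf fy y0 yinj.
exact: (symmetrize_varK t_neq0 q_neq0 T_lin T_quad T_comm T_braid T_var T_varl T_varr w_lin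
  w_var0 w_varS w_T w2_T evD evZ ev_T ev_var (m := 1%N) isT sf fy y0 yinj).
Qed.

Let x := xvar F K.
(** Generating functions: L has the factors 1 + x_l z for l < i, R the factors 1 + t x_l z for l >=
    i, and Kp their product with x_i left out. *)
Let L i : {poly P} := \prod_(l < i) (1 + x l *: 'X).
Let R i : {poly P} := \prod_(l < K.+1 - i) (1 + (t *: x (i + l)) *: 'X).
Let Kp i := L i * R i.+1.

Let coef_lin (c : P) (p : {poly P}) j :
  ((1 + c *: 'X) * p)`_j = p`_j + c * (if j is j'.+1 then p`_j' else 0).
Proof.
rewrite mulrDl mul1r coefD -scalerAl coefZ mulrC ['X * p]mulrC coefMX; congr (_ + _).
by case: j => [|j]; rewrite mulrC.
Qed.

Let RE i : (i <= K)%N -> R i = (1 + (t *: x i) *: 'X) * R i.+1.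
Proof.
move=> iK; rewrite /R (subSn iK) big_ord_recl addn0 subSS; congr (_ * _).
by apply: eq_bigr => l _; rewrite addSnnS.
Qed.

Let commutes i (M : {poly P}) := forall n f, T i (M`_n * f) = M`_n * T i f.

Let commutes1 i : (i < K)%N -> commutes i 1.
Proof.
move=> iK n f; rewrite coef1; case: eqP => _; first by rewrite !mul1r.
by rewrite !mul0r (lin0 (T_lin iK)).
Qed.

Let commutesM i c M : (i < K)%N -> (forall f, T i (c * f) = c * T i f) -> commutes i M ->
  commutes i ((1 + c *: 'X) * M).
Proof.
move=> iK cT MC n f; rewrite coef_lin !mulrDl (linD (T_lin iK)) MC -!mulrA cT.
by case: n => [|n]; rewrite ?MC // !mul0r (lin0 (T_lin iK)).
Qed.

Let commutes_prod i (c : nat -> P) n : (i < K)%N ->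
  (forall l f, (l < n)%N -> T i (c l * f) = c l * T i f) ->
  commutes i (\prod_(l < n) (1 + c l *: 'X)).
Proof.
move=> iK; elim: n => [|n IH] cT; first by rewrite big_ord0; apply: commutes1.
rewrite big_ord_recr /= mulrC; apply: commutesM => //; first by move=> f; apply: cT.
by apply: IH => l f ln; apply: cT; apply: leqW.
Qed.

(** All factors but one commute with T_i, and T_i (1 + x_i z) = 1 + t x_(i+1) z. *)
Let T_Kp i n : (i < K)%N -> T i (Kp i.+1)`_n = (Kp i)`_n.
Proof.
move=> iK; pose M := L i * R i.+2.
have E1 : Kp i.+1 = (1 + x i *: 'X) * M by rewrite /Kp /L big_ord_recr /= mulrAC mulrC.
have E2 : Kp i = (1 + (t *: x i.+1) *: 'X) * M by rewrite /Kp RE // mulrCA.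
have CL : commutes i (L i).
  by apply: commutes_prod => // l f li; rewrite /x T_var //; lia.
have CR : commutes i (R i.+2).
  apply: (commutes_prod (c := fun l => t *: x (i.+2 + l)%N)) => // l f li.
  by rewrite -!scalerAl (linZ (T_lin iK)) /x T_var //; lia.
have CM : commutes i M.
  move=> j f; rewrite /M coefM !mulr_suml (lin_sum (T_lin iK)); apply: eq_bigr => l _.
  by rewrite -!mulrA CL CR.
rewrite E1 E2 !coef_lin (linD (T_lin iK)); congr (_ + _).
  by rewrite -[M`_n]mulr1 CM T_one.
case: n => [|n]; first by rewrite !mulr0 (lin0 (T_lin iK)).
rewrite mulrC CM -[x i]mulr1 /x T_varl // T_one // -[X in X + _]scale1r -scalerDl addrC subrK.
by rewrite -scalerAr mulr1 -scalerAr mulrC scalerAl.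
Qed.

Let tup_Kp d n i : (i + d)%N = K -> tup T i d (Kp K)`_n = (Kp i)`_n.
Proof.
elim: d i => [|d IH] i id /=; first by rewrite addn0 in id *; rewrite id.
by rewrite IH 1?addSnnS // T_Kp //; lia.
Qed.

Let coef_scaled k n : (\prod_(l < k) (1 + (t *: x l) *: 'X) : {poly P})`_n =
  t ^+ n *: (\prod_(l < k) (1 + x l *: 'X) : {poly P})`_n.
Proof.
elim: k n => [|k IH] n.
  by rewrite !big_ord0 coef1; case: n => [|n]; rewrite ?expr0 ?scale1r ?scaler0.
rewrite !big_ord_recr /= ![_ * (1 + _)]mulrC !coef_lin IH scalerDr; congr (_ + _).
case: n => [|n]; first by rewrite !mulr0 scaler0.
by rewrite IH -scalerAl -scalerAr scalerA -exprS.
Qed.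

(** The i-th term of the symmetrization is t^i [Kp i], and (1 - t) [Kp i] = [W i] - t [W i.+1]. The
    sum telescopes between the product with all variables scaled by t and the unscaled one. *)
Lemma symm_prefix n : symm (\prod_(l < K) (1 + x l *: 'X) : {poly P})`_n =
  (t ^+ n - t ^+ K.+1) *: (\prod_(l < K.+1) (1 + x l *: 'X) : {poly P})`_n.
Proof.
have -> : (\prod_(l < K) (1 + x l *: 'X) : {poly P})`_n = (Kp K)`_n.
  by rewrite /Kp /R subnn big_ord0 mulr1.
pose W i := L i * R i.
have WE i : (i <= K)%N -> (1 - t) *: (Kp i)`_n = (W i)`_n - t *: (W i.+1)`_n.
  move=> iK; rewrite /W RE // mulrCA -/(Kp i) coef_lin.
  have -> : L i.+1 * R i.+1 = (1 + x i *: 'X) * Kp i by rewrite /Kp /L big_ord_recr /= mulrAC mulrC.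
  by rewrite coef_lin scalerDr scalerBl scale1r -!scalerAl opprD addrACA subrr addr0.
rewrite /symm /symmetrize scaler_sumr.
transitivity (\sum_(i < K.+1) (t ^+ i *: (W i)`_n - t ^+ i.+1 *: (W i.+1)`_n)).
  apply: eq_bigr => i _; have iK : (i <= K)%N by rewrite -ltnS.
  rewrite tup_Kp ?subnKC // scalerA mulrC -scalerA WE // scalerBr scalerA.
  by rewrite -exprSr.
have tele k (V : nat -> P) : \sum_(i < k) (V i - V i.+1) = V 0%N - V k.
  by elim: k => [|k IH]; rewrite ?big_ord0 ?subrr // big_ord_recr /= IH addrA subrK.
rewrite (tele _ (fun i => t ^+ i *: (W i)`_n)) expr0 scale1r scalerBl; congr (_ - _).
  by rewrite /W /L big_ord0 mul1r /R subn0 coef_scaled.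
by rewrite /W /R subnn big_ord0 mulr1.
Qed.

End FixedRank.
End GaussOperator.

(** * Symmetric functions and their homomorphisms *)

Section PowerSeries.
Variable A : comNzRingType.
Implicit Types (a b c p r : nat -> A).

(** Sequences stand for formal power series: [conv] is the product, [der] is z d/dz, [twist]
    rescales the variable. Identities between series are proved by comparing logarithmic derivatives
    ([ode_unique]). *)
Definition conv a b n := \sum_(i < n.+1) a i * b (n - i)%N.
Definition der a n := a n *+ n.
Definition unit_seq n : A := (n == 0%N)%:R.
Definition twist (z : A) a n := z ^+ n * a n.

Let trunc m a : {poly A} := \poly_(i < m) a i.

Let convE m a b n : (n < m)%N -> conv a b n = (trunc m a * trunc m b)`_n.
Proof.
move=> nm; rewrite coefM; apply: eq_bigr => i _; rewrite !coef_poly.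
have im : (i < m)%N by have := ltn_ord i; lia.
by rewrite im (leq_ltn_trans (leq_subr _ _) nm).
Qed.

Let coefM_eq (p p' r r' : {poly A}) n : (forall i, (i <= n)%N -> p`_i = p'`_i) ->
  (forall i, (i <= n)%N -> r`_i = r'`_i) -> (p * r)`_n = (p' * r')`_n.
Proof.
move=> pp rr; rewrite !coefM; apply: eq_bigr => i _.
by rewrite pp ?rr ?leq_subr // -ltnS.
Qed.

Let trunc_conv m a b i : (i < m)%N -> (trunc m (conv a b))`_i = (trunc m a * trunc m b)`_i.
Proof. by move=> im; rewrite coef_poly im; apply: convE. Qed.

Lemma eq_conv a a' b b' : a =1 a' -> b =1 b' -> conv a b =1 conv a' b'.
Proof. by move=> aa bb n; apply: eq_bigr => i _; rewrite aa bb. Qed.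

Lemma convC a b : conv a b =1 conv b a.
Proof. by move=> n; rewrite !(@convE n.+1) // mulrC. Qed.

Lemma convA a b c : conv a (conv b c) =1 conv (conv a b) c.
Proof.
move=> n; rewrite !(@convE n.+1) //.
transitivity (trunc n.+1 a * (trunc n.+1 b * trunc n.+1 c))`_n.
  by apply: coefM_eq => i ni //; apply: trunc_conv.
by rewrite mulrA; apply: coefM_eq => i ni //; rewrite trunc_conv.
Qed.

Lemma convDl a b c : conv (fun n => a n + b n) c =1 (fun n => conv a c n + conv b c n).
Proof. by move=> n; rewrite /conv -big_split; apply: eq_bigr => i _; rewrite mulrDl. Qed.

Lemma conv0 a b : conv a b 0 = a 0%N * b 0%N.
Proof. by rewrite /conv big_ord1. Qed.

Lemma der_conv a b : der (conv a b) =1 (fun n => conv (der a) b n + conv a (der b) n).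
Proof.
move=> n; rewrite /der /conv -big_split -sumrMnl; apply: eq_bigr => i _ /=.
rewrite mulrnAl mulrnAr -mulrnDr subnKC // -ltnS //.
Qed.

Lemma twist_conv z a b : twist z (conv a b) =1 conv (twist z a) (twist z b).
Proof.
move=> n; rewrite /twist /conv mulr_sumr; apply: eq_bigr => i _.
by rewrite mulrACA -exprD subnKC // -ltnS.
Qed.

Lemma der_twist z a : der (twist z a) =1 twist z (der a).
Proof. by move=> n; rewrite /der /twist mulrnAr. Qed.

Lemma der_conv_ode p r a b : der a =1 conv p a -> der b =1 conv r b ->
  der (conv a b) =1 conv (fun n => p n + r n) (conv a b).
Proof.
move=> da db n; rewrite der_conv convDl; congr (_ + _).
  by rewrite (eq_conv da (frefl b)) convA.
rewrite (eq_conv (frefl a) db) convA (eq_conv (convC a r) (frefl b)).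
by rewrite -convA.
Qed.

(** The logarithmic derivative of 1 + x z is minus the sum of (- x z)^k over k >= 1. *)
Lemma der_prod_ode n (x : nat -> A) :
  der (fun k => (\prod_(i < n) (1 + x i *: 'X) : {poly A})`_k) =1
  conv (fun k => if k is 0 then 0 else - \sum_(i < n) (- x i) ^+ k)
       (fun k => (\prod_(i < n) (1 + x i *: 'X) : {poly A})`_k).
Proof.
elim: n => [|n IH] k.
  rewrite /conv [RHS]big1 => [|i _]; last first.
    by case: (i : nat) => [|j] /=; rewrite ?big_ord0 ?oppr0 mul0r.
  by rewrite /der big_ord0 coef1; case: k => [|k]; rewrite ?mulr0n ?mul0rn.
pose a k := (\prod_(i < n) (1 + x i *: 'X) : {poly A})`_k.
pose b k := (1 + x n *: 'X : {poly A})`_k.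
pose p k := if k is 0 then 0 else - \sum_(i < n) (- x i) ^+ k.
pose r k := if k is 0 then 0 else - (- x n) ^+ k.
have E : (fun k => (\prod_(i < n.+1) (1 + x i *: 'X) : {poly A})`_k) =1 conv a b.
  by move=> j; rewrite big_ord_recr /= coefM.
have bE j : b j = (j == 0%N)%:R + x n * (j == 1%N)%:R.
  by rewrite /b coefD coef1 coefZ coefX.
have db : der b =1 conv r b.
  move=> j; rewrite /der /conv bE; case: j => [|j]; first by rewrite mulr0n big_ord1 /r mul0r.
  rewrite big_ord_recr subnn /= bE mulr0 addr0 mulr1 add0r.
  case: j => [|j]; first by rewrite big_ord1 /= mul0r add0r mulr1 expr1 opprK mulr1n.
  rewrite big_ord_recr subSnn /= bE /= mulr0 mul0rn add0r mulr1 big1 ?add0r => [|i _].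
    by rewrite [(- x n) ^+ j.+2]exprSr mulrN mulNr opprK addNr.
  have : (1 < j.+2 - i)%N by have := ltn_ord i; lia.
  by rewrite bE; case: (j.+2 - i)%N => [|[|l]] //; rewrite mulr0 addr0 mulr0.
rewrite /der E -[LHS]/(der (conv a b) k) (der_conv_ode IH db); apply: eq_conv => // j.
  by case: j => [|j]; rewrite /p /r ?addr0 // big_ord_recr /= opprD.
Qed.

Lemma conv_cancel a b b' : a 0%N = 1 -> conv a b =1 conv a b' -> b =1 b'.
Proof.
move=> a0 E n; have [k] := ubnP n; elim: k n => // k IH n nk.
have := E n; rewrite /conv !big_ord_recl /= a0 !mul1r subn0.
rewrite (eq_bigr (fun i : 'I_n => a (bump 0 i) * b' (n - bump 0 i)%N)) => [/addIr //|i _].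
by rewrite IH //; have := ltn_ord i; rewrite /bump; lia.
Qed.

Hypothesis natI : forall n (x y : A), x *+ n.+1 = y *+ n.+1 -> x = y.

(* In terms of generating functions, [der a =1 conv p a] reads z a'(z) = p(z) a(z). *)
Lemma ode_unique p a b : p 0%N = 0 -> a 0%N = b 0%N ->
  der a =1 conv p a -> der b =1 conv p b -> a =1 b.
Proof.
move=> p0 ab da db n; have [k] := ubnP n; elim: k n => // k IH [|n] nk //.
apply: (@natI n); rewrite -[LHS]/(der a n.+1) -[RHS]/(der b n.+1) da db /conv big_ord_recl [in RHS]big_ord_recl /=.
rewrite p0 !mul0r; congr (_ + _); apply: eq_bigr => i _; rewrite IH //.
by rewrite /bump /=; lia.
Qed.

End PowerSeries.

(** * Symmetric functions as a polynomial ring in the e_k, and Newton's identities *)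

Section SymfunGenerators.
Variable F : fieldType.
Local Notation Lam := (symfun F).
Implicit Types (f g : Lam) (N k : nat).

Lemma sympoly0 N : (0 : Lam) N = 0. Proof. by []. Qed.
Lemma sympoly1 N : (1 : Lam) N = 1. Proof. by []. Qed.
Lemma sympolyD f g N : (f + g) N = f N + g N. Proof. by []. Qed.
Lemma sympolyN f N : (- f) N = - f N. Proof. by []. Qed.
Lemma sympolyM f g N : (f * g) N = f N * g N. Proof. by []. Qed.
Lemma sympolyZ c f N : (c *: f) N = c *: f N. Proof. by []. Qed.

Lemma sympoly_sum N (I : Type) (r : seq I) (p : pred I) (E : I -> Lam) :
  (\sum_(i <- r | p i) E i : Lam) N = \sum_(i <- r | p i) E i N.
Proof. by apply: (big_morph (fun f : Lam => f N)). Qed.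

Lemma sympoly_prod N (I : Type) (r : seq I) (p : pred I) (E : I -> Lam) :
  (\prod_(i <- r | p i) E i : Lam) N = \prod_(i <- r | p i) E i N.
Proof. by apply: (big_morph (fun f : Lam => f N)). Qed.

Lemma sympolyXn f n N : (f ^+ n) N = f N ^+ n.
Proof. by elim: n => // n IH; rewrite !exprS sympolyM IH. Qed.

Lemma sympolyMn f n N : (f *+ n) N = f N *+ n.
Proof. by elim: n => // n IH; rewrite !mulrS sympolyD IH. Qed.

Lemma symfun_eq_upto f g N0 : (forall N, (N0 <= N)%N -> f N = g N) -> f = g.
Proof.
move=> E; apply: symfunP => N; have [NN|/E //] := ltnP N N0.
rewrite -(subKn (ltnW NN)); elim: (N0 - N)%N (leq_subr N N0) => [|k IH] kN.
  by rewrite subn0; apply: E.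
have k1 : (N0 - k = (N0 - k.+1).+1)%N by lia.
have := IH (ltnW kN); rewrite k1 => /(congr1 (@drop_last_var F _)).
by rewrite (sympoly_drop f) (sympoly_drop g).
Qed.

(* Above its degree, a symmetric function has no coefficient that is not seen *)
(* in fewer variables: permute the variables of the monomial.                 *)
Lemma symfun_eq0 f d : (forall N, (msize (f N) <= d)%N) -> f d = 0 -> f = 0.
Proof.
move=> fd f0; apply: (@symfun_eq_upto _ _ d) => N; rewrite sympoly0.
elim: N => [|N IH]; first by rewrite leqn0 => /eqP E; move: f0; rewrite E.
rewrite leq_eqVlt => /predU1P[<- //|dN]; have {IH}fN := IH dN.
apply/mpolyP => m; rewrite mcoeff0; apply/eqP; apply: contraTT (fd N.+1) => fm.
rewrite -ltnNge; apply: (@leq_ltn_trans N) => //.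
have := msize_mdeg_lt (_ : m \in msupp (f N.+1)); rewrite mcoeff_msupp => /(_ fm).
apply: leq_ltn_trans; rewrite leqNgt; apply/negP => mN.
have [i mi] : exists i : 'I_N.+1, m i = 0%N.
  suff /existsP[i /eqP mi] : [exists i : 'I_N.+1, m i == 0%N] by exists i.
  apply: contraTT mN; rewrite negb_exists => /forallP mi.
  rewrite -leqNgt; apply: (@leq_trans N.+1) => //.
  rewrite mdegE -[X in (X <= _)%N]card_ord -sum1_card; apply: leq_sum => i _.
  by rewrite lt0n mi.
case/negP: fm; apply/eqP.
have /issymP/(_ (tperm i ord_max)) fs := sympoly_sym f N.+1.
rewrite -fs mcoeff_sym.
rewrite [X in _@_X](_ : _ =
  mnm_add_var [multinom m (tperm i ord_max (lift ord_max j)) | j < N]).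
  by rewrite -mcoeff_drop_last_var sympoly_drop fN mcoeff0.
apply/mnmP => j; rewrite !mnmE; case: unliftP => [k ->|->]; first by rewrite mnmE.
by rewrite tpermR mi.
Qed.

Definition esub n (p : {mpoly F[n]}) : Lam :=
  mmap (in_alg Lam) (fun i : 'I_n => elementary F i.+1) p.

Lemma esubN n (p : {mpoly F[n]}) N : esub p N =
  mmap (@mpolyC N F) (fun i : 'I_n => mesym N F i.+1) p.
Proof.
rewrite /esub /mmap sympoly_sum; apply: eq_bigr => m _.
rewrite sympolyM sympolyZ sympoly1 -mul_mpolyC mulr1; congr (_ * _).
by rewrite /mmap1 sympoly_prod; apply: eq_bigr => i _; rewrite sympolyXn.
Qed.

Lemma esub_self n (p : {mpoly F[n]}) : esub p n = p \mPo [tuple mesym n F i.+1 | i < n].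
Proof.
rewrite esubN /comp_mpoly /mmap; apply: eq_bigr => m _; congr (_ * _).
by rewrite /mmap1; apply: eq_bigr => i _; rewrite tnth_mktuple.
Qed.

Lemma esub_inj n (p : {mpoly F[n]}) : esub p = 0 -> p = 0.
Proof.
move=> /(congr1 (fun f : Lam => f n)); rewrite esub_self sympoly0.
exact: msym_fundamental_un0.
Qed.

(** With d a degree bound, express f in d variables through e_1, ..., e_d. The difference vanishes
    in d variables and its degree is bounded, so it is 0 by [symfun_eq0]. *)
Lemma esub_surj f : exists n (p : {mpoly F[n]}), f = esub p.
Proof.
have [d fd] := sympoly_bounded f; have [p [pf pw]] := sym_fundamental (sympoly_sym f d).
exists d, p; apply/eqP; rewrite -subr_eq0; apply/eqP; apply: (@symfun_eq0 _ d); last first.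
  by rewrite sympolyD sympolyN esub_self -pf subrr.
move=> N; apply: msize_le => m; apply: contraNT; rewrite -leqNgt => dm.
rewrite sympolyD sympolyN mcoeffB; apply/eqP.
have fm (g : {mpoly F[N]}) : (msize g <= d)%N -> g@_m = 0.
  by move=> gd; apply/eqP; rewrite mcoeff_eq0; apply/msize_mdeg_ge/(leq_trans gd).
rewrite fm ?fd // fm ?subrr // esubN; apply: msize_le => m'; apply: contraNT.
rewrite -leqNgt => dm'; rewrite /mmap raddf_sum /= big_seq big1 // => k kp.
rewrite mcoeffCM; have kd : (mnmwgt k < d)%N.
  by apply: leq_trans (fd d); apply: leq_trans pw; apply: mmeasure_mnm_lt.
suff hk : mmap1 (fun i : 'I_d => mesym N F i.+1) k \is (mnmwgt k).-homog.
  by rewrite (dhomog_nemf_coeff hk) ?mulr0 //= gtn_eqF // (leq_trans kd).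
rewrite /mmap1 /mnmwgt.
apply: (big_rec2 (fun e (g : {mpoly F[N]}) => g \is e.-homog)); first exact: dhomog1.
by move=> i e g _ ge; apply: dhomogM => //; rewrite mulnC; apply/dhomogMn/dhomog_mesym.
Qed.

Lemma mesym_coef N k :
  mesym N F k = (\prod_(i < N) (1 + ('X_i : {mpoly F[N]}) *: 'X) : {poly {mpoly F[N]}})`_k.
Proof.
under eq_bigr do rewrite addrC.
rewrite bigA_distr /mesym coef_sum big_mkcond /=; apply: eq_bigr => J _.
have -> : \prod_i (if i \in J then ('X_i : {mpoly F[N]}) *: 'X else 1) =
    (\prod_(i in J) ('X_i : {mpoly F[N]})) *: 'X^#|J| :> {poly {mpoly F[N]}}.
  rewrite -big_mkcond scaler_prod; congr (_ *: _).
  by rewrite prodr_const.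
by rewrite coefZ coefXn eq_sym; case: eqP => _; rewrite ?mulr1 ?mulr0.
Qed.

Lemma power_sum_mpolyE N k : power_sum_succ F k N = \sum_(i < N) 'X_i ^+ k.+1. Proof. by []. Qed.

Definition pseq k : Lam := if k is k'.+1 then power_sum_succ F k' else 0.
Definition sgn_pseq k : Lam := if k is k'.+1 then (-1) ^+ k' *: power_sum_succ F k' else 0.

Lemma elementary0 : elementary F 0 = 1.
Proof. by apply: symfunP => N; rewrite /= mesym0E. Qed.

Lemma complete0 : complete F 0 = 1.
Proof.
apply: symfunP => N; rewrite sympoly1; apply/mpolyP => m.
by rewrite mcoeff_complete_mpoly mcoeff1 mdeg_eq0.
Qed.

Lemma der_elementary : der (elementary F) =1 conv sgn_pseq (elementary F).
Proof.
move=> k; apply: symfunP => N.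
pose x i : {mpoly F[N]} := oapp (fun j : 'I_N => 'X_j) 0 (insub i).
have xE (i : 'I_N) : x i = 'X_i by rewrite /x valK.
have eE j : mesym N F j = (\prod_(i < N) (1 + x i *: 'X) : {poly {mpoly F[N]}})`_j.
  by rewrite mesym_coef; under eq_bigr do rewrite -xE.
rewrite /conv sympoly_sum /der sympolyMn -[elementary F k N]/(mesym N F k) eE.
have := @der_prod_ode {mpoly F[N]} N x k; rewrite /der => ->.
apply: eq_bigr => i _; rewrite sympolyM -[elementary F _ N]/(mesym N F _) -eE; congr (_ * _).
case: (i : nat) => [|j] //; rewrite /sgn_pseq sympolyZ power_sum_mpolyE -sumrN scaler_sumr.
apply: eq_bigr => l _; rewrite xE; move: ('X_l : {mpoly F[N]}) => y.
elim: j => [|j IH]; first by rewrite !expr1 opprK expr0 scale1r.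
rewrite exprS -mulrN IH -scalerAr mulNr scalerN -scaleNr -exprS; congr (_ *: _).
by rewrite exprS mulN1r.
Qed.

Lemma mcoeff_varXM N (j : 'I_N) e (g : {mpoly F[N]}) m :
  ('X_j ^+ e * g)@_m = if (e <= m j)%N then g@_(m - U_(j) *+ e) else 0.
Proof.
rewrite mpolyXn mulrC; case: ifP => em.
  rewrite -{1}(@submK _ (U_(j) *+ e)%MM m) ?mcoeffMX 1?addmC ?mcoeffMX //.
  by apply/mnm_lepP => i; rewrite mulmnE mnmE; case: eqP => [<-|_]; rewrite ?mul1n ?mul0n.
rewrite (mpolyE g) mulr_suml raddf_sum big1 // => k _ /=.
rewrite -scalerAl mcoeffZ -mpolyXD mcoeffX; case: eqP => [E|_]; last by rewrite mulr0.
move: em; rewrite -E mnmDE mulmnE mnmE eqxx mul1n leq_addl //.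
Qed.

Lemma sum_ltn k a : (\sum_(i < k) (i < a))%N = minn k a.
Proof. by elim: k => [|k IH]; rewrite ?big_ord0 ?min0n // big_ord_recr /= IH; lia. Qed.

(** Coefficientwise count: a monomial of degree k occurs in p_(i+1) h_(k-i-1) once for each variable
    of exponent greater than i. *)
Lemma der_complete : der (complete F) =1 conv pseq (complete F).
Proof.
move=> k; apply: symfunP => N.
rewrite /conv sympoly_sum /der sympolyMn; apply/mpolyP => m.
rewrite mcoeffMn mcoeff_complete_mpoly raddf_sum big_ord_recl /=.
rewrite mul0r mcoeff0 add0r.
have E (i : 'I_k) : (power_sum_mpoly F N i.+1 * complete_mpoly F N (k - i.+1))@_m =
    (\sum_(j < N) ((i < m j)%N && (mdeg m == k)))%:R.
  rewrite /power_sum_mpoly mulr_suml raddf_sum /= natr_sum; apply: eq_bigr => j _.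
  rewrite mcoeff_varXM mcoeff_complete_mpoly; case: ifP => im //=.
  congr (_%:R); congr nat_of_bool.
  have jm : (i.+1 <= mdeg m)%N.
    by apply: leq_trans im _; rewrite mdegE (bigD1 j) //= leq_addr.
  have <- : (mdeg (m - U_(j) *+ i.+1) + i.+1)%N = mdeg m.
    rewrite -{2}(@submK _ (U_(j) *+ i.+1)%MM m) ?mdegD ?mdegMn ?mdeg1 ?mul1n //.
    by apply/mnm_lepP => l; rewrite mulmnE mnmE; case: eqP => [<-|_]; rewrite ?mul1n ?mul0n.
  have := ltn_ord i; lia.
rewrite (eq_bigr _ (fun i _ => E i)) -natr_sum exchange_big /=.
case: eqP => [mk|_]; last first.
  by rewrite mul0rn big1 // => j _; rewrite big1 // => i _; rewrite andbF.
congr (_%:R); rewrite -[LHS]mk mdegE.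
apply: eq_bigr => j _; have jm : (m j <= k)%N by rewrite -mk mdegE (bigD1 j) //= leq_addr.
under eq_bigr do rewrite andbT.
by rewrite sum_ltn (minn_idPr jm).
Qed.

Section Hom.
Variables (A : comNzRingType) (c : {rmorphism F -> A}) (a : nat -> A).

Let asub n (p : {mpoly F[n]}) : A := mmap c (fun i : 'I_n => a i.+1) p.

Let widen n k (nk : (n <= k)%N) (p : {mpoly F[n]}) : {mpoly F[k]} :=
  mmap (@mpolyC k F) (fun i => 'X_(widen_ord nk i)) p.

Let esub_widen n k (nk : (n <= k)%N) p : esub (widen nk p) = esub p.
Proof.
rewrite /widen /mmap /esub raddf_sum; apply: eq_bigr => m _ /=.
rewrite rmorphM /= mmapC; congr (_ * _); rewrite /mmap1 rmorph_prod.
by apply: eq_bigr => i _; rewrite rmorphXn /= mmapX mmap1U.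
Qed.

Let asub_widen n k (nk : (n <= k)%N) p : asub (widen nk p) = asub p.
Proof.
rewrite /widen /mmap /asub raddf_sum; apply: eq_bigr => m _ /=.
rewrite rmorphM /= mmapC; congr (_ * _); rewrite /mmap1 rmorph_prod.
by apply: eq_bigr => i _; rewrite rmorphXn /= mmapX mmap1U.
Qed.

Let sub_wd n (p : {mpoly F[n]}) k (r : {mpoly F[k]}) : esub p = esub r -> asub p = asub r.
Proof.
have [nk kn] : (n <= maxn n k)%N /\ (k <= maxn n k)%N by rewrite leq_maxl leq_maxr.
move=> E; rewrite -(asub_widen nk) -(asub_widen kn); congr asub; apply/eqP.
rewrite -subr_eq0; apply/eqP; apply: esub_inj; rewrite /esub rmorphB /=.
by rewrite -!/(esub _) !esub_widen E subrr.
Qed.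

(** The value at f is read off from any expression of f in the e_k; two expressions are widened to a
    common number of variables and compared by [esub_inj]. *)
Lemma ehom_exists : exists phi : Lam -> A, [/\ {morph phi : f g / f + g},
  {morph phi : f g / f * g}, (forall x, phi (x *: 1) = c x) &
  forall k, phi (elementary F k.+1) = a k.+1].
Proof.
have /choice [phi phiP] : forall f : Lam, exists v, exists n (p : {mpoly F[n]}),
    f = esub p /\ v = asub p.
  by move=> f; have [n [p fp]] := esub_surj f; exists (asub p), n, p.
have phiE n (p : {mpoly F[n]}) : phi (esub p) = asub p.
  by have [k [r [E ->]]] := phiP (esub p); apply/esym/sub_wd.
have two f g : exists n (p r : {mpoly F[n]}), f = esub p /\ g = esub r.
  have [n [p ->]] := esub_surj f; have [k [r ->]] := esub_surj g.
  exists (maxn n k), (widen (leq_maxl n k) p), (widen (leq_maxr n k) r).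
  by rewrite !esub_widen.
exists phi; split.
- move=> f g; have [n [p [r [-> ->]]]] := two f g.
  by rewrite !phiE -[esub p + _](rmorphD (mmap (in_alg Lam) _)) -/(esub _) phiE [asub _]rmorphD.
- move=> f g; have [n [p [r [-> ->]]]] := two f g.
  by rewrite !phiE -[esub p * _](rmorphM (mmap (in_alg Lam) _)) -/(esub _) phiE [asub _]rmorphM.
- move=> x; have -> : x *: (1 : Lam) = esub (x%:MP : {mpoly F[0]}) by rewrite /esub mmapC.
  by rewrite phiE [asub _]mmapC.
- move=> k; have -> : elementary F k.+1 = esub ('X_ord_max : {mpoly F[k.+1]}).
    by rewrite /esub mmapX mmap1U.
  by rewrite phiE [asub _]mmapX mmap1U.
Qed.

Definition is_hom (phi : Lam -> A) := [/\ {morph phi : f g / f + g},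
  {morph phi : f g / f * g} & forall x, phi (x *: 1) = c x].

Section HomTheory.
Variables (phi : Lam -> A) (phiH : is_hom phi).
Lemma homD f g : phi (f + g) = phi f + phi g. Proof. by case: phiH => ->. Qed.
Lemma homM f g : phi (f * g) = phi f * phi g. Proof. by case: phiH => _ ->. Qed.
Lemma homZ x f : phi (x *: f) = c x * phi f.
Proof. by case: phiH => _ _ E; rewrite -[f in LHS]mul1r scalerAl homM E. Qed.
Lemma hom1 : phi 1 = 1.
Proof. by case: phiH => _ _ E; rewrite -[1]scale1r E rmorph1. Qed.
Lemma hom0 : phi 0 = 0.
Proof. by rewrite -(scale0r (1 : Lam)) homZ rmorph0 mul0r. Qed.
Lemma homN f : phi (- f) = - phi f.
Proof. by rewrite -scaleN1r homZ rmorphN1 mulN1r. Qed.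
Lemma hom_sum (I : Type) (r : seq I) (P : pred I) E :
  phi (\sum_(i <- r | P i) E i) = \sum_(i <- r | P i) phi (E i).
Proof. by apply: (big_morph phi homD hom0). Qed.
Lemma hom_prod (I : Type) (r : seq I) (P : pred I) E :
  phi (\prod_(i <- r | P i) E i) = \prod_(i <- r | P i) phi (E i).
Proof. by apply: (big_morph phi homM hom1). Qed.
Lemma homX f n : phi (f ^+ n) = phi f ^+ n.
Proof. by elim: n => [|n IH]; rewrite ?expr0 ?hom1 // !exprS homM IH. Qed.
Lemma homMn f n : phi (f *+ n) = phi f *+ n.
Proof. by elim: n => [|n IH]; rewrite ?mulr0n ?hom0 // !mulrS homD IH. Qed.
Lemma hom_conv u v : phi \o conv u v =1 conv (phi \o u) (phi \o v).
Proof. by move=> n; rewrite /= hom_sum; apply: eq_bigr => i _; rewrite homM. Qed.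
End HomTheory.

Hypothesis char0 : forall n, n.+1%:R != 0 :> F.

Lemma hom_natI n (x y : A) : x *+ n.+1 = y *+ n.+1 -> x = y.
Proof.
move=> /(congr1 (fun z => c (n.+1%:R^-1) * z)); rewrite !mulrnAr -!mulrnAl -rmorphMn /=.
by rewrite -[_ *+ _]mulr_natr mulVf // rmorph1 !mul1r.
Qed.

Lemma hom_der phi : is_hom phi -> der (phi \o elementary F) =1
  conv (phi \o sgn_pseq) (phi \o elementary F).
Proof.
by move=> pH n; rewrite -hom_conv // /= -der_elementary /der /= homMn.
Qed.

End Hom.

Section HomExists.
Variables (A : comNzRingType) (c : {rmorphism F -> A}) (a : nat -> A).
Hypothesis char0 : forall n, n.+1%:R != 0 :> F.
Let sgn n : A := if n is k.+1 then (-1) ^+ k * a k else 0.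

(** Newton's identities solved for the e_n when the power sums have the prescribed values a; the
    division by n uses characteristic 0. *)
Fixpoint exp_tab n : nat -> A :=
  if n is n'.+1 then fun k => if (k <= n')%N then exp_tab n' k
    else c (n'.+1%:R^-1) * \sum_(i < n'.+1) sgn i.+1 * exp_tab n' (n' - i)%N
  else fun=> 1.
Let eps n := exp_tab n n.

Let exp_tabE n k : (k <= n)%N -> exp_tab n k = eps k.
Proof.
elim: n => [|n IH]; first by case: k.
by rewrite leq_eqVlt => /predU1P[->//|kn] /=; rewrite -ltnS kn IH.
Qed.

Let der_eps : der eps =1 conv sgn eps.
Proof.
move=> [|n]; first by rewrite /der mulr0n /conv big_ord1 mul0r.
rewrite /der /conv big_ord_recl mul0r add0r {1}/eps /= ltnn -mulrnAl -rmorphMn /=.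
rewrite -[_ *+ _]mulr_natr mulVf // rmorph1 mul1r; apply: eq_bigr => i _.
by rewrite /= exp_tabE ?leq_subr // subSS.
Qed.


Lemma hom_exists : exists phi, is_hom c phi /\ forall k, phi (power_sum_succ F k) = a k.
Proof.
have [phi [pD pM pZ pe]] := ehom_exists c eps.
have pH : is_hom c phi by [].
exists phi; split=> // k.
have Ee : phi \o elementary F =1 eps.
  by move=> [|n] /=; rewrite ?pe // elementary0 (hom1 pH).
have e0 : eps 0 = 1 by [].
have E : phi \o sgn_pseq =1 sgn.
  apply: (conv_cancel e0) => n; rewrite convC [RHS]convC -der_eps.
  by rewrite -(eq_conv (frefl _) Ee) -(hom_der pH) /der Ee.
have := E k.+1; rewrite /= (homZ pH) rmorphXn rmorphN1.
by move/(congr1 (fun z => (-1) ^+ k * z)); rewrite !mulrA -exprMn mulrNN mulr1 expr1n !mul1r.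
Qed.

End HomExists.

Section HomUnique.
Variables (A : comNzRingType) (c : {rmorphism F -> A}).
Hypothesis char0 : forall n, n.+1%:R != 0 :> F.

Lemma hom_unique (phi psi : Lam -> A) : is_hom c phi -> is_hom c psi ->
  (forall k, phi (power_sum_succ F k) = psi (power_sum_succ F k)) -> phi =1 psi.
Proof.
move=> pH sH E.
have Ee : phi \o elementary F =1 psi \o elementary F.
  apply: (ode_unique (hom_natI c char0) (p := phi \o sgn_pseq)).
  - by rewrite /= (hom0 pH).
  - by rewrite /= elementary0 (hom1 pH) (hom1 sH).
  - exact: (hom_der pH).
  move=> n; rewrite (hom_der sH); apply: eq_conv => // -[|k] /=; rewrite ?(hom0 pH) ?(hom0 sH) //.
  by rewrite (homZ pH) (homZ sH) E.
move=> f; have [n [p ->]] := esub_surj f; rewrite /esub /mmap (hom_sum pH) (hom_sum sH).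
apply: eq_bigr => m _; rewrite (homM pH) (homM sH); congr (_ * _).
  by case: (pH) (sH) => _ _ -> [_ _ ->].
rewrite /mmap1 (hom_prod pH) (hom_prod sH); apply: eq_bigr => i _.
by rewrite (homX pH) (homX sH); congr (_ ^+ _); apply: Ee.
Qed.

End HomUnique.

End SymfunGenerators.

(** * The operator D0 *)

Section LambdaOperators.
Variable F : fieldType.
Hypothesis char0 : forall n, n.+1%:R != 0 :> F.
Local Notation Lam := (symfun F).
Local Notation p_ := (power_sum_succ F).
Local Notation e_ := (elementary F).
Local Notation h_ := (complete F).
Implicit Types (f g : Lam) (d : nat -> F).

Lemma id_hom : is_hom (in_alg Lam) id.
Proof. by split. Qed.

Definition diag d : Lam -> Lam :=
  sval (cid (hom_exists (in_alg Lam) (fun k => d k *: p_ k) char0)).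

Lemma diag_hom d : is_hom (in_alg Lam) (diag d).
Proof. by rewrite /diag; case: cid => phi []. Qed.

Lemma diag_p d k : diag d (p_ k) = d k *: p_ k.
Proof. by rewrite /diag; case: cid => phi []. Qed.

Lemma diagZ d a f : diag d (a *: f) = a *: diag d f.
Proof. by rewrite (homZ (diag_hom d)) mulr_algl. Qed.

Lemma hom_comp (A : comNzRingType) (c : {rmorphism F -> A}) (phi : Lam -> A) (psi : Lam -> Lam) :
  is_hom c phi -> is_hom (in_alg Lam) psi -> is_hom c (phi \o psi).
Proof.
move=> pH sH; split => [f g|f g|x] /=.
- by rewrite (homD sH) (homD pH).
- by rewrite (homM sH) (homM pH).
by rewrite (homZ sH) (hom1 sH) mulr1; case: pH => _ _ ->.
Qed.

Lemma diag_comp d d' f : diag d (diag d' f) = diag (fun k => d k * d' k) f.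
Proof.
apply: (hom_unique char0 (phi := diag d \o diag d') (c := in_alg Lam)).
- by apply: hom_comp; apply: diag_hom.
- exact: diag_hom.
by move=> k; rewrite /= !diag_p diagZ diag_p scalerA mulrC.
Qed.

Lemma diag_id d f : (forall k, d k = 1) -> diag d f = f.
Proof.
move=> d1; apply: (hom_unique char0 (phi := diag d) (psi := id) (c := in_alg Lam)).
- exact: diag_hom.
- exact: id_hom.
by move=> k; rewrite diag_p d1 scale1r.
Qed.

Lemma diagK d : (forall k, d k != 0) -> cancel (diag d) (diag (fun k => (d k)^-1)).
Proof. by move=> d0 f; rewrite diag_comp diag_id // => k; rewrite mulVf. Qed.

(* f |-> f[X + D w] with p_k[D] = d_(k-1), as a polynomial in w. *)
Definition shift_const : {rmorphism F -> {poly Lam}} := polyC \o in_alg Lam.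

Definition shift d : Lam -> {poly Lam} :=
  sval (cid (hom_exists shift_const (fun k => (p_ k)%:P + (d k *: (1 : Lam)) *: 'X^(k.+1)) char0)).

Lemma shift_hom d : is_hom shift_const (shift d).
Proof. by rewrite /shift; case: cid => phi []. Qed.

Lemma shift_p d k : shift d (p_ k) = (p_ k)%:P + (d k *: (1 : Lam)) *: 'X^(k.+1).
Proof. by rewrite /shift; case: cid => phi []. Qed.

(** The linear functional w^r |-> u_r, so that [D0_gen u d f] is the sum of u_r [w^r] f[X + D w]. *)
Definition pairing (u : nat -> Lam) (P : {poly Lam}) : Lam := \sum_(r < size P) u r * P`_r.

Lemma pairingE u (P : {poly Lam}) n : (size P <= n)%N -> pairing u P = \sum_(r < n) u r * P`_r.
Proof.
move=> Pn; rewrite /pairing (big_ord_widen n (fun r => u r * P`_r)) //.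
rewrite [in RHS](bigID (fun r : 'I_n => r < size P)%N) /= [X in _ + X]big1 ?addr0 // => r.
by rewrite -leqNgt => Pr; rewrite nth_default ?mulr0.
Qed.

Lemma pairingD u P Q : pairing u (P + Q) = pairing u P + pairing u Q.
Proof.
pose n := maxn (size P) (size Q).
rewrite (@pairingE _ _ n) ?size_polyD // (@pairingE _ P n) ?leq_maxl // (@pairingE _ Q n) ?leq_maxr //.
by rewrite -big_split; apply: eq_bigr => r _; rewrite coefD mulrDr.
Qed.

Lemma pairingC u (a : Lam) P : pairing u (a%:P * P) = a * pairing u P.
Proof.
rewrite (@pairingE _ _ (size P)) ?mul_polyC ?size_scale_leq // mulr_sumr.
by apply: eq_bigr => r _; rewrite coefZ mulrCA.
Qed.

Definition D0_gen (u : nat -> Lam) d f := pairing u (shift d f).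

Lemma D0_gen_lin u d : lin (D0_gen u d).
Proof.
move=> c f g; rewrite /D0_gen (homD (shift_hom d)) (homZ (shift_hom d)) pairingD.
by rewrite -[shift_const c]/((c *: (1 : Lam))%:P) pairingC mulr_algl.
Qed.


Section Kappa.
Variables (q t : F).
Hypotheses (t_neq0 : t != 0) (t_neq1 : t != 1) (q_neq0 : q != 0).

Definition kappa_coef k := (-1) ^+ k * (1 - t ^+ k.+1).
(* f |-> (-1)^(deg f) f[(t - 1) X] *)
Definition kappa := diag kappa_coef.
Definition kap N f : {mpoly F[N]} := kappa f N.

Lemma kappa_hom : is_hom (in_alg Lam) kappa.
Proof. exact: diag_hom. Qed.

Lemma kap_hom N : is_hom (@mpolyC N F) (kap N).
Proof.
split=> [f g|f g|x]; rewrite /kap ?(homD kappa_hom) ?(homM kappa_hom) //.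
by rewrite (homZ kappa_hom) (hom1 kappa_hom) mulr1 /= -mul_mpolyC mulr1.
Qed.

Fact kap_zmod N : zmod_morphism (kap N).
Proof. by move=> f g; rewrite (homD (kap_hom N)) (homN (kap_hom N)). Qed.
Fact kap_monoid N : monoid_morphism (kap N).
Proof. by split=> [|f g]; rewrite ?(hom1 (kap_hom N)) ?(homM (kap_hom N)). Qed.
HB.instance Definition _ N := GRing.isZmodMorphism.Build Lam {mpoly F[N]} (kap N) (@kap_zmod N).
HB.instance Definition _ N := GRing.isMonoidMorphism.Build Lam {mpoly F[N]} (kap N) (kap_monoid N).

Lemma kapZ N c f : kap N (c *: f) = c *: kap N f.
Proof. by rewrite (homZ (kap_hom N)) mul_mpolyC. Qed.

Lemma kap_sym N f : kap N f \is symmetric.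
Proof. exact: sympoly_sym. Qed.

Lemma kap_p N k : kap N (p_ k) = kappa_coef k *: \sum_(i < N) 'X_i ^+ k.+1.
Proof. by rewrite /kap /kappa diag_p. Qed.

Lemma kap_inj f g N0 : (forall k, t ^+ k.+1 != 1) ->
  (forall N, (N0 <= N)%N -> kap N f = kap N g) -> f = g.
Proof.
move=> tn E; apply: (can_inj (diagK (d := kappa_coef) _)).
  by move=> k; rewrite mulf_neq0 ?expf_neq0 ?oppr_eq0 ?oner_eq0 // subr_eq0 eq_sym tn.
exact: (symfun_eq_upto E).
Qed.

Lemma twistA z (u : nat -> Lam) n : twist z%:A u n = z ^+ n *: u n.
Proof. by rewrite /twist -[z%:A]/(in_alg Lam z) -rmorphXn mulr_algl. Qed.

(** The series of kappa(e_n) is E(- t z) / E(- z), the generating function of the one-row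
    Hall-Littlewood functions. *)
Lemma twist_e_kappa : conv (twist (-1)%:A e_) (kappa \o e_) =1 twist (- t)%:A e_.
Proof.
have nat_inj n (x y : Lam) : x *+ n.+1 = y *+ n.+1 -> x = y by apply: (hom_natI (in_alg Lam) char0).
apply: (ode_unique nat_inj (p := fun k => twist (-1)%:A (sgn_pseq F) k + kappa (sgn_pseq F k))).
- by rewrite /twist /= mulr0 add0r (hom0 kappa_hom).
- by rewrite conv0 /twist /= !expr0 !mul1r elementary0 (hom1 kappa_hom) mulr1.
- apply: der_conv_ode => n; last exact: (hom_der kappa_hom).
  by rewrite der_twist -twist_conv /twist der_elementary.
move=> n; rewrite der_twist /twist der_elementary -/(twist _ _ n) twist_conv.
apply: eq_conv => // k; rewrite -/(twist _ _ k) -/(twist _ _ k) !twistA; case: k => [|k].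
  by rewrite /= !scaler0 (hom0 kappa_hom) addr0.
rewrite /sgn_pseq /kappa diagZ diag_p /kappa_coef !scalerA -scalerDl; congr (_ *: _).
have ss : (-1) ^+ k * (-1) ^+ k = 1 :> F by rewrite -exprD addnn -muln2 mulnC exprM sqrrN expr1n expr1n.
by rewrite [(- t) ^+ _]exprNn [in RHS]mulrA ss mul1r exprS !mulN1r !mulNr ss mulrAC ss mul1r addrA addNr add0r.
Qed.

Section FixedRank.
Variable K : nat.
Let P : comAlgType F := {mpoly F[K.+1]}.
Let x := xvar F K.
Let E n : P := (\prod_(l < K.+1) (1 + x l *: 'X) : {poly P})`_n.
Let E' n : P := (\prod_(l < K) (1 + x l *: 'X) : {poly P})`_n.
Local Notation symm := (@symm F t K).

Lemma xvar_ord (i : 'I_K.+1) : xvar F K i = 'X_i.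
Proof. by rewrite /xvar inord_val. Qed.

Let EE n : E n = e_ n K.+1.
Proof.
rewrite -[RHS]/(mesym K.+1 F n) mesym_coef /E; congr (polyseq _)`_n.
by apply: eq_bigr => i _; rewrite /x xvar_ord.
Qed.

Let E'E n : E' n = \sum_(i < n.+1) (- x K) ^+ i * E (n - i).
Proof.
have ES m : E m.+1 = E' m.+1 + x K * E' m.
  rewrite /E big_ord_recr /= mulrDr mulr1 coefD -scalerAr coefZ coefMX //.
elim: n => [|n IH].
  rewrite big_ord1 expr0 mul1r /E big_ord_recr /= mulrDr mulr1 coefD -scalerAr coefZ coefMX.
  by rewrite mulr0 addr0.
rewrite big_ord_recl expr0 mul1r subn0 ES.
under eq_bigr do rewrite exprS -mulrA subSS.
by rewrite -mulr_sumr -IH mulNr addrK.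
Qed.

Let exprN_scale (y : P) i : (- y) ^+ i = (-1) ^+ i *: y ^+ i.
Proof. by elim: i => [|i IH]; rewrite ?expr0 ?scale1r // !exprS IH mulN1r scaleNr mulNr scalerAr. Qed.

Lemma symm1 : symm 1 = (1 - t ^+ K.+1) *: 1.
Proof.
have := symm_prefix t_neq0 t_neq1 q_neq0 K 0.
suff c0 k : (\prod_(l < k) (1 + x l *: 'X) : {poly P})`_0 = 1 by rewrite !c0.
rewrite -horner_coef0 horner_prod big1 // => i _.
by rewrite hornerD hornerZ hornerX mulr0 addr0 -polyC1 hornerC.
Qed.

(** Expand e_m(x_0, ..., x_(K-1)) as the sum of (- x_K)^i e_(m-i)(x_0, ..., x_K) and symmetrize. By
    [symm_prefix] the symmetrized powers of x_K satisfy the relation [twist_e_kappa], which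
    determines kappa(e_n). *)
Lemma symm_varX n : symm (x K ^+ n.+1) = kap K.+1 (e_ n.+1).
Proof.
(* At 0 the value is 1 rather than symm 1 = 1 - t^(K+1); the discrepancy cancels the term t^(K+1) in
   [symm_prefix]. *)
pose s n : P := if n is n.+1 then symm (x K ^+ n.+1) else 1.
have symm_s i : symm (x K ^+ i) = s i - (if i is 0 then t ^+ K.+1 *: 1 else 0).
  by case: i => [|i] /=; rewrite ?subr0 // expr0 symm1 scalerBl scale1r.
suff : s =1 kap K.+1 \o e_ by move/(_ n.+1).
have tw z (u : nat -> P) m : twist z%:A u m = z ^+ m *: u m.
  by rewrite /twist -[z%:A]/(in_alg P z) -rmorphXn mulr_algl.
apply: (@conv_cancel _ (twist (-1)%:A E)).
  by rewrite tw EE elementary0 sympoly1 scale1r.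
move=> m; transitivity (twist (- t)%:A E m); last first.
  have := congr1 (fun f : Lam => f K.+1) (twist_e_kappa m).
  rewrite twistA sympolyZ tw EE => <-; rewrite /conv sympoly_sum; apply: eq_bigr => i _.
  by rewrite sympolyM twistA tw EE sympolyZ.
have symE k (f : P) : symm (E k * f) = E k * symm f.
  by rewrite (symm_mul t_neq0 q_neq0) // EE; apply: sympoly_sym.
have : symm (E' m) = (t ^+ m - t ^+ K.+1) *: E m.
  exact: (symm_prefix t_neq0 t_neq1 q_neq0 K m).
have SL := symm_lin t_neq0 q_neq0 (K := K).
have term i k : symm ((- x K) ^+ i * E k) =
    (-1) ^+ i *: (s i * E k) - (if i is 0 then t ^+ K.+1 *: E k else 0).
  rewrite exprN_scale -scalerAl.
  rewrite (linZ SL) mulrC symE symm_s mulrBr mulrC scalerBr; congr (_ - _).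
  by case: (i) => [|j]; rewrite ?mulr0 ?scaler0 // expr0 scale1r -scalerAr mulr1.
rewrite E'E (lin_sum SL); under eq_bigr do rewrite term.
rewrite sumrB [X in _ - X]big_ord_recl subn0 [X in _ - (_ + X)]big1 // addr0 scalerBl => /addIr TE.
rewrite convC /conv tw exprNn -scalerA -TE scaler_sumr; apply: eq_bigr => i _.
rewrite tw -scalerAr scalerA; congr (_ *: _).
have im : (i <= m)%N by rewrite -ltnS.
move: (i : nat) im => j jm; rewrite -{2}(subnKC jm) [RHS]mulrC exprD mulrA -exprD addnn -muln2 mulnC exprM.
by rewrite sqrrN !expr1n mul1r.
Qed.

Definition D0_coef k := (1 - q ^+ k.+1) * (1 - t ^+ k.+1).
(* The operator sum_r (-1)^r e_r [w^r] f[X + (1 - q)(1 - t) w], which has the *)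
(* modified Macdonald polynomials as eigenvectors.                            *)
Definition D0 := D0_gen (fun r => (-1) ^+ r *: e_ r) D0_coef.

Lemma D0_lin : lin D0.
Proof. exact: D0_gen_lin. Qed.

Lemma qrot_power_sum k : qrot q (\sum_(i < K.+1) ('X_i : P) ^+ k) =
  \sum_(i < K.+1) 'X_i ^+ k + (q ^+ k - 1) *: x K ^+ k.
Proof.
have qD := big_morph (qrot q (K := K)) (@qrotD F q K) (linear0 _ : qrot q 0 = 0).
rewrite [in LHS](eq_bigr (fun i : 'I_K.+1 => x i ^+ k)); last by move=> i _; rewrite /x xvar_ord.
rewrite [in RHS](eq_bigr (fun i : 'I_K.+1 => x i ^+ k)); last by move=> i _; rewrite /x xvar_ord.
have qX y : qrot q (y ^+ k) = qrot q y ^+ k by exact: rmorphXn.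
rewrite qD big_ord_recl [in RHS]big_ord_recr /= -addrA scalerBl scale1r.
rewrite qX qrot_var0 exprZn [x K ^+ k + _]addrC subrK addrC; congr (_ + _).
by apply: eq_bigr => i _; rewrite qX /bump /= add1n qrot_varS.
Qed.

(** The rotation adds (q^k - 1) x_K^k to the power sum p_k, which through [kap] is the shift X + (1
    - q)(1 - t) w at w = - x_K. *)
Lemma qrot_kap f : qrot q (kap K.+1 f) = (map_poly (kap K.+1) (shift D0_coef f)).[- x K].
Proof.
have sH := shift_hom D0_coef.
pose phi g := (map_poly (kap K.+1) (shift D0_coef g)).[- x K].
apply: (hom_unique char0 (phi := fun g => qrot q (kap K.+1 g)) (psi := phi) (c := @mpolyC K.+1 F)).
- split=> [g h|g h|c]; rewrite ?(homD (kap_hom _)) ?(homM (kap_hom _)) ?qrotD ?qrotM //.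
  by rewrite kapZ (hom1 (kap_hom _)) -mul_mpolyC mulr1 qrotC.
- split=> [g h|g h|c]; rewrite /phi ?(homD sH) ?(homM sH) ?rmorphD ?rmorphM ?hornerD ?hornerM //.
  by rewrite (homZ sH) (hom1 sH) mulr1 map_polyC hornerC /= kapZ (hom1 (kap_hom _)) -mul_mpolyC mulr1.
move=> k; rewrite /phi shift_p rmorphD /= map_polyC hornerD hornerC map_polyZ map_polyXn hornerZ hornerXn.
change (qrot q (kap K.+1 (p_ k)) = kap K.+1 (p_ k) + kap K.+1 ((D0_coef k)%:A) * (- x K) ^+ k.+1).
rewrite kap_p qrotZ qrot_power_sum scalerDr kapZ (hom1 (kap_hom _)); congr (_ + _).
rewrite scalerA -scalerAl mul1r exprN_scale scalerA.
congr (_ *: _); rewrite /kappa_coef /D0_coef [(-1) ^+ k.+1]exprS; ring.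
Qed.

(** After [qrot_kap], symmetrization replaces x_K^r by kap(e_r). The summand with t^(K+1) corrects r
    = 0, where symm 1 = 1 - t^(K+1). *)
Lemma kap_D0 f : kap K.+1 (D0 f) = symm (qrot q (kap K.+1 f)) + t ^+ K.+1 *: kap K.+1 f.
Proof.
rewrite qrot_kap /D0 /D0_gen; set S := shift _ _.
have S0 : S`_0 = f.
  pose phi g := (shift D0_coef g)`_0; have sH := shift_hom D0_coef.
  apply: (hom_unique char0 (phi := phi) (psi := id) (c := in_alg Lam)) => //.
  - split=> [g h|g h|c]; rewrite /phi ?(homD sH) ?(homM sH) ?coefD -?horner_coef0 ?hornerM //.
    by rewrite (homZ sH) (hom1 sH) mulr1 hornerC.
  - by move=> k; rewrite /phi shift_p coefD coefC coefZ coefXn mulr0 addr0.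
have Sn : (size S <= (size S).+1)%N by [].
rewrite (pairingE _ Sn) (horner_coef_wide _ (leq_trans (size_poly _ _) Sn)).
have SL := symm_lin t_neq0 q_neq0 (K := K).
rewrite rmorph_sum (lin_sum SL) !big_ord_recl /= !coef_map /= S0 !expr0 mulr1 scale1r elementary0 mul1r.
rewrite -[X in symm X]mulr1 (symm_mul t_neq0 q_neq0) ?kap_sym // symm1 -scalerAr mulr1 scalerBl scale1r.
rewrite addrAC subrK; congr (_ + _); apply: eq_bigr => i _.
rewrite rmorphM /= kapZ -symm_varX coef_map /= (symm_mul t_neq0 q_neq0) ?kap_sym // mulrC; congr (_ * _).
by rewrite exprN_scale (linZ SL).
Qed.

End FixedRank.
End Kappa.

End LambdaOperators.

(** * Iterated commutators of D0 with e_1 *)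

Section Commutators.
Variable F : fieldType.
Hypothesis char0 : forall n, n.+1%:R != 0 :> F.
Variables (q t : F).
Hypotheses (t_neq0 : t != 0) (t_neq1 : t != 1) (q_neq0 : q != 0).
Local Notation Lam := (symfun F).
Local Notation p_ := (power_sum_succ F).
Local Notation e_ := (elementary F).
Local Notation h_ := (complete F).
Local Notation D0 := (D0 char0 q t).
Local Notation kap := (kap char0 t).

Fixpoint D0_comm k (f : Lam) : Lam :=
  if k is k'.+1 then D0_comm k' (e_ 1 * f) - e_ 1 * D0_comm k' f else D0 f.

Lemma elementary1 : e_ 1 = p_ 0.
Proof. by apply: symfunP => N; rewrite /= mesym1E. Qed.

Lemma kap_e1 N : kap N (e_ 1) = (1 - t) *: \sum_(i < N) 'X_i.
Proof. by rewrite elementary1 kap_p /kappa_coef expr0 mul1r expr1. Qed.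

Section FixedRank.
Variable K : nat.
Local Notation symm := (@symm F t K).
Local Notation x := (xvar F K).

(** Under [kap], e_1 becomes a symmetric S with qrot S = S + c x_K, where c = (1 - t)(q - 1). Each
    commutator thus inserts a factor c x_K under the symmetrization. *)
Lemma kap_D0_comm k f : kap K.+1 (D0_comm k f) =
  ((1 - t) * (q - 1)) ^+ k *: symm (x K ^+ k * qrot q (kap K.+1 f)) +
  (if k is 0 then t ^+ K.+1 *: kap K.+1 f else 0).
Proof.
elim: k f => [|k IH] f; first by rewrite /= expr0 scale1r mul1r kap_D0.
have SL := symm_lin t_neq0 q_neq0 (K := K).
set c := (1 - t) * (q - 1) in IH *; set S := kap K.+1 (e_ 1); set Y := kap K.+1 f in IH *.
have sS : S \is symmetric by apply: kap_sym.
have qS : qrot q S = S + c *: x K.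
  rewrite /S kap_e1 qrotZ (eq_bigr (fun i => 'X_i ^+ 1)) // qrot_power_sum scalerDr scalerA.
  by congr (_ *: _ + _); rewrite ?expr1.
have -> : kap K.+1 (D0_comm k.+1 f) = kap K.+1 (D0_comm k (e_ 1 * f)) - S * kap K.+1 (D0_comm k f).
  by rewrite /= rmorphB rmorphM.
rewrite !IH rmorphM /= -/S -/Y qrotM qS mulrDl mulrDr addr0.
have -> : x K ^+ k * (S * qrot q Y) = S * (x K ^+ k * qrot q Y) by rewrite mulrCA.
have -> : x K ^+ k * (c *: x K * qrot q Y) = c *: (x K ^+ k.+1 * qrot q Y).
  by rewrite -scalerAl -scalerAr mulrA -exprSr.
rewrite (linD SL) (linZ SL) (symm_mul t_neq0 q_neq0) //.
set A := symm _; set B := symm _; rewrite mulrDr scalerDr -[S * (_ *: A)]scalerAr scalerA -exprSr.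
have -> : S * (match k with 0%N => t ^+ K.+1 *: Y | _.+1 => 0 end) =
  match k with 0%N => t ^+ K.+1 *: (S * Y) | _.+1 => 0 end.
  by case: (k) => [|_]; rewrite ?mulr0 // -scalerAr.
by rewrite opprD addrACA subrr addr0 addrAC subrr add0r.
Qed.

End FixedRank.

Lemma D0_comm1 n : (forall k, t ^+ k.+1 != 1) ->
  D0_comm n.+1 1 = ((1 - t) * (q - 1)) ^+ n.+1 *: e_ n.+1.
Proof.
move=> tn; apply: (kap_inj (N0 := 1) tn) => -[//|K] _.
by rewrite kap_D0_comm addr0 rmorph1 /qrot rmorph1 mulr1 (symm_varX char0 t_neq0 t_neq1 q_neq0) kapZ.
Qed.

End Commutators.

(** * The homomorphism that interpolates the evaluations over all N *)

Section PsiHom.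
Variable F : fieldType.
Hypothesis char0 : forall n, n.+1%:R != 0 :> F.
Local Notation Lam := (symfun F).
Local Notation p_ := (power_sum_succ F).
Local Notation h_ := (complete F).

Definition Psi : Lam -> {poly F} := sval (cid (hom_exists (@polyC F)
  (fun k => (-1) ^+ k *: (1 - (- 'X) ^+ k.+1)) char0)).

Lemma Psi_hom : is_hom (@polyC F) Psi.
Proof. by rewrite /Psi; case: cid => phi []. Qed.

Lemma Psi_p k : Psi (p_ k) = (-1) ^+ k *: (1 - (- 'X) ^+ k.+1).
Proof. by rewrite /Psi; case: cid => phi []. Qed.

Fact Psi_zmod : zmod_morphism Psi.
Proof. by move=> f g; rewrite (homD Psi_hom) (homN Psi_hom). Qed.
Fact Psi_monoid : monoid_morphism Psi.
Proof. by split=> [|f g]; rewrite ?(hom1 Psi_hom) ?(homM Psi_hom). Qed.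
HB.instance Definition _ := GRing.isZmodMorphism.Build Lam {poly F} Psi Psi_zmod.
HB.instance Definition _ := GRing.isMonoidMorphism.Build Lam {poly F} Psi Psi_monoid.

Lemma evt_kap t K f : evt t (kap char0 t K.+1 f) = (Psi f).[- t ^+ K.+1].
Proof.
apply: (hom_unique char0 (phi := fun f => evt t (kap char0 t K.+1 f)) (psi := fun f => (Psi f).[- t ^+ K.+1]) (c := idfun)).
- split=> [g h|g h|c]; rewrite ?rmorphD ?rmorphM ?evtD ?evtM //.
  by rewrite kapZ rmorph1 evtZ evt1 mulr1.
- split=> [g h|g h|c]; rewrite ?(homD Psi_hom) ?(homM Psi_hom) ?hornerD ?hornerM //.
  by rewrite (homZ Psi_hom) (hom1 Psi_hom) mulr1 hornerC.
move=> k; rewrite kap_p evtZ Psi_p hornerZ /kappa_coef -mulrA; congr (_ * _).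
rewrite hornerD hornerN horner_exp hornerN hornerX opprK hornerC.
have -> : evt t (\sum_(i < K.+1) ('X_i : {mpoly F[K.+1]}) ^+ k.+1) = \sum_(i < K.+1) (t ^+ k.+1) ^+ i.
  rewrite /evt raddf_sum (reindex_inj rev_ord_inj) /=; apply: eq_bigr => i _.
  have iK : (i <= K)%N by rewrite -ltnS.
  by rewrite rmorphXn /= mevalXU /= subSS subKn ?iK // exprAC.
by rewrite -!exprM mulnC exprM -[in RHS]opprB subrX1 -mulNr opprB.
Qed.

(** The series of the Psi(h_k) is (1 + z) / (1 - X z), the product of the series A and B. *)
Lemma Psi_h k : Psi (h_ k) = (if k is k'.+1 then 'X^k + 'X^k' else 1).
Proof.
have nat_inj n (x y : {poly F}) : x *+ n.+1 = y *+ n.+1 -> x = y by apply: (hom_natI (@polyC F) char0).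
pose A k : {poly F} := 'X^k; pose B k : {poly F} := (k <= 1)%N%:R.
have AB : (fun k => if k is k'.+1 then 'X^k + 'X^k' else 1) =1 conv A B.
  move=> [|n]; rewrite /conv; first by rewrite big_ord1 mulr1.
  rewrite !big_ord_recr /= subnn subSnn !mulr1 big1 ?add0r 1?addrC // => i _.
  by rewrite /B; case: leqP => [|_]; rewrite ?mulr0 //; have := ltn_ord i; lia.
rewrite [RHS]AB.
pose r k : {poly F} := if k is 0 then 0 else 'X^k.
pose s k : {poly F} := if k is k'.+1 then (-1) ^+ k' else 0.
have dA : der A =1 conv r A.
  move=> n; rewrite /der /conv big_ord_recl mul0r add0r.
  rewrite (eq_bigr (fun=> 'X^n)) ?sumr_const ?card_ord // => i _.
  by rewrite /= -exprD subnKC //; have := ltn_ord i; rewrite /bump; lia.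
have dB : der B =1 conv s B.
  move=> [|[|n]]; rewrite /der /conv.
  - by rewrite big_ord1 mul0r mulr0n.
  - by rewrite big_ord_recl big_ord1 mul0r add0r mulr1.
  rewrite !big_ord_recr /= subnn subSnn !mulr1 big1 ?add0r => [|i _]; last first.
    by rewrite /B; case: leqP => [|_]; rewrite ?mulr0 //; have := ltn_ord i; lia.
  have -> : (n.+2 - n = 2)%N by lia.
  by rewrite mulr0 add0r exprS mulN1r subrr /B mul0rn.
apply: (ode_unique nat_inj (p := fun k => r k + s k) (a := Psi \o h_)).
- by rewrite addr0.
- by rewrite /= complete0 (hom1 Psi_hom) conv0 mulr1.
- move=> n; rewrite /der /= -(homMn Psi_hom) -/(der _ n) der_complete.
  rewrite -[LHS]/((Psi \o conv _ _) n) (hom_conv Psi_hom); apply: eq_conv => // -[|i] /=.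
    by rewrite (hom0 Psi_hom) addr0.
  rewrite Psi_p [(- 'X) ^+ _]exprNn [(-1) ^+ i.+1]exprS mulN1r mulNr opprK -mul_polyC rmorphXn rmorphN1 mulrDr mulr1.
  by rewrite mulrA -exprD addnn -muln2 mulnC exprM sqrrN !expr1n mul1r addrC.
- exact: der_conv_ode.
Qed.

End PsiHom.

(** * Dominance order and spans *)

Section PartitionOrder.
Implicit Types (s al be nu la mu : seq nat) (k j n : nat).

Definition psum k s := sumn (take k s).

Lemma psum0 s : psum 0 s = 0%N. Proof. by rewrite /psum take0. Qed.
Lemma psumS k a s : psum k.+1 (a :: s) = (a + psum k s)%N. Proof. by []. Qed.

(* Dominance between compositions, without sorting their entries. *)
Definition sge nu al := [/\ size nu = size al, sumn nu = sumn al &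
  forall k, (psum k al <= psum k nu)%N].
Definition sgt nu al := sge nu al /\ nu <> al.

Lemma sge_refl al : sge al al. Proof. by []. Qed.

Lemma psum_inj s s' : size s = size s' -> (forall k, psum k s = psum k s') -> s = s'.
Proof.
elim: s s' => [|a s IH] [|b s'] // [ss] E.
have /eqP ab := E 1%N; rewrite !psumS !psum0 !addn0 in ab; rewrite (eqP ab) in E *.
by congr (_ :: _); apply: IH => // k; have /eqP := E k.+1; rewrite !psumS eqn_add2l => /eqP.
Qed.

Lemma sge_insert x nu b a al j : sge (x :: nu) ((a + j)%N :: al) -> (j <= b)%N ->
  sge [:: x, (b - j)%N & nu] [:: a, b & al].
Proof.
move=> [/= [ss] sm E] jb; split; rewrite /= ?ss //; first by move: sm; lia.
move=> [|[|k]]; rewrite ?psum0 //; first by have := E 1%N; rewrite !psumS !psum0; lia.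
by have := E k.+1; rewrite !psumS; lia.
Qed.

Lemma sge_shift nu b a al j : sge nu ((b - j)%N :: al) -> (j <= b)%N ->
  sge ((a + j)%N :: nu) [:: a, b & al].
Proof.
move=> [/= ss sm E] jb; split; rewrite /= ?ss //; first by move: sm; lia.
move=> [|[|k]]; rewrite ?psum0 //; first by rewrite !psumS !psum0; lia.
by have := E k.+1; rewrite !psumS; lia.
Qed.

Lemma sge_cons a nu al : sge nu al -> sge (a :: nu) (a :: al).
Proof.
move=> [ss sm E]; split; rewrite /= ?ss ?sm // => -[|k]; rewrite ?psum0 // !psumS leq_add2l.
exact: E.
Qed.

Lemma sumn_count s M : all (fun x => x <= M)%N s ->
  sumn s = (\sum_(j < M) count (fun x => j < x)%N s)%N.
Proof.
elim: s => [|a s IH] /=; first by rewrite big1.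
move=> /andP[aM /IH ->]; rewrite big_split /= sum_ltn; congr (_ + _)%N; lia.
Qed.

Lemma sorted_geq_cons a s : sorted geq (a :: s) = all (fun x => x <= a)%N s && sorted geq s.
Proof. by rewrite /= (path_sortedE (rev_trans leq_trans)). Qed.

Lemma count_take_sorted s k j : sorted geq s ->
  count (fun x => j < x)%N (take k s) = minn k (count (fun x => j < x)%N s).
Proof.
elim: s k => [|a s IH] [|k]; rewrite ?minn0 ?min0n //.
rewrite sorted_geq_cons => /andP[sa ss] /=; rewrite IH //.
case: (ltnP j a) => ja; first by lia.
have -> : count (fun x => j < x)%N s = 0%N; last by lia.
apply/eqP; rewrite -leqn0 leqNgt -has_count; apply/hasPn => x xs; rewrite -leqNgt.
by apply: leq_trans ja; apply: (allP sa).
Qed.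

Lemma psum_sorted s s' k : sorted geq s' ->
  (forall j, count (fun x => j < x)%N s' = count (fun x => j < x)%N s) ->
  (psum k s <= psum k s')%N.
Proof.
move=> ss E; pose M := (sumn s + sumn s')%N.
have le r : all (fun x => x <= sumn r)%N r.
  elim: r => //= a r IH; rewrite leq_addr; apply: sub_all IH => x xr; lia.
have leM r : (sumn r <= M)%N -> all (fun x => x <= M)%N (take k r).
  move=> rM; apply/allP => x /mem_take xr; apply: leq_trans rM; exact: (allP (le r)).
rewrite /psum (@sumn_count (take k s) M) ?leM ?leq_addr // (@sumn_count (take k s') M) ?leM ?leq_addl //.
apply: leq_sum => j _; rewrite (count_take_sorted _ _ ss) E leq_min.
apply/andP; split; first by apply: leq_trans (count_size _ _) _; rewrite size_take; case: ltnP.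
by rewrite -[X in (_ <= count _ X)%N](cat_take_drop k) count_cat leq_addr.
Qed.

Definition nrm s := sort geq [seq x <- s | 0 < x]%N.

Lemma nrm_partition s : is_partition (nrm s).
Proof.
rewrite /is_partition sort_sorted; last by move=> x y; apply: leq_total.
by rewrite mem_sort mem_filter ltnn.
Qed.

Lemma nrm_count s j : count (fun x => j < x)%N (nrm s) = count (fun x => j < x)%N s.
Proof.
rewrite count_sort count_filter; apply: eq_count => x /=; case: (ltnP j x) => //= jx.
by rewrite (leq_ltn_trans _ jx).
Qed.

Lemma psum_nrm k s : (psum k s <= psum k (nrm s))%N.
Proof. by apply: psum_sorted (nrm_count s); case/andP: (nrm_partition s). Qed.

Lemma sumn_nrm s : sumn (nrm s) = sumn s.
Proof.
rewrite (perm_sumn (s2 := [seq x <- s | 0 < x]%N)) ?perm_sort //.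
by elim: s => //= -[|a] s IH /=; rewrite IH.
Qed.

Definition pgt nu la := [/\ is_partition nu, sumn nu = sumn la,
  forall k, (psum k la <= psum k nu)%N & nu <> la].

Lemma psum_oversize k s : (size s <= k)%N -> psum k s = sumn s.
Proof. by move=> sk; rewrite /psum take_oversize. Qed.

Lemma sgt_nrm nu la : sgt nu la -> pgt (nrm nu) la.
Proof.
move=> [[ss sm E] ne]; split=> [||k|nl]; rewrite ?nrm_partition ?sumn_nrm //.
  exact: leq_trans (E k) (psum_nrm k nu).
apply: ne; apply: psum_inj => // k; apply/eqP; rewrite eqn_leq E andbT -nl; exact: psum_nrm.
Qed.

(** A numerical refinement of dominance: it increases strictly along it ([pgt_rk]). *)
Definition rk n la := (\sum_(k < n) psum k la)%N.

Lemma partition_size la : is_partition la -> (size la <= sumn la)%N.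
Proof.
case/andP=> _; elim: la => //= a s IH; rewrite in_cons negb_or => /andP[a0 /IH sn].
by rewrite -add1n leq_add // lt0n eq_sym.
Qed.

Lemma pgt_rk nu la n : is_partition la -> sumn la = n -> pgt nu la -> (rk n la < rk n nu)%N.
Proof.
move=> pla ln [pnu sm E ne].
have [/forallP all_eq|] := boolP [forall k : 'I_n, psum k la == psum k nu].
  case: ne; have Ek k : psum k nu = psum k la.
    case: (ltnP k n) => kn; first by have /eqP := all_eq (Ordinal kn).
    by rewrite !psum_oversize // (leq_trans (partition_size _)) // ?sm ln.
  have nz r k : is_partition r -> (k < size r)%N -> (psum k r < psum k.+1 r)%N.
    move=> /andP[_ r0] kr; rewrite /psum (take_nth 0%N kr) sumn_rcons -[X in (X < _)%N]addn0 ltn_add2l.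
    by rewrite lt0n; apply: contraNneq r0 => <-; apply: mem_nth.
  apply: psum_inj => //; case: (ltngtP (size nu) (size la)) => // lt.
    have := nz _ _ pla lt; rewrite -(Ek (size nu)) -(Ek (size nu).+1).
    by rewrite (psum_oversize (leqnn _)) (psum_oversize (leqnSn _)) ltnn.
  have := nz _ _ pnu lt; rewrite (Ek (size la)) (Ek (size la).+1).
  by rewrite (psum_oversize (leqnn _)) (psum_oversize (leqnSn _)) ltnn.
rewrite negb_forall => /existsP[k kne]; rewrite /rk (bigD1 k) //= [X in (_ < X)%N](bigD1 k) //= -addSn.
by apply: leq_add; [rewrite ltn_neqAle kne E | apply: leq_sum => i _; apply: E].
Qed.

Fixpoint bounded_seqs n k : seq (seq nat) :=
  if k is k'.+1 then [::] :: [seq a :: s | a <- iota 0 n.+1, s <- bounded_seqs n k'] else [:: [::]].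

Definition partitions n := [seq la <- undup (bounded_seqs n n) | is_partition la && (sumn la == n)].

Lemma mem_partitions n la : (la \in partitions n) = is_partition la && (sumn la == n).
Proof.
rewrite mem_filter mem_undup; case: (boolP (is_partition la && _)) => //= /andP[pla /eqP ln].
have bs k s : (size s <= k)%N -> all (fun x => x <= n)%N s -> s \in bounded_seqs n k.
  elim: k s => [|k IH] [|a s] //= sk /andP[an sn]; rewrite in_cons /=.
  by rewrite -[X in _ \in X]/[seq b :: r | b <- iota 0 n.+1, r <- _] allpairs_f // ?IH // mem_iota; lia.
apply: bs; first by rewrite -[X in (_ <= X)%N]ln partition_size.
rewrite -ln; elim: (la) => //= a s IH; rewrite leq_addr; apply: sub_all IH => x xs; lia.
Qed.

Lemma partitions_uniq n : uniq (partitions n).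
Proof. by rewrite filter_uniq // undup_uniq. Qed.

End PartitionOrder.

(** * Spans of products of complete functions *)

Section Span.
Variable F : fieldType.
Local Notation Lam := (symfun F).
Implicit Types (X Y Z : Lam -> Prop) (f g : Lam).

Inductive lspan X : Lam -> Prop :=
| lspan0 : lspan X 0
| lspan_cons c f g : X f -> lspan X g -> lspan X (c *: f + g).

Lemma lspan_gen X f : X f -> lspan X f.
Proof. by move=> Xf; rewrite -[f]addr0 -[f]scale1r; apply: lspan_cons => //; apply: lspan0. Qed.

Lemma lspanD X f g : lspan X f -> lspan X g -> lspan X (f + g).
Proof.
by elim=> [|c u v Xu _ IH] Xg; rewrite ?add0r // -addrA; apply: lspan_cons => //; apply: IH.
Qed.

Lemma lspanZ X c f : lspan X f -> lspan X (c *: f).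
Proof.
elim=> [|d u v Xu _ IH]; first by rewrite scaler0; apply: lspan0.
by rewrite scalerDr scalerA; apply: lspan_cons.
Qed.

Lemma lspanN X f : lspan X f -> lspan X (- f).
Proof. by move=> Xf; rewrite -scaleN1r; apply: lspanZ. Qed.

Lemma lspanB X f g : lspan X f -> lspan X g -> lspan X (f - g).
Proof. by move=> Xf Xg; apply: lspanD => //; apply: lspanN. Qed.

Lemma lspan_sum X (I : Type) (r : seq I) (p : pred I) (E : I -> Lam) :
  (forall i, p i -> lspan X (E i)) -> lspan X (\sum_(i <- r | p i) E i).
Proof. by move=> XE; apply: (big_ind (lspan X)) => //; [apply: lspan0 | apply: lspanD]. Qed.

Lemma lspan_lin X Y (A : Lam -> Lam) : lin A -> (forall f, X f -> lspan Y (A f)) ->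
  forall f, lspan X f -> lspan Y (A f).
Proof.
move=> LA XY f; elim=> [|c u v Xu _ IH]; first by rewrite (lin0 LA); apply: lspan0.
by rewrite LA; apply: lspanD => //; apply: lspanZ; apply: XY.
Qed.

Lemma lspan_sub X Y f : (forall g, X g -> lspan Y g) -> lspan X f -> lspan Y f.
Proof. by move=> XY; apply: (@lspan_lin _ _ id). Qed.

Lemma mul_lin f : lin (fun g : Lam => f * g).
Proof. by move=> c u v; rewrite mulrDr scalerAr. Qed.

Lemma lspanM X Y Z : (forall f g, X f -> Y g -> lspan Z (f * g)) ->
  forall f g, lspan X f -> lspan Y g -> lspan Z (f * g).
Proof.
move=> XYZ f g Xf Yg; rewrite mulrC; apply: (lspan_lin (@mul_lin g) _ Xf) => u Xu.
by rewrite mulrC; apply: (lspan_lin (@mul_lin u) _ Yg) => v Yv; apply: XYZ.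
Qed.

Definition hprod s : Lam := \prod_(a <- s) complete F a.

Definition hs (P : seq nat -> Prop) := lspan (fun f => exists2 s, P s & f = hprod s).

Lemma hprod_cons a s : hprod (a :: s) = complete F a * hprod s.
Proof. by rewrite /hprod big_cons. Qed.

Lemma hs_gen (P : seq nat -> Prop) s : P s -> hs P (hprod s).
Proof. by move=> Ps; apply: lspan_gen; exists s. Qed.

Lemma hs_sub (P Q : seq nat -> Prop) f : (forall s, P s -> Q s) -> hs P f -> hs Q f.
Proof. by move=> PQ; apply: lspan_sub => _ [s Ps ->]; apply: hs_gen; apply: PQ. Qed.

Lemma hs_lin (P : seq nat -> Prop) Y (A : Lam -> Lam) : lin A ->
  (forall s, P s -> lspan Y (A (hprod s))) -> forall f, hs P f -> lspan Y (A f).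
Proof. by move=> LA PY f; apply: lspan_lin => // _ [s Ps ->]; apply: PY. Qed.

Lemma hs_mul (P Q : seq nat -> Prop) a : (forall s, P s -> Q (a :: s)) ->
  forall f, hs P f -> hs Q (complete F a * f).
Proof.
move=> PQ; apply: hs_lin; first exact: mul_lin.
by move=> s Ps; rewrite -hprod_cons; apply: hs_gen; apply: PQ.
Qed.

Lemma hprod_nrm s : hprod (nrm s) = hprod s.
Proof.
rewrite /hprod (perm_big _ (permEl (perm_sort _ _))) big_filter.
by rewrite [RHS](bigID (fun a => 0 < a)%N) /= [X in _ * X]big1 ?mulr1 // => -[] // _; apply: complete0.
Qed.

Definition graded n := hs (fun s => sumn s = n).

Lemma gradedM m n f g : graded m f -> graded n g -> graded (m + n) (f * g).
Proof.
apply: lspanM => _ _ [s sm ->] [s' sn ->]; rewrite /hprod -big_cat -/(hprod _).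
by apply: hs_gen; rewrite sumn_cat sm sn.
Qed.

Lemma graded1 : graded 0 1.
Proof.
have -> : 1 = hprod [::] by rewrite /hprod big_nil.
exact: hs_gen.
Qed.

Lemma graded_h n : graded n (complete F n).
Proof.
rewrite (_ : complete F n = hprod [:: n]); first by apply: hs_gen; rewrite /= addn0.
by rewrite /hprod big_seq1.
Qed.

Hypothesis char0 : forall n, n.+1%:R != 0 :> F.

Lemma graded_p k : graded k.+1 (power_sum_succ F k).
Proof.
have [n] := ubnP k; elim: n k => // n IH k; rewrite ltnS => kn.
have := der_complete F k.+1; rewrite /der /conv big_ord_recl mul0r add0r big_ord_recr /=.
rewrite subnn complete0 mulr1 addrC => E.
rewrite -[power_sum_succ F k](addrK (\sum_(i < k) power_sum_succ F (0 + i) * complete F (k.+1 - bump 0 i))).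
rewrite -E; apply: lspanB.
  by rewrite -scaler_nat; apply: lspanZ; apply: graded_h.
apply: lspan_sum => i _; have ik := ltn_ord i.
have -> : (k.+1 - bump 0 i = k - i)%N by rewrite /bump; lia.
suff : graded (i.+1 + (k - i)) (power_sum_succ F (0 + i) * complete F (k - i)).
  by rewrite (_ : (i.+1 + (k - i))%N = k.+1) //; lia.
by apply: gradedM; [apply: IH; lia | apply: graded_h].
Qed.

Lemma graded_diag d n f : graded n f -> graded n (diag char0 d f).
Proof.
have dH := diag_hom char0 d.
have dh k : graded k (diag char0 d (complete F k)).
  have [m] := ubnP k; elim: m k => // m IH [|k] km; first by rewrite complete0 (hom1 dH); apply: graded1.
  rewrite -[diag _ _ _](scalerK (char0 k)) scaler_nat -(homMn dH); apply: lspanZ.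
  rewrite -[_ *+ _]/(der (complete F) k.+1) der_complete /conv (hom_sum dH); apply: lspan_sum => -[[|i] ik] _ /=.
    by rewrite mul0r (hom0 dH); apply: lspan0.
  rewrite (homM dH) diag_p subSS (_ : k.+1 = (i.+1 + (k - i))%N); last by lia.
  by apply: gradedM; [apply: lspanZ; apply: graded_p | apply: IH; lia].
apply: hs_lin => [c u v|s <-]; first by rewrite (homD dH) diagZ.
elim: s => [|a s IH]; first by rewrite /hprod big_nil (hom1 dH); apply: graded1.
by rewrite hprod_cons (homM dH); apply: gradedM.
Qed.

End Span.

(** * Triangularity *)

Section Triangular.
Variable F : fieldType.
Hypothesis char0 : forall n, n.+1%:R != 0 :> F.
Local Notation Lam := (symfun F).
Local Notation p_ := (power_sum_succ F).
Local Notation e_ := (elementary F).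
Local Notation h_ := (complete F).
Local Notation diag := (diag char0).
Implicit Types (u v : nat -> Lam) (P Q : {poly Lam}).

Fact diag_zmod d : zmod_morphism (diag d).
Proof. by move=> f g; rewrite (homD (diag_hom char0 d)) (homN (diag_hom char0 d)). Qed.
Fact diag_monoid d : monoid_morphism (diag d).
Proof. by split=> [|f g]; rewrite ?(hom1 (diag_hom char0 d)) ?(homM (diag_hom char0 d)). Qed.
HB.instance Definition _ d := GRing.isZmodMorphism.Build Lam Lam (diag d) (@diag_zmod d).
HB.instance Definition _ d := GRing.isMonoidMorphism.Build Lam Lam (diag d) (diag_monoid d).

HB.instance Definition _ d := GRing.isScalable.Build F Lam Lam *:%R (diag d) (diagZ char0 d).

Lemma pairing_sum u (I : Type) (r : seq I) (p : pred I) (E : I -> {poly Lam}) :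
  pairing u (\sum_(i <- r | p i) E i) = \sum_(i <- r | p i) pairing u (E i).
Proof.
apply: (big_morph (pairing u) (@pairingD F u)).
by rewrite /pairing size_poly0 big_ord0.
Qed.

Lemma pairing1 u : pairing u 1 = u 0%N.
Proof. by rewrite (@pairingE F _ _ 1) ?size_poly1 // big_ord1 coef1 mulr1. Qed.

Lemma pairingXn u j P : pairing u ('X^j * P) = pairing (fun s => u (j + s)%N) P.
Proof.
rewrite (@pairingE F _ _ (j + size P)); last first.
  apply: leq_trans (size_polyMleq _ _) _; rewrite size_polyXn; lia.
rewrite big_split_ord /= big1 ?add0r => [|i _]; last by rewrite coefXnM ltn_ord mulr0.
by apply: eq_bigr => i _; rewrite coefXnM ltnNge leq_addr /= addKn.
Qed.

Lemma pairing_map u d P : diag d (pairing u P) = pairing (diag d \o u) (map_poly (diag d) P).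
Proof.
rewrite (@pairingE F _ (map_poly _ _) (size P)) ?size_poly // /pairing rmorph_sum.
by apply: eq_bigr => i _; rewrite rmorphM /= coef_map.
Qed.

Variables (q t : F).

Definition phi_q := diag (fun k => 1 - q ^+ k.+1).
Definition cseq r := phi_q ((-1) ^+ r *: e_ r).
Definition tcoef k := 1 - t ^+ k.+1.
(* The conjugate of [D0] by f |-> f[X (1 - q)]. *)
Definition Dq := D0_gen char0 cseq tcoef.

Lemma Dq_lin : lin Dq.
Proof. exact: D0_gen_lin. Qed.

Lemma phi_q_D0 f : phi_q (D0 char0 q t f) = Dq (phi_q f).
Proof.
rewrite /phi_q /D0 /D0_gen pairing_map /Dq /D0_gen; congr pairing.
have [sH sH'] := (shift_hom char0 (D0_coef q t), shift_hom char0 tcoef).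
have dH := diag_hom char0 (fun k => 1 - q ^+ k.+1).
apply: (hom_unique char0 (phi := fun g => map_poly (diag (fun k => 1 - q ^+ k.+1)) (shift char0 (D0_coef q t) g))
  (psi := fun g => shift char0 tcoef (diag (fun k => 1 - q ^+ k.+1) g)) (c := shift_const F)).
- split=> [g h|g h|c]; rewrite ?(homD sH) ?(homM sH) ?rmorphD ?rmorphM //.
  by rewrite (homZ sH) (hom1 sH) mulr1 /= map_polyC /= diagZ rmorph1.
- split=> [g h|g h|c]; rewrite ?(homD dH) ?(homM dH) ?(homD sH') ?(homM sH') //.
  by rewrite (homZ dH) (hom1 dH) mulr1 (homZ sH') (hom1 sH') mulr1.
move=> k; rewrite diag_p (homZ sH') !shift_p rmorphD /= map_polyC map_polyZ map_polyXn mulrDr -polyCM /=.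
rewrite mulr_algl diag_p; congr (_ + _).
rewrite -!mul_polyC mulrA -polyCM; congr (_%:P * _).
by rewrite diagZ rmorph1 mulr_algl scalerA.
Qed.

(** h_j[1 - t] is 1 - t for j > 0; writing 1 = t + (1 - t) includes j = 0 in the sum. *)
Lemma shift_h a : shift char0 tcoef (h_ a) =
  (t *: h_ a)%:P + \sum_(j < a.+1) ((1 - t) *: h_ (a - j))%:P * 'X^j.
Proof.
have nat_inj n (x y : {poly Lam}) : x *+ n.+1 = y *+ n.+1 -> x = y by apply: (hom_natI (shift_const F) char0).
have sH := shift_hom char0 tcoef.
pose H k : {poly Lam} := (h_ k)%:P.
pose p k : {poly Lam} := (pseq F k)%:P.
pose w k : {poly Lam} := if k is 0 then 1 else shift_const F (1 - t) * 'X^k.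
pose r k : {poly Lam} := if k is 0 then 0 else shift_const F (1 - t ^+ k) * 'X^k.
have -> : shift char0 tcoef (h_ a) = conv w H a.
  apply: (ode_unique nat_inj (p := fun k => r k + p k) (a := shift char0 tcoef \o h_)).
  - by rewrite /p /= add0r.
  - by rewrite /= complete0 (hom1 sH) conv0 mul1r /H complete0.
  - move=> n; rewrite /der /= -(homMn sH) -/(der _ n) der_complete.
    rewrite -[LHS]/((shift char0 tcoef \o conv _ _) n) (hom_conv sH); apply: eq_conv => // -[|i] /=.
      by rewrite (hom0 sH) /p /= addr0.
    by rewrite shift_p addrC -mul_polyC.
  apply: der_conv_ode => n; last first.
    rewrite /der /H -polyCMn -[_ *+ _]/(der h_ n) der_complete /conv rmorph_sum.
    by apply: eq_bigr => i _; rewrite rmorphM.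
  case: n => [|n]; rewrite /der /conv; first by rewrite big_ord1 mul0r mulr0n.
  rewrite big_ord_recl mul0r add0r big_ord_recr /= subnn mulr1.
  rewrite (eq_bigr (fun i : 'I_n => shift_const F ((1 - t ^+ i.+1) * (1 - t)) * 'X^(n.+1))) => [|i _].
    rewrite -mulr_suml -mulrDl -(rmorph_sum (shift_const F)) /= -rmorphD -mulrnAl -rmorphMn /=; congr (_ * _).
    congr (_%:P); rewrite -scalerDl scalerMnl; congr (_ *: _); rewrite /bump add1n.
    elim: (n) => [|k IH]; first by rewrite big_ord0 add0r expr1.
    rewrite mulrSr IH big_ord_recr /= !exprS; ring.
  have -> : (n.+1 - bump 0 i = (n - i.+1).+1)%N by have := ltn_ord i; rewrite /bump; lia.
  rewrite -[((_ *: 1)%:P : {poly Lam})]/(shift_const F _) /w /bump add1n mulrACA -rmorphM -exprD; congr (_ * 'X^_); have := ltn_ord i; lia.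
rewrite /conv !big_ord_recl /= subn0 expr0 mulr1 mul1r addrA -polyCD; congr (_%:P + _).
  by rewrite -scalerDl addrC subrK scale1r.
apply: eq_bigr => i _; rewrite mulrAC; congr (_ * _).
by rewrite /H -polyCM mulr_algl.
Qed.

(** The value r = 0 is [Dq] on h_al; the shifted values make the recursion on al close up
    ([Gseq_cons]). *)
Definition Gseq al r := pairing (fun s => cseq (r + s)%N) (shift char0 tcoef (hprod F al)).

Lemma Dq_hprod al : Dq (hprod F al) = Gseq al 0.
Proof. by []. Qed.

Lemma Gseq_nil r : Gseq [::] r = cseq r.
Proof.
by rewrite /Gseq /hprod big_nil (hom1 (shift_hom char0 tcoef)) pairing1 addn0.
Qed.

Lemma Gseq_cons a al r : Gseq (a :: al) r =
  t *: (h_ a * Gseq al r) + (1 - t) *: \sum_(j < a.+1) h_ (a - j) * Gseq al (r + j).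
Proof.
rewrite /Gseq hprod_cons (homM (shift_hom char0 tcoef)) shift_h mulrDl pairingD pairingC scalerAl; congr (_ + _).
rewrite mulr_suml pairing_sum scaler_sumr; apply: eq_bigr => j _.
rewrite -mulrA pairingC pairingXn -scalerAl; congr (_ *: (_ * pairing _ _)).
by apply: funext => s; rewrite addnA.
Qed.

(** The series of [cseq] is H(q z) / H(z). *)
Lemma conv_h_cseq : conv h_ cseq =1 (fun m => q ^+ m *: h_ m).
Proof.
have nat_inj n (x y : Lam) : x *+ n.+1 = y *+ n.+1 -> x = y by apply: (hom_natI (in_alg Lam) char0).
have pH := diag_hom char0 (fun k => 1 - q ^+ k.+1).
have cE r : cseq r = twist (-1)%:A (phi_q \o e_) r by rewrite twistA /cseq /phi_q diagZ.
move=> m; rewrite -twistA; move: m.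
apply: (ode_unique nat_inj (p := fun k => pseq F k + twist (-1)%:A (phi_q \o sgn_pseq F) k)).
- by rewrite /twist /= /phi_q rmorph0 mulr0 addr0.
- by rewrite conv0 complete0 /twist cE /twist !expr0 !mul1r /= elementary0 complete0 /phi_q rmorph1.
- apply: der_conv_ode; first exact: der_complete.
  move=> n; rewrite /der cE -[_ *+ _]/(der (twist _ (phi_q \o e_)) n) der_twist /twist (hom_der pH).
  by rewrite -/(twist _ _ n) twist_conv; apply: eq_conv => // k; rewrite cE.
move=> n; rewrite der_twist /twist der_complete -/(twist _ _ n) twist_conv.
apply: eq_conv => // k; rewrite -/(twist _ _ k) -/(twist _ _ k) !twistA; case: k => [|k].
  by rewrite /= /phi_q rmorph0 !scaler0 addr0.
rewrite -[pseq F _]/(p_ k) -[(phi_q \o _) _]/(phi_q ((-1) ^+ k *: p_ k)) /phi_q diagZ diag_p !scalerA.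
rewrite -[X in _ = X + _]scale1r -scalerDl; congr (_ *: _).
rewrite [(-1) ^+ k.+1]exprS mulN1r mulNr -exprD addnn -muln2 mulnC exprM sqrrN !expr1n; ring.
Qed.

Definition Useq al := conv h_ (Gseq al).

Lemma Useq_cons b al s : Useq (b :: al) s = h_ b * Useq al s +
  (1 - t) *: \sum_(j < b) (h_ (b - j.+1) * Useq al (s + j.+1) - h_ (s + j.+1) * Useq al (b - j.+1)).
Proof.
(* [V j] is the part of [Useq al (s + j)] in which h has index at most s; the remaining part,
   regrouped by associativity of [conv], gives the subtracted terms. *)
pose V j := \sum_(i < s.+1) h_ i * Gseq al (s - i + j).
have V0 : V 0%N = Useq al s by apply: eq_bigr => i _; rewrite addn0.
have VU j : Useq al (s + j.+1) = V j.+1 + conv (fun k => h_ (s + k.+1)) (Gseq al) j.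
  rewrite /Useq /conv -addSn big_split_ord /=; congr (_ + _).
    by apply: eq_bigr => i _; congr (_ * Gseq al _); have := ltn_ord i; lia.
  by apply: eq_bigr => i _; rewrite addSnnS; congr (_ * Gseq al _); have := ltn_ord i; lia.
have -> : Useq (b :: al) s = t *: (h_ b * V 0%N) + (1 - t) *: \sum_(j < b.+1) h_ (b - j) * V j.
  rewrite V0 /Useq {1}/conv.
  rewrite (eq_bigr (fun i : 'I_s.+1 => t *: (h_ b * (h_ i * Gseq al (s - i))) +
     (1 - t) *: \sum_(j < b.+1) h_ (b - j) * (h_ i * Gseq al (s - i + j)))) => [|i _]; last first.
    rewrite Gseq_cons mulrDr -!scalerAr mulrCA; congr (_ + _ *: _).
    by rewrite mulr_sumr; apply: eq_bigr => j _; rewrite mulrCA.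
  rewrite big_split -!scaler_sumr -mulr_sumr exchange_big; congr (_ + _ *: _).
  by apply: eq_bigr => j _; rewrite mulr_sumr.
rewrite big_ord_recl subn0 scalerDr addrA -scalerDl addrC [t + _]addrC subrK scale1r V0 addrC.
congr (_ + _ *: _); rewrite sumrB.
rewrite (eq_bigr (fun j : 'I_b => h_ (b - j.+1) * Useq al (s + j.+1) -
    h_ (b - j.+1) * conv (fun k => h_ (s + k.+1)) (Gseq al) j)) => [|j _]; last first.
  by rewrite VU mulrDr addrK.
rewrite sumrB; congr (_ - _); case: (b) => [|c]; first by rewrite !big_ord0.
transitivity (conv (conv (fun k => h_ (s + k.+1)) (Gseq al)) h_ c).
  by apply: eq_bigr => j _; rewrite mulrC subSS.
rewrite -convA (eq_conv (frefl _) (convC _ _)).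
by apply: eq_bigr => j _; rewrite subSS.
Qed.

(** In [Useq_cons] every correction term has first entry larger than s, so only h_b times
    [Useq al s] contributes to the leading term. *)
Lemma hs_Useq al s : hs (sgt ^~ (s :: al)) (Useq al s - q ^+ s *: hprod F (s :: al)).
Proof.
elim: al s => [|b al IH] s.
  rewrite /Useq (eq_conv (frefl _) Gseq_nil) conv_h_cseq /hprod big_seq1 subrr; exact: lspan0.
have weak r : hs (sge ^~ (r :: al)) (Useq al r).
  rewrite -[Useq al r](subrK (q ^+ r *: hprod F (r :: al))); apply: lspanD.
    by apply: hs_sub (IH r) => nu [].
  by apply: lspanZ; apply: hs_gen; apply: sge_refl.
rewrite Useq_cons addrAC; apply: lspanD; last first.
  apply: lspanZ; apply: lspan_sum => j _; have jb := ltn_ord j; apply: lspanB.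
    apply: (hs_lin (mul_lin _) _ (weak _)) => -[|x nu] nuE; first by case: nuE.
    rewrite hprod_cons mulrCA -!hprod_cons; apply: hs_gen; split; first exact: sge_insert.
    by case=> E _; have [_ _ /(_ 1%N)] := nuE; rewrite !psumS !psum0; lia.
  apply: (hs_mul _ (weak _)) => nu nuE; split; first exact: sge_shift.
  by case; lia.
rewrite !hprod_cons mulrCA scalerAr -mulrBr -hprod_cons.
apply: (hs_lin (mul_lin _) _ (IH s)) => -[|x nu] [nuE ne]; first by case: nuE.
rewrite hprod_cons mulrCA -!hprod_cons; apply: hs_gen; split.
  by have := @sge_insert x nu b s al 0; rewrite subn0 addn0; apply.
by move=> [E1 E2]; apply: ne; rewrite E1 E2.
Qed.

(** Equal to 1 - (1 - q)(1 - t) times the sum of q^j t^i over the cells of al; see also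
    [D0_eigenvalueE]. *)
Fixpoint D0_eigenvalue al : F :=
  if al is a :: be then t * D0_eigenvalue be + (1 - t) * q ^+ a else 1.

Lemma hs_Gseq al : hs (sgt ^~ al) (Dq (hprod F al) - D0_eigenvalue al *: hprod F al).
Proof.
rewrite Dq_hprod; elim: al => [|a al IH].
  rewrite Gseq_nil /= /hprod big_nil scale1r /cseq expr0 scale1r elementary0 /phi_q rmorph1 subrr.
  exact: lspan0.
have -> : Gseq (a :: al) 0 = t *: (h_ a * Gseq al 0) + (1 - t) *: Useq al a.
  rewrite Gseq_cons; congr (_ + _ *: _); rewrite /Useq convC.
  by apply: eq_bigr => j _; rewrite add0n mulrC.
rewrite hprod_cons -[D0_eigenvalue (a :: al)]/(t * D0_eigenvalue al + (1 - t) * q ^+ a).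
rewrite [(_ + _ * _) *: _]scalerDl opprD addrACA -!scalerA -!scalerBr; apply: lspanD; apply: lspanZ.
  rewrite scalerAr -mulrBr; apply: (hs_mul _ IH) => nu [nuE ne]; split; first exact: sge_cons.
  by case.
by rewrite -hprod_cons; apply: hs_Useq.
Qed.


End Triangular.

(** * Splitting into eigenvectors and projections *)

Section EigenDecomposition.
Variables (F : fieldType) (V : lmodType F) (A : V -> V).
Hypotheses (AD : forall f g, A (f + g) = A f + A g) (AZ : forall c f, A (c *: f) = c *: A f).

Let A0 : A 0 = 0. Proof. by have := AZ 0 0; rewrite !scale0r. Qed.
Let AN f : A (- f) = - A f. Proof. by rewrite -scaleN1r AZ scaleN1r. Qed.
Let A_sum (I : Type) (r : seq I) (p : pred I) (E : I -> V) :
  A (\sum_(i <- r | p i) E i) = \sum_(i <- r | p i) A (E i).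
Proof. exact: (big_morph A AD A0). Qed.

Definition kill (l : seq F) f := foldl (fun g c => A g - c *: g) f l.

Lemma killD l f g : kill l (f + g) = kill l f + kill l g.
Proof.
elim: l f g => //= c l IH f g; rewrite -IH; congr foldl.
by rewrite AD scalerDr opprD addrACA.
Qed.

Lemma killZ l c f : kill l (c *: f) = c *: kill l f.
Proof.
elim: l f => //= d l IH f; rewrite -IH; congr foldl.
by rewrite AZ scalerBr !scalerA mulrC.
Qed.

Lemma kill_eigen l c f : A f = c *: f -> kill l f = (\prod_(d <- l) (c - d)) *: f.
Proof.
elim: l f => [|d l IH] f fc; first by rewrite big_nil scale1r.
by rewrite -[LHS]/(kill l (A f - d *: f)) fc -scalerBl killZ IH // scalerA big_cons.
Qed.

(** Induction: split A f - E_i f, divide its part for E_j by E_j - E_i, and subtract these from f;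
    what remains is the eigenvector for E_i. *)
Lemma eigen_split (I : eqType) (E : I -> F) (s : seq I) (X : V -> Prop) f :
  (forall f g, X f -> X g -> X (f + g)) -> (forall c f, X f -> X (c *: f)) ->
  (forall f, X f -> X (A f)) ->
  uniq s -> {in s &, injective E} -> X f -> kill (map E s) f = 0 ->
  exists v : I -> V, [/\ f = \sum_(i <- s) v i, forall i, i \in s -> A (v i) = E i *: v i
    & forall i, i \in s -> X (v i)].
Proof.
move=> XD XZ XA; elim: s f => [|i s IH] f.
  by move=> _ _ _ /= ->; exists (fun=> 0); rewrite big_nil.
move=> /= /andP[iN us] Einj Xf kf.
have [||v [vE vA Xv]] := IH (A f - E i *: f) us _ _ kf.
- by move=> j k js ks; apply: Einj; rewrite in_cons ?js ?ks orbT.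
- by rewrite -scaleN1r scalerA; apply: (XD) => //; [apply: XA | apply: XZ].
have Eij j : j \in s -> E j - E i != 0.
  move=> js; rewrite subr_eq0; apply: contraNneq iN => Eji.
  by rewrite -(Einj j i) // ?in_cons ?js ?eqxx ?orbT.
pose v' j := (E j - E i)^-1 *: v j.
have v'A j : j \in s -> A (v' j) = E j *: v' j by move=> js; rewrite AZ vA // !scalerA mulrC.
exists (fun j => if j == i then f - \sum_(k <- s) v' k else v' j); split.
- rewrite big_cons eqxx; set S := \sum_(k <- s) v' k.
  rewrite [X in _ + X](eq_big_seq v') ?subrK // => j js.
  by case: eqP => // ji; rewrite -ji js in iN.
- move=> j; rewrite in_cons; case: eqP => [-> _|_ /= /v'A //].
  rewrite AD AN A_sum (eq_big_seq (fun j => E j *: v' j)) => [|k]; last exact: v'A.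
  have -> : A f = E i *: f + \sum_(k <- s) (E k - E i) *: v' k.
    rewrite (eq_big_seq v) => [|k ks]; last by rewrite scalerA mulfV ?scale1r // Eij.
    by rewrite -vE addrC subrK.
  rewrite -addrA scalerBr; congr (_ + _); rewrite -sumrB scaler_sumr -sumrN; apply: eq_bigr => k _.
  by rewrite scalerBl addrAC subrr sub0r.
- move=> j; rewrite in_cons; case: eqP => [_ _|_ /= js]; last exact/XZ/Xv.
  apply: (XD) => //; rewrite -scaleN1r; apply: (XZ).
  rewrite big_seq; apply: (big_ind X) => //; first by rewrite -(scale0r f); apply: (XZ).
  by move=> k ks; apply: (XZ); apply: Xv.
Qed.

(** Up to a scalar, the product of the A - d over the d in S different from c. *)
Lemma eigen_proj (S : seq F) c : exists Q : V -> V,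
  [/\ forall f g, Q (f + g) = Q f + Q g, Q 0 = 0, forall v, A v = c *: v -> Q v = v
    & forall d v, d \in S -> d != c -> A v = d *: v -> Q v = 0].
Proof.
pose l := [seq d <- S | d != c]; pose a := \prod_(d <- l) (c - d).
have a0 : a != 0.
  rewrite /a prodf_seq_neq0; apply/allP => d; rewrite mem_filter subr_eq0 => /andP[dc _].
  by rewrite eq_sym dc.
exists (fun f => a^-1 *: kill l f); split=> [f g||v vc|d v dS dc vd].
- by rewrite killD scalerDr.
- by rewrite -(scale0r 0) killZ !scale0r scaler0.
- by rewrite (kill_eigen l vc) scalerA mulVf ?scale1r.
have dl : d \in l by rewrite mem_filter dc.
rewrite (kill_eigen l vd) (_ : \prod_(e <- l) _ = 0) ?scale0r ?scaler0 //.
by apply/eqP; rewrite prodf_seq_eq0; apply/hasP; exists d; rewrite //= subrr eqxx.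
Qed.

End EigenDecomposition.

Section Triangularity.
Variable F : fieldType.
Hypothesis char0 : forall n, n.+1%:R != 0 :> F.
Variables (q t : F).
Local Notation Lam := (symfun F).
Local Notation Dq := (Dq char0 q t).
Local Notation D0 := (D0 char0 q t).
Local Notation phi_q := (phi_q char0 q).
Local Notation ev := (D0_eigenvalue q t).

Lemma hs_nrm (P Q : seq nat -> Prop) (f : Lam) : (forall s, P s -> Q (nrm s)) -> hs P f -> hs Q f.
Proof.
by move=> PQ; apply: lspan_sub => _ [s Ps ->]; rewrite -hprod_nrm; apply: hs_gen; apply: PQ.
Qed.

Lemma graded_partitions n (f : Lam) : graded n f -> hs (fun la => la \in partitions n) f.
Proof. by apply: hs_nrm => s <-; rewrite mem_partitions nrm_partition sumn_nrm eqxx. Qed.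

Lemma pgt_partitions n nu la : la \in partitions n -> pgt nu la -> nu \in partitions n.
Proof. by rewrite !mem_partitions => /andP[_ /eqP <-] [-> -> _ _]; rewrite eqxx. Qed.

Lemma Dq_tri la : hs (pgt^~ la) (Dq (hprod F la) - ev la *: hprod F la).
Proof. by apply: hs_nrm (hs_Gseq char0 q t la) => s; apply: sgt_nrm. Qed.

Lemma Dq_graded n f : graded n f -> graded n (Dq f).
Proof.
move=> /graded_partitions; apply: hs_lin; first exact: Dq_lin.
move=> la lan; rewrite -[Dq _](subrK (ev la *: hprod F la)).
have pn nu : nu \in partitions n -> sumn nu = n by rewrite mem_partitions => /andP[_ /eqP].
apply: lspanD; last by apply/lspanZ/hs_gen/pn.
by apply: hs_sub (Dq_tri la) => nu /(pgt_partitions lan)/pn.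
Qed.

Definition rk_le n (x y : seq nat) := (rk n x <= rk n y)%N.
Definition parts n := sort (rk_le n) (partitions n).

Lemma mem_parts n : parts n =i partitions n.
Proof. exact: mem_sort. Qed.

(** Indices are removed by increasing rank: the factor for rho kills the coefficient of h_rho, and
    triangularity creates only terms of larger rank, none of which has been removed before. *)
Lemma kill_span n (U : pred (seq nat)) l1 l2 f :
  (forall nu la, la \in partitions n -> U la -> pgt nu la -> U nu) ->
  pairwise (rk_le n) (l1 ++ l2) -> {subset l1 ++ l2 <= partitions n} ->
  (forall la, la \in partitions n -> ~~ U la -> la \in l1 ++ l2) ->
  (forall la, la \in l1 ++ l2 -> ~~ U la) ->
  hs (fun la => la \in partitions n /\ la \notin l1) f ->
  hs (fun la => la \in partitions n /\ la \notin l1 ++ l2) (kill Dq (map ev l2) f).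
Proof.
move=> Ucl; elim: l2 l1 f => [|rho l2 IH] l1 f; first by rewrite cats0.
rewrite -cat_rcons => pw sub all_in notU fs; apply: (IH (rcons l1 rho)) => //.
have DL : lin (fun g => Dq g - ev rho *: g).
  by move=> c u v; rewrite (Dq_lin char0 q t) scalerDr opprD addrACA !scalerBr !scalerA [_ * c]mulrC.
apply: (hs_lin DL) fs => nu [nun nul1].
have sub_tri : hs (fun la => la \in partitions n /\ la \notin rcons l1 rho)
    (Dq (hprod F nu) - ev nu *: hprod F nu).
  apply: hs_sub (Dq_tri nu) => ka kanu; split; first exact: pgt_partitions kanu.
  apply/negP => kal; have kall : ka \in rcons l1 rho ++ l2 by rewrite mem_cat kal.
  have nUnu : ~~ U nu by apply: contra (notU _ kall) => Unu; apply: Ucl Unu kanu.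
  have := all_in _ nun nUnu; rewrite cat_rcons mem_cat (negPf nul1) => /= nul.
  have rk_rho : (rk n rho <= rk n nu)%N.
    move: pw; rewrite cat_rcons pairwise_cat => /and3P[_ _] /= /andP[rl _].
    by move: nul; rewrite in_cons => /predU1P[-> //|nul2]; apply: (allP rl).
  have rk_ka : (rk n ka <= rk n rho)%N.
    move: kal; rewrite mem_rcons in_cons => /predU1P[-> //|kal1].
    move: pw; rewrite cat_rcons pairwise_cat => /andP[/allrelP al _].
    by apply: al => //; rewrite in_cons eqxx.
  move: (nun); rewrite mem_partitions => /andP[pnu /eqP snu].
  by have := pgt_rk pnu snu kanu; rewrite ltnNge (leq_trans rk_ka).
rewrite -[Dq _](subrK (ev nu *: hprod F nu)) -addrA -scalerBl; apply: lspanD => //.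
have [->|ne] := eqVneq nu rho; first by rewrite subrr scale0r; apply: lspan0.
by apply/lspanZ/hs_gen; rewrite mem_rcons in_cons negb_or ne.
Qed.

Lemma kill_up n (U : pred (seq nat)) f :
  (forall nu la, la \in partitions n -> U la -> pgt nu la -> U nu) -> graded n f ->
  hs (fun la => la \in partitions n /\ U la) (kill Dq [seq ev la | la <- parts n & ~~ U la] f).
Proof.
move=> Ucl fn; have lE la : (la \in [seq la <- parts n | ~~ U la]) = (la \in partitions n) && ~~ U la.
  by rewrite mem_filter mem_parts andbC.
apply: hs_sub (@kill_span n U [::] _ f Ucl _ _ _ _ _) => [la [lan]| | | | |].
- by rewrite /= lE lan /= negbK.
- rewrite pairwise_filter // -sorted_pairwise; last by move=> y x z; apply: leq_trans.
  by apply: sort_sorted => x y; apply: leq_total.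
- by move=> la; rewrite lE => /andP[].
- by move=> la lan Ula; rewrite lE lan.
- by move=> la; rewrite lE => /andP[].
- by apply: hs_sub (graded_partitions fn).
Qed.

Hypothesis qn : forall k, 1 - q ^+ k.+1 != 0.

Lemma phi_q_inj : injective phi_q.
Proof. exact: can_inj (diagK char0 qn). Qed.

Lemma D0_graded n f : graded n f -> graded n (D0 f).
Proof.
move=> fn; rewrite -[D0 f](diagK char0 qn); apply: graded_diag.
by rewrite -/(phi_q _) phi_q_D0; apply/Dq_graded/graded_diag.
Qed.

Lemma kill_D0 n f : graded n f -> kill D0 (map ev (parts n)) f = 0.
Proof.
move=> fn; apply: phi_q_inj; rewrite /phi_q rmorph0 -/phi_q.
have -> : phi_q (kill D0 (map ev (parts n)) f) = kill Dq (map ev (parts n)) (phi_q f).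
  elim: (map _ _) f {fn} => //= c l IH f; rewrite IH; congr foldl.
  by rewrite -phi_q_D0 /phi_q -diagZ -rmorphB.
have /(@kill_up n pred0 (phi_q f))  : graded n (phi_q f) by apply: graded_diag.
rewrite (eq_filter (a2 := predT)) ?filter_predT // => /(_ (fun _ _ _ x _ => x)).
by case=> // c g h [la []].
Qed.

(** The product of the [Dq] - ev la over la outside U maps into the span of U, and it multiplies
    phi_q f by a nonzero scalar. *)
Lemma D0_eigen_span n (U : pred (seq nat)) f c :
  (forall nu la, la \in partitions n -> U la -> pgt nu la -> U nu) ->
  (forall la, la \in partitions n -> ~~ U la -> ev la != c) ->
  graded n f -> D0 f = c *: f ->
  hs (fun la => la \in partitions n /\ U la) (phi_q f).
Proof.
move=> Ucl Uc fn fc; have Df : Dq (phi_q f) = c *: phi_q f by rewrite -phi_q_D0 fc /phi_q diagZ.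
have := kill_up Ucl (graded_diag char0 (fun k => 1 - q ^+ k.+1) fn); rewrite -/(phi_q f).
rewrite (kill_eigen (linZ (Dq_lin char0 q t)) _ Df); set a := \prod_(d <- _) _ => H.
rewrite -[phi_q f]scale1r -(@mulVf _ a); last first.
  rewrite /a prodf_seq_neq0 all_map; apply/allP => la /=; rewrite mem_filter mem_parts subr_eq0 eq_sym.
  by case/andP => Ula lan; apply: Uc.
by rewrite -scalerA; apply: lspanZ.
Qed.

End Triangularity.

(** * Jacobi-Trudi determinants *)

Section JacobiTrudi.
Variable F : fieldType.
Local Notation Lam := (symfun F).
Local Notation h_ := (complete F).
Local Notation e_ := (elementary F).
Local Notation hp := (hprod F).
Local Notation schur := (schur F).

Lemma psum_nth k s : psum k s = (\sum_(i < k) nth 0 s i)%N.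
Proof.
elim: k s => [|k IH] [|a s]; rewrite ?psum0 ?big_ord0 //.
  by rewrite /psum big1 // => i _; rewrite nth_nil.
by rewrite psumS IH big_ord_recl.
Qed.

Lemma sumn_sorted_iota a s : sorted ltn s -> all (leq a) s ->
  (sumn (iota a (size s)) <= sumn s)%N.
Proof.
elim: s a => //= b s IH a; rewrite (path_sortedE ltn_trans) => /andP[bs ss] /andP[ab _].
apply: leq_add => //; apply: IH => //; apply: sub_all bs => x bx; exact: leq_ltn_trans bx.
Qed.

Lemma sumn_uniq s : uniq s -> (sumn (iota 0 (size s)) <= sumn s)%N.
Proof.
move=> us; rewrite -(perm_sumn (permEl (perm_sort leq s))) -(size_sort leq s).
apply: sumn_sorted_iota; last by apply/allP.
by rewrite ltn_sorted_uniq_leq sort_uniq us sort_sorted //; apply: leq_total.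
Qed.

Lemma perm_psum n (s : 'S_n) k : (k <= n)%N ->
  (\sum_(i < k) i <= \sum_(i < n | i < k) s i)%N.
Proof.
move=> kn; pose r := map (fun i : 'I_n => s i : nat) (filter (fun i : 'I_n => i < k)%N (enum 'I_n)).
have ur : uniq r.
  rewrite map_inj_uniq; first by apply: filter_uniq; apply: enum_uniq.
  by move=> i j /val_inj/perm_inj.
have sr : size r = k.
  rewrite size_map -(size_map val) -(filter_map val (fun i => i < k)%N) val_enum_ord.
  rewrite size_filter -(subnKC kn) iotaD count_cat.
  rewrite (eq_in_count (a2 := predT)) ?count_predT ?size_iota => [|i]; last first.
    by rewrite mem_iota /= => ->.
  rewrite (eq_in_count (a2 := pred0)) ?count_pred0 ?addn0 // => i.
  by rewrite mem_iota /=; lia.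
have := sumn_uniq ur; rewrite sr !sumnE big_map big_filter big_enum_cond /=.
by rewrite -{1}[k]subn0 -/(index_iota 0 k) big_mkord.
Qed.

(** In the determinant the identity gives h_la. Another permutation s gives h_al with al_i = la_i +
    s(i) - i, whose partial sums are at least those of la by [perm_psum]. *)
Lemma schur_tri la : is_partition la -> hs (pgt^~ la) (schur la - hp la).
Proof.
move=> pla; rewrite /Defs.schur /determinant; set M := \matrix_(_, _) _.
rewrite (bigD1 1%g) //= addrAC (_ : _ * _ = hp la) ?subrr ?add0r; last first.
  rewrite odd_perm1 expr0 mul1r /hprod (big_nth 0%N) big_mkord; apply: eq_bigr => i _.
  by rewrite mxE perm1 leq_addl addnK.
apply: lspan_sum => s s1; rewrite mulr_sign.
suff H : hs (pgt^~ la) (\prod_i M i (s i)) by case: ifP => _; [apply: lspanN | ].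
have [/forallP Hs|] := boolP [forall i : 'I_(size la), i <= nth 0 la i + s i]%N; last first.
  rewrite negb_forall => /existsP[i iN]; rewrite (bigD1 i) //= mxE (negPf iN) mul0r; exact: lspan0.
pose al := [seq (nth 0 la i + s i - i)%N | i : 'I_(size la)].
have nth_al (i : 'I_(size la)) : (nth 0 al i + i = nth 0 la i + s i)%N.
  rewrite (nth_map i) ?size_enum_ord // nth_ord_enum subnK //; exact: Hs.
have sal : size al = size la by rewrite size_map size_enum_ord.
have -> : \prod_i M i (s i) = hp al.
  rewrite /hprod big_map big_enum /=; apply: eq_bigr => i _; rewrite mxE Hs //.
rewrite -hprod_nrm; apply: hs_gen; apply: sgt_nrm.
have sumE k : (k <= size la)%N ->
   (psum k al + \sum_(i < k) i = psum k la + \sum_(i < size la | i < k) s i)%N.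
  move=> kla; rewrite !psum_nth (big_ord_widen (size la) (fun i => i) kla).
  rewrite (big_ord_widen (size la) (nth 0%N al) kla) (big_ord_widen (size la) (nth 0%N la) kla).
  rewrite -big_split -[RHS]big_split; apply: eq_bigr => i _.
  exact: nth_al.
have tot : sumn al = sumn la.
  have := sumE _ (leqnn _); rewrite !psum_oversize ?sal //.
  rewrite [X in _ = (_ + X)%N -> _](eq_bigl predT) => [|i]; last exact: ltn_ord.
  have R : (\sum_(i < size la) i = \sum_(i < size la) s i)%N by apply: reindex_inj (@perm_inj _ s).
  by rewrite [X in (_ + X = _)%N]R => /addIn.
split; last first.
  move=> E; case/eqP: s1; apply/permP => i; rewrite perm1; apply: val_inj.
  by have := nth_al i; rewrite E /=; lia.
split=> // k; case: (leqP k (size la)) => kla; last by rewrite !psum_oversize ?sal ?tot // ltnW.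
by have := sumE _ kla; have := perm_psum s kla; lia.
Qed.

Definition ss (P : seq nat -> Prop) := lspan (fun f : Lam => exists2 la, P la & f = schur la).

Lemma ss_gen (P : seq nat -> Prop) la : P la -> ss P (schur la).
Proof. by move=> Pla; apply: lspan_gen; exists la. Qed.

Lemma ss_sub (P Q : seq nat -> Prop) f : (forall s, P s -> Q s) -> ss P f -> ss Q f.
Proof. by move=> PQ; apply: lspan_sub => _ [s Ps ->]; apply: ss_gen; apply: PQ. Qed.

Lemma dominates_trans nu ka la : dominates nu ka -> dominates ka la -> dominates nu la.
Proof.
move=> [pnu snu nuE] [_ ska kaE]; split=> //; first by rewrite snu.
by move=> k; apply: leq_trans (kaE k) (nuE k).
Qed.

Lemma pgt_dominates nu la : pgt nu la -> dominates nu la.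
Proof. by case. Qed.

Lemma dominates_partitions n nu la : la \in partitions n -> dominates nu la -> nu \in partitions n.
Proof. by rewrite !mem_partitions => /andP[_ /eqP <-] [-> -> _]; rewrite eqxx. Qed.

Lemma psum_le k la : (psum k la <= sumn la)%N.
Proof. by rewrite /psum -{2}(cat_take_drop k la) sumn_cat leq_addr. Qed.

Lemma hprod_schur n la : la \in partitions n -> ss (dominates^~ la) (hp la).
Proof.
have [m] := ubnP (n * n - rk n la); elim: m la => // m IH la lam lan.
move: (lan); rewrite mem_partitions => /andP[pla /eqP sla].
rewrite -[hp la](subKr (schur la)); apply: lspanB.
  by apply: ss_gen; split.
apply: lspan_sub (schur_tri pla) => _ [ka kala ->].
have kan := pgt_partitions lan kala.
apply: ss_sub (IH ka _ kan) => [nu nuka|].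
  exact: dominates_trans nuka (pgt_dominates kala).
have rn : (rk n ka <= n * n)%N.
  apply: leq_trans (_ : \sum_(k < n) n <= _)%N; last by rewrite sum_nat_const card_ord.
  by apply: leq_sum => k _; move: kan; rewrite mem_partitions => /andP[_ /eqP {2}<-]; apply: psum_le.
have := pgt_rk pla sla kala; lia.
Qed.

Lemma graded_ss n (f : Lam) : graded n f -> ss (fun la => la \in partitions n) f.
Proof.
move=> /graded_partitions; apply: lspan_sub => _ [la lan ->].
by apply: ss_sub (hprod_schur lan) => nu; apply: dominates_partitions.
Qed.

Lemma in_schur_spanP (P : seq nat -> Prop) (f : Lam) : ss P f -> in_schur_span P f.
Proof.
rewrite /in_schur_span => fP; suff [r [c [_ rP ->]]] : exists (r : seq (seq nat)) (c : seq nat -> F),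
    [/\ uniq r, forall la, la \in r -> P la & f = \sum_(la <- r) c la *: schur la] by exists r, c.
elim: fP => [|c _ g [la Pla ->] _ [r [d [ur rP ->]]]]; first by exists [::], (fun=> 0); rewrite big_nil.
have [lar|lar] := boolP (la \in r).
  exists r, (fun nu => d nu + (if nu == la then c else 0)); split=> //.
  under [RHS]eq_bigr do rewrite scalerDl.
  rewrite big_split addrC /=; congr (_ + _).
  rewrite (bigD1_seq la) //= eqxx big1 ?addr0 // => nu /negPf ->; exact: scale0r.
exists (la :: r), (fun nu => if nu == la then c else d nu); split; rewrite /= ?lar //.
  by move=> nu; rewrite in_cons => /predU1P[->|/rP].
rewrite big_cons eqxx; congr (_ + _); apply: eq_big_seq => nu nur.
by case: eqP => // E; rewrite -E nur in lar.
Qed.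

End JacobiTrudi.

(** * The Hall pairing with e_n *)

Section Hall.
Variable F : fieldType.
Hypothesis char0 : forall n, n.+1%:R != 0 :> F.
Local Notation Lam := (symfun F).
Local Notation h_ := (complete F).
Local Notation e_ := (elementary F).
Local Notation Psi := (Psi char0).

Lemma conv_e_h : conv h_ (twist (-1)%:A e_) =1 @unit_seq Lam.
Proof.
have nat_inj n (x y : Lam) : x *+ n.+1 = y *+ n.+1 -> x = y by apply: (hom_natI (in_alg Lam) char0).
apply: (ode_unique nat_inj (p := fun k => pseq F k + twist (-1)%:A (sgn_pseq F) k)).
- by rewrite /twist /= mulr0 addr0.
- by rewrite conv0 complete0 /twist expr0 elementary0 !mulr1.
- apply: der_conv_ode; first exact: der_complete.
  by move=> n; rewrite der_twist -twist_conv /twist der_elementary.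
move=> [|n]; first by rewrite /der conv0 /twist /= mulr0n mulr0 addr0 mul0r.
rewrite /der /unit_seq mul0rn /conv big1 // => -[[|i] ik] _; rewrite twistA.
  by rewrite /= scaler0 addr0 mul0r.
rewrite -[pseq F _]/(power_sum_succ F i) -[sgn_pseq F _]/((-1) ^+ i *: power_sum_succ F i) scalerA.
rewrite -[nat_of_ord (Ordinal ik)]/(i.+1).
by rewrite [X in X *: _]mulrC exprS mulrCA mulN1r -exprD addnn -muln2 mulnC exprM sqrrN !expr1n scaleN1r subrr mul0r.
Qed.

(** The unitriangular Toeplitz matrices of the h_k and of the (-1)^k e_k are inverse to each other,
    so e_n is up to sign a corner entry of an adjugate; that minor is the Jacobi-Trudi determinant
    of 1^n. *)
Lemma elementary_schur n : e_ n = schur F (nseq n 1%N).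
Proof.
pose H : 'M[Lam]_n.+1 := \matrix_(i, j) (if (i <= j)%N then h_ (j - i) else 0).
pose E : 'M[Lam]_n.+1 := \matrix_(i, j) (if (i <= j)%N then twist (-1)%:A e_ (j - i) else 0).
have HE : H *m E = 1%:M.
  apply/matrixP => i j; rewrite !mxE; under eq_bigr do rewrite !mxE.
  pose f k := (if (i <= k)%N then h_ (k - i) else 0) * (if (k <= j)%N then twist (-1)%:A e_ (j - k) else 0).
  rewrite -(big_mkord predT f); have [ji|ij] := ltnP j i.
    rewrite big1_seq => [|k _]; last first.
      by rewrite /f; case: leqP => ik; rewrite ?mul0r //; case: leqP => kj; rewrite ?mulr0 //; lia.
    by case: eqP => // E1; rewrite E1 ltnn in ji.
  have [i1 j1] : (i <= j.+1)%N /\ (j < n.+1)%N by have := ltn_ord j; lia.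
  have i2 : (i <= n.+1)%N by apply: ltnW.
  have -> : \sum_(0 <= k < n.+1) f k = \sum_(0 <= k < i) f k +
      (\sum_(i <= k < j.+1) f k + \sum_(j.+1 <= k < n.+1) f k).
    by rewrite -(big_cat_nat i1 j1) -(big_cat_nat (leq0n i) i2).
  rewrite [X in X + _]big1_seq => [|k]; last first.
    by rewrite mem_index_iota /f => /andP[_ ki]; case: leqP => ik; rewrite ?mul0r //; lia.
  rewrite [X in _ + (_ + X)]big1_seq => [|k]; last first.
    rewrite mem_index_iota /f => /= /andP[jk _].
    by rewrite [X in _ * X]ifF ?mulr0 //; apply/negbTE; rewrite -ltnNge.
  rewrite add0r addr0 -{1}[nat_of_ord i]add0n big_addn subSn // big_mkord.
  have := conv_e_h (j - i)%N; rewrite /conv /unit_seq => E1.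
  rewrite (eq_bigr (fun k : 'I_(j - i).+1 => h_ k * twist (-1)%:A e_ (j - i - k))) => [|k _].
    by rewrite E1; congr (nat_of_bool _)%:R; apply/eqP/eqP => [ji0|->]; [apply: ord_inj; lia | rewrite subnn].
  rewrite /f leq_addl addnK [X in _ * X]ifT; last by have := ltn_ord k; lia.
  by congr (_ * twist _ _ _); lia.
have dH : \det H = 1.
  rewrite -det_tr det_trig; last first.
    by apply/is_trig_mxP => i j ij; rewrite !mxE leqNgt ij.
  by rewrite big1 // => i _; rewrite !mxE leqnn subnn complete0.
have : \adj H = E by rewrite -[LHS]mulmx1 -HE mulmxA mul_adj_mx dH mul1mx.
move/matrixP/(_ ord0 ord_max); rewrite !mxE /= subn0 twistA /cofactor /= addn0.
have -> : \det (row' ord_max (col' ord0 H)) = schur F (nseq n 1%N).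
  have schurE m la (E1 : size la = m) : schur F la = \det (\matrix_(i < m, j < m)
      (if (i <= nth 0%N la i + j)%N then h_ (nth 0%N la i + j - i) else 0)).
    by case: m / E1.
  rewrite (schurE n) ?size_nseq //; congr determinant; apply/matrixP => i j; rewrite !mxE /=.
  by rewrite nth_nseq ltn_ord /bump leq0n [(n <= i)%N]leqNgt ltn_ord add0n.
rewrite -signr_odd -[X in _ = X *: _]signr_odd mulr_sign scaler_sign.
by case: ifP => // _ /oppr_inj.
Qed.

Lemma Psi0_h k : (Psi (h_ k)).[0] = (k <= 1)%N%:R.
Proof.
rewrite Psi_h; case: k => [|[|k]]; rewrite ?hornerC // hornerD !hornerXn ?expr0 expr0n ?add0r //.
by rewrite expr0n.
Qed.

Lemma partition_ones n la : la \in partitions n -> (head 0 la <= 1)%N -> la = nseq n 1%N.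
Proof.
rewrite mem_partitions => /andP[/andP[sla la0] /eqP <-]; elim: la sla la0 => //= a la IH.
rewrite -[path _ _ _]/(sorted geq (a :: la)) sorted_geq_cons => /andP[ala sla].
rewrite in_cons negb_or => /andP[a0 la0] a1; have aE : a = 1%N by case: a a0 a1 {ala} => [|[|]].
rewrite {}aE in ala *; rewrite add1n /=; congr (_ :: _); apply: IH => //.
by case: (la) ala => //= b s /andP[].
Qed.


(** At 0, h_k becomes 1 for k <= 1 and 0 otherwise. If the first part is at least 2 the first row of
    the determinant vanishes; for 1^n the matrix is unitriangular. *)
Lemma Psi0_schur n la : la \in partitions n -> (Psi (schur F la)).[0] = (la == nseq n 1%N)%:R.
Proof.
move=> lan; pose ev0 : {rmorphism {poly F} -> F} := horner_eval 0.
have -> : (Psi (schur F la)).[0] = \det (\matrix_(i < size la, j < size la)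
    ((i <= nth 0%N la i + j)%N && (nth 0%N la i + j - i <= 1)%N)%:R : 'M[F]_(size la)).
  rewrite -[LHS]/(ev0 (Psi _)) /schur -det_map_mx -det_map_mx; congr determinant.
  apply/matrixP => i j; rewrite !mxE; case: leqP => _ /=; last by rewrite rmorph0 /ev0 /= /horner_eval horner0.
  exact: Psi0_h.
have [l1|l2] := leqP (head 0 la) 1.
  rewrite (partition_ones lan l1) eqxx det_trig.
    by rewrite big1 // => i _; rewrite !mxE leq_addl addnK nth_nseq; case: ifP.
  apply/is_trig_mxP => i j ij; rewrite !mxE nth_nseq.
  have := ltn_ord i; rewrite {2}size_nseq => ->.
  by rewrite [X in _ && X]leqNgt [X in ~~ X](_ : _ = true) ?andbF //; lia.
case: la lan l2 => // a la lan /= a2; rewrite (expand_det_row _ ord0) big1 => [|j _]; last first.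
  by rewrite !mxE /= subn0 (_ : (a + j <= 1)%N = false) ?mul0r //; lia.
case: eqP => // E; move: a2; rewrite (_ : a = head 0 (nseq n 1))%N; last by rewrite -E.
by case: (n).
Qed.

Lemma hall_elementary (hall : {biscalar Lam}) n (f : Lam) : is_hall hall -> graded n f ->
  hall f (e_ n) = (Psi f).[0].
Proof.
move=> hallP /graded_ss; elim=> [|c u v [la lan ->] _ IH].
  by rewrite linear0l rmorph0 horner0.
rewrite linearPl IH (homD (Psi_hom char0)) (homZ (Psi_hom char0)) hornerD hornerM hornerC (Psi0_schur lan).
rewrite elementary_schur hallP //; first by move: lan; rewrite mem_partitions => /andP[].
by rewrite /is_partition mem_nseq andbF andbT; elim: (n) => // -[|m].
Qed.

End Hall.

(** * Adding a box *)

Section PsiDegree.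
Variable F : fieldType.
Hypothesis char0 : forall n, n.+1%:R != 0 :> F.
Local Notation Lam := (symfun F).
Local Notation Psi := (Psi char0).

Lemma size_Psi_hprod s : (size (Psi (hprod F s)) <= (sumn s).+1)%N /\ (Psi (hprod F s))`_(sumn s) = 1.
Proof.
elim: s => [|a s [IH1 IH2]]; first by rewrite /hprod big_nil rmorph1 size_poly1 coef1.
have [sa ca] : (size (Psi (complete F a)) <= a.+1)%N /\ (Psi (complete F a))`_a = 1.
  rewrite Psi_h; case: a => [|a]; first by rewrite size_poly1 coef1.
  rewrite coefD !coefXn eqxx eqn_leq ltnn addr0; split=> //.
  by rewrite (leq_trans (size_polyD _ _)) // !size_polyXn geq_max leqnn leqnSn.
rewrite hprod_cons rmorphM /=; split.
  by apply: leq_trans (size_polyMleq _ _) _; lia.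
by have [_ ->] := top_coefM sa IH1; rewrite ca IH2 mulr1.
Qed.

Lemma size_Psi n (f : Lam) : graded n f -> (size (Psi f) <= n.+1)%N.
Proof.
elim=> [|c _ g [s <- ->] _ IH]; first by rewrite rmorph0 size_poly0.
rewrite (homD (Psi_hom char0)) (homZ (Psi_hom char0)) mul_polyC; apply: leq_trans (size_polyD _ _) _.
by rewrite geq_max IH andbT (leq_trans (size_scale_leq _ _)) //; case: (size_Psi_hprod s).
Qed.

Lemma complete_at1 a : (complete F a 1%N).@[fun=> 1] = 1.
Proof.
pose ev1 (f : Lam) : F := (f 1%N).@[fun=> 1].
have evH : is_hom idfun ev1.
  split=> [f g|f g|c]; rewrite /ev1 ?sympolyD ?sympolyM ?rmorphD ?rmorphM //.
  by rewrite sympolyZ mevalZ rmorph1 mulr1.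
apply: (ode_unique (hom_natI (A := F) idfun char0) (p := ev1 \o pseq F) (a := ev1 \o complete F) (b := fun=> 1)).
- by rewrite /= (hom0 evH).
- by rewrite /= complete0 (hom1 evH).
- by move=> n; rewrite /der /= -(homMn evH) -/(der _ n) der_complete -(hom_conv evH).
move=> n; rewrite /der /conv big_ord_recl /= (hom0 evH) mul0r add0r.
rewrite (eq_bigr (fun=> 1)) ?sumr_const ?card_ord // => i _; rewrite mulr1.
by rewrite /ev1 power_sum_mpolyE big_ord1 rmorphXn /= mevalXU expr1n.
Qed.

(** Both sides are linear in f and equal to 1 on every product of complete functions of degree n. *)
Lemma Psi_top n (f : Lam) : graded n f -> (Psi f)`_n = (f 1%N).@[fun=> 1].
Proof.
elim=> [|c _ g [s <- ->] _ IH]; first by rewrite rmorph0 coef0 sympoly0 raddf0.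
rewrite (homD (Psi_hom char0)) (homZ (Psi_hom char0)) mul_polyC coefD coefZ IH sympolyD sympolyZ mevalD mevalZ.
have [_ ->] := size_Psi_hprod s; congr (_ * _ + _).
rewrite /hprod sympoly_prod rmorph_prod /= big1 // => a _.
exact: complete_at1.
Qed.

Lemma kap_homog t n N (f : Lam) : graded n f -> kap char0 t N f \is n.-homog.
Proof.
move=> /(graded_diag char0 (kappa_coef t)); rewrite /kap /kappa; elim=> [|c _ g [s <- ->] _ IH].
  by rewrite rpred0.
rewrite sympolyD sympolyZ rpredD // rpredZ // {g IH}; elim: s => [|a s IH].
  by rewrite /hprod big_nil dhomog1.
rewrite hprod_cons sympolyM dhomogM //; apply: rpred_sum => m /eqP ma.
by rewrite dhomogX; apply/eqP.
Qed.

End PsiDegree.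

(** * Dependence of the box factors on the number of variables *)

Section BoxWeight.
Variables (F : fieldType) (t : F).
Hypotheses (t_neq0 : t != 0) (t_nroot : forall k, t ^+ k.+1 != 1).

Lemma expt_inj i j : t ^+ i = t ^+ j -> i = j.
Proof.
wlog ij : i j / (i <= j)%N => [H E|].
  by case: (leqP i j) => [/H|/ltnW/H]; [apply | move/(_ (esym E))].
rewrite -{1}(subnKC ij) exprD -[LHS]mulr1 => /(mulfI (expf_neq0 _ t_neq0)).
case E : (j - i)%N => [|k]; first by lia.
by move/esym/eqP; rewrite (negPf (t_nroot k)).
Qed.

Lemma poly_eq_at (p r : {poly F}) k0 :
  (forall K, (k0 <= K)%N -> p.[- t ^+ K] = r.[- t ^+ K]) -> p = r.
Proof.
move=> E; apply/eqP; rewrite -subr_eq0; apply/negPn/negP => pr0.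
pose rs := [seq - t ^+ (k0 + k) | k <- iota 0 (size (p - r))].
have := max_poly_roots pr0 (rs := rs); rewrite size_map size_iota ltnn.
move=> H; suff : false by []; apply: H.
  by apply/allP => _ /mapP[k _ ->]; rewrite /root hornerD hornerN E ?leq_addr ?subrr.
by rewrite map_inj_uniq ?iota_uniq // => i j /oppr_inj/expt_inj; lia.
Qed.

Variables (y : nat -> F) (r n : nat).
Hypotheses (rn : (r <= n)%N) (y_neq0 : forall i, y i != 0) (y_inj : injective y)
  (y_tail : forall i, (n < i)%N -> y i = t ^+ i) (y_r : forall i, t * y i != y r).

Definition box_ratio K := box_weight K y r * \prod_(i < K.+1) (1 - t * (y i / y r)).

(** Passing from K to K + 1 multiplies the ratio by (1 - t^(K+2) / y_r) / (1 - t^(K+1) / y_r),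
    because the new weight is t^(K+1). The constant is nonzero since no t y_i equals y_r. *)
Lemma box_ratioE : exists2 C, C != 0 & forall K, (n < K)%N -> box_ratio K = C * (1 - t ^+ K.+1 / y r).
Proof.
have yr0 := y_neq0 r.
have tail0 K : (n < K)%N -> 1 - t ^+ K / y r != 0.
  move=> nK; rewrite subr_eq0 eq_sym; apply/negP => /eqP E.
  have /y_inj : y K = y r by rewrite y_tail // -[RHS]mul1r -E divfK.
  by lia.
have step K : (n < K)%N -> box_ratio K.+1 * (1 - t ^+ K.+1 / y r) = box_ratio K * (1 - t ^+ K.+2 / y r).
  move=> nK; have K1 : (n < K.+1)%N by apply: ltnW.
  have -> : box_ratio K.+1 = box_ratio K * (y r / (y r - y K.+1) * (1 - t * (y K.+1 / y r))).
    rewrite /box_ratio mulrACA; congr (_ * _); last by rewrite big_ord_recr.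
    rewrite /box_weight big_mkcond [in RHS]big_mkcond big_ord_recr /= ifT //; lia.
  have ne : y r - y K.+1 != 0 by rewrite subr_eq0; apply/negP => /eqP /y_inj; lia.
  have yK := y_tail K1; rewrite yK in ne; rewrite -mulrA yK; congr (_ * _).
  rewrite [t ^+ K.+2]exprS; move: (t ^+ K.+1) ne => u ne; field.
  by rewrite yr0 ne.
exists (box_ratio n.+1 / (1 - t ^+ n.+2 / y r)).
  rewrite mulf_neq0 ?invr_eq0 ?tail0 // /box_ratio mulf_neq0 //.
    apply/prodf_neq0 => s sr; rewrite mulf_neq0 ?invr_eq0 ?subr_eq0 //.
    by apply: contraNneq sr => /y_inj ->.
  apply/prodf_neq0 => s _; rewrite subr_eq0 eq_sym mulrA; apply/negP => /eqP E.
  by have /eqP := y_r s; apply; rewrite -[RHS]mul1r -E divfK.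
elim=> // K IH; rewrite ltnS leq_eqVlt => /predU1P[<-|nK]; first by rewrite divfK ?tail0.
apply: (mulIf (tail0 K.+1 (ltnW nK))); rewrite step // IH //.
by rewrite mulrAC.
Qed.

End BoxWeight.

Section EigenvalueFormula.
Variables (F : fieldType) (q t : F).

Lemma D0_eigenvalueE al N : (size al <= N)%N ->
  D0_eigenvalue q t al = t ^+ N + (1 - t) * \sum_(i < N) q ^+ nth 0 al i * t ^+ i.
Proof.
elim: al N => [|a al IH] N.
  move=> _ /=; rewrite (eq_bigr (fun i : 'I_N => t ^+ i)) => [|i _]; last by rewrite nth_nil mul1r.
  by rewrite -opprB mulNr -subrX1 opprB addrC subrK.
case: N => // N sN; rewrite /= (IH N sN) big_ord_recl /= mulr1 exprS.
rewrite [X in _ = _ + _ * (_ + X)](_ : _ = t * \sum_(i < N) q ^+ nth 0%N al i * t ^+ i); first by ring.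
rewrite mulr_sumr; apply: eq_bigr => i _.
by rewrite /bump /= add1n exprS mulrCA.
Qed.

Hypothesis t_neq1 : t != 1.
Hypothesis row_sum_inj : forall K (al be : nat -> nat),
  \sum_(i < K) q ^+ al i * t ^+ i = \sum_(i < K) q ^+ be i * t ^+ i ->
  forall i, (i < K)%N -> al i = be i.

Lemma D0_eigenvalue_inj al be : D0_eigenvalue q t al = D0_eigenvalue q t be ->
  forall i, nth 0%N al i = nth 0%N be i.
Proof.
pose N := maxn (size al) (size be).
have [aN bN] : (size al <= N)%N /\ (size be <= N)%N by rewrite leq_maxl leq_maxr.
rewrite (D0_eigenvalueE aN) (D0_eigenvalueE bN) => /addrI/mulfI E i.
have [iN|Ni] := ltnP i N; last by rewrite !nth_default // (leq_trans _ Ni).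
by apply: (@row_sum_inj N) => //; apply: E; rewrite subr_eq0 eq_sym.
Qed.

End EigenvalueFormula.

(** * Eigenvectors indexed by partitions, and multiplication by e_1 *)

Section MacdonaldFunctions.
Variable F : fieldType.
Hypothesis char0 : forall n, n.+1%:R != 0 :> F.
Variables (q t : F).
Hypotheses (t_neq0 : t != 0) (q_neq0 : q != 0).
Hypothesis monomial_inj : forall a b c d, q ^+ a * t ^+ b = q ^+ c * t ^+ d -> a = c /\ b = d.
Hypothesis row_sum_inj : forall K (al be : nat -> nat),
  \sum_(i < K) q ^+ al i * t ^+ i = \sum_(i < K) q ^+ be i * t ^+ i ->
  forall i, (i < K)%N -> al i = be i.
Local Notation Lam := (symfun F).
Local Notation e_ := (elementary F).
Local Notation Psi := (Psi char0).
Local Notation D0 := (D0 char0 q t).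
Local Notation kap := (kap char0 t).
Local Notation ev := (D0_eigenvalue q t).
Local Notation rw mu := (row_weight q t (nth 0%N mu)).

Let t_nroot k : t ^+ k.+1 != 1.
Proof. by apply/eqP => E; have [] := @monomial_inj 0 k.+1 0 0; rewrite ?E. Qed.
Let t_neq1 : t != 1. Proof. exact: (t_nroot 0). Qed.
Let qn k : 1 - q ^+ k.+1 != 0.
Proof.
by rewrite subr_eq0; apply/eqP => E; have [] := @monomial_inj 0 0 k.+1 0; rewrite ?expr0 ?mulr1 ?E.
Qed.

Lemma partition_nth_inj al be : is_partition al -> is_partition be ->
  (forall i, nth 0%N al i = nth 0%N be i) -> al = be.
Proof.
have size_le r s : is_partition r -> (forall i, nth 0%N r i = nth 0%N s i) -> (size r <= size s)%N.
  move=> /andP[_ r0] E; rewrite leqNgt; apply/negP => lt.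
  by move: r0; rewrite -(nth_default 0%N (leqnn (size s))) -E mem_nth.
move=> pa pb E; apply: (@eq_from_nth _ 0%N) => [|i _]; last exact: E.
by apply/eqP; rewrite eqn_leq !size_le.
Qed.

Lemma ev_inj_partitions n : {in partitions n &, injective ev}.
Proof.
move=> al be; rewrite !mem_partitions => /andP[pa _] /andP[pb _] E.
exact: partition_nth_inj pa pb (D0_eigenvalue_inj t_neq1 row_sum_inj E).
Qed.

Definition good mu (H : Lam) := [/\ is_partition mu, graded (sumn mu) H, (Psi H)`_(sumn mu) != 0 &
  forall K, (sumn mu <= K)%N -> symm_type q t (rw mu) (kap K.+1 H)].

Let Delta K (f : {mpoly F[K.+1]}) := t ^+ K.+1 *: f + macdonald_op q t f.

Let DeltaD K (f g : {mpoly F[K.+1]}) : Delta (f + g) = Delta f + Delta g.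
Proof. by rewrite /Delta (linD (macdonald_op_lin t_neq0 q_neq0 (K := K))) scalerDr addrACA. Qed.
Let DeltaZ K c (f : {mpoly F[K.+1]}) : Delta (c *: f) = c *: Delta f.
Proof. by rewrite /Delta (linZ (macdonald_op_lin t_neq0 q_neq0 (K := K))) scalerDr !scalerA mulrC. Qed.

Let Delta_kap K f : Delta (kap K.+1 f) = kap K.+1 (D0 f).
Proof.
by rewrite kap_D0 // /Delta (macdonald_op_sym t_neq0 q_neq0) ?kap_sym // addrC.
Qed.

Let Delta_type K mu (f : {mpoly F[K.+1]}) : (size mu <= K.+1)%N -> symm_type q t (rw mu) f ->
  Delta f = ev mu *: f.
Proof.
by move=> sK fy; rewrite /Delta (macdonald_op_type fy) -scalerDl -(D0_eigenvalueE q t sK).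
Qed.

Lemma good_eigen mu H : good mu H -> D0 H = ev mu *: H.
Proof.
move=> [pmu _ _ Ht]; apply: (kap_inj (N0 := (sumn mu).+1) t_nroot) => -[//|K] nK.
rewrite -Delta_kap kapZ; apply: Delta_type; last exact: Ht.
by apply: leq_trans (partition_size pmu) _; apply: ltnW.
Qed.

Definition good_sum n := lspan (fun H => exists2 mu, sumn mu = n & good mu H).

Lemma kap_e1M K f : kap K.+1 (e_ 1 * f) = symm t (xvar F K K * kap K.+1 f).
Proof.
rewrite rmorphM /= -(symm_varX char0 t_neq0 t_neq1 q_neq0) expr1 mulrC [in RHS]mulrC.
by rewrite (symm_mul t_neq0 q_neq0) ?kap_sym.
Qed.

Lemma add_box_good mu H nu r v : good mu H -> is_partition nu -> sumn nu = (sumn mu).+1 ->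
  (forall i, nth 0%N nu i = nth 0%N mu i + (i == r))%N -> graded (sumn nu) v ->
  (forall K, (sumn nu <= K)%N -> exists g : {mpoly F[K.+1]},
     [/\ kap K.+1 v = g, symm_type q t (add_box q (rw mu) r) g &
     evt t g = box_ratio t (rw mu) r K * evt t (kap K.+1 H)]) -> good nu v.
Proof.
move=> [pmu Hn Htop Ht] pnu snu nuE vn gP.
have pnth (s : seq nat) i : is_partition s -> (nth 0 s i.+1 <= nth 0 s i)%N.
  move=> /andP[/(sortedP 0%N) ss _]; have [lt|ge] := ltnP i.+1 (size s); first exact: ss.
  by rewrite nth_default.
have rn : (r <= sumn mu)%N.
  rewrite -ltnS -snu; apply: leq_trans (partition_size pnu); rewrite ltnNge; apply/negP => sr.
  by have := nuE r; rewrite nth_default // eqxx addn1.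
have [C C0 CE] : exists2 C, C != 0 & forall K, (sumn mu < K)%N -> box_ratio t (rw mu) r K = C * (1 - t ^+ K.+1 / rw mu r).
  apply: (box_ratioE t_neq0 rn).
  - by move=> i; rewrite mulf_neq0 ?expf_neq0.
  - by move=> i j /monomial_inj[].
  - move=> i ni; rewrite /row_weight nth_default ?mul1r //.
    exact: leq_trans (partition_size pmu) (ltnW ni).
  (* An equality t y_i = y_r would mean that rows r - 1 and r of mu have the same length, so that a
     box in row r would not give a partition. *)
  - move=> i; apply/eqP => E.
    have [E1 E2] : nth 0%N mu i = nth 0%N mu r /\ i.+1 = r.
      by apply: monomial_inj; rewrite -[RHS]/(rw mu r) -E /row_weight exprS mulrCA.
    have := pnth nu i pnu; rewrite !nuE E2 eqxx E1; lia.
(* The evaluations in all large numbers of variables determine [Psi v], and the factor 1 - t^(K+1) /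
   y_r is 1 + X / y_r at X = - t^(K+1). The top coefficient thus stays nonzero. *)
have PE : Psi v = (C *: (1 + (rw mu r)^-1 *: 'X)) * Psi H.
  apply: (@poly_eq_at _ t t_neq0 t_nroot _ _ (sumn nu).+1) => -[//|K] nK.
  have [g [kg _ eg]] := gP K nK.
  rewrite -evt_kap kg eg CE -?snu // evt_kap hornerM hornerZ hornerD hornerC hornerZ hornerX.
  by rewrite mulrN [_^-1 * _]mulrC.
split=> // [|K nK].
  rewrite PE snu -scalerAl coefZ mulf_neq0 // mulrDl mul1r coefD -scalerAl coefZ coefXM /=.
  rewrite nth_default ?add0r ?(size_Psi char0 Hn) // mulf_neq0 // invr_eq0.
  by rewrite mulf_neq0 ?expf_neq0.
have [g [-> gt _]] := gP K nK.
suff -> : rw nu = add_box q (rw mu) r by [].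
apply: funext => i; rewrite /row_weight /add_box nuE; case: eqP => [->|_].
  by rewrite addn1 exprS mulrA.
by rewrite addn0.
Qed.

(** Two splittings of e_1 H are compared: the one into eigenvectors v_nu of [D0], which is
    independent of K, and for each K the one of [symm_varK], whose parts have the type of mu with a
    box added in row r. Projection to one eigenvalue and injectivity of the eigenvalues show that
    kap v_nu is the part for the row in which nu exceeds mu, or 0 if there is none. *)
Lemma good_sum_e1 n f : good_sum n f -> good_sum n.+1 (e_ 1 * f).
Proof.
move: f; apply: lspan_lin => [|H [mu smu gH]]; first exact: mul_lin.
have [pmu Hn _ Ht] := gH; rewrite smu in Hn Ht.
have Gn : graded n.+1 (e_ 1 * H).
  rewrite -add1n; apply: gradedM => //; rewrite elementary1; exact: graded_p.
have DL := D0_lin char0 q t.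
have uparts : uniq (parts n.+1) by rewrite sort_uniq partitions_uniq.
have injp : {in parts n.+1 &, injective ev}.
  by move=> x y; rewrite !mem_parts; apply: ev_inj_partitions.
have [v [GE vD vn]] := eigen_split (linD DL) (linZ DL) (@lspanD _ _) (@lspanZ _ _)
  (@D0_graded _ char0 q t qn n.+1) uparts injp Gn (kill_D0 char0 t qn Gn).
rewrite GE big_seq; apply: lspan_sum => nu nun.
have := nun; rewrite mem_parts mem_partitions => /andP[pnu /eqP snu].
pose c K r := t ^+ K.+1 + (1 - t) * \sum_(i < K.+1) add_box q (rw mu) r i.
have compare K : (n < K)%N -> exists g : nat -> {mpoly F[K.+1]},
   [/\ kap K.+1 (v nu) = \sum_(r < K.+1 | c K r == ev nu) g r,
    forall r, (r <= K)%N -> symm_type q t (add_box q (rw mu) r) (g r) &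
    forall r, (r <= K)%N -> evt t (g r) = box_ratio t (rw mu) r K * evt t (kap K.+1 H)].
  move=> nK; have Hs : kap K.+1 H \is symmetric by apply: kap_sym.
  have [||g [gE gt ge]] := symm_varK t_neq0 t_neq1 q_neq0 Hs (Ht K (ltnW nK)).
  - by move=> i _; rewrite mulf_neq0 ?expf_neq0.
  - by move=> i j _ _ /monomial_inj[].
  exists g; split=> //.
  pose S := map ev (parts n.+1) ++ [seq c K r | r <- iota 0 K.+1].
  have [Q [QD Q0 Q1 QS]] := eigen_proj (@DeltaD K) (@DeltaZ K) S (ev nu).
  have Qsum (I : Type) (s : seq I) (p : pred I) (E : I -> {mpoly F[K.+1]}) :
    Q (\sum_(i <- s | p i) E i) = \sum_(i <- s | p i) Q (E i) by apply: (big_morph Q QD Q0).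
  have QE : Q (kap K.+1 (e_ 1 * H)) = kap K.+1 (v nu).
    rewrite GE raddf_sum Qsum (bigD1_seq nu) //= Q1 ?big1_seq ?addr0 //.
      move=> ka /andP[kanu kan]; apply: (QS (ev ka)).
      - by rewrite mem_cat map_f.
      - by apply: contra kanu => /eqP/injp ->.
      - by rewrite Delta_kap vD // kapZ.
    by rewrite Delta_kap vD // kapZ.
  rewrite -QE kap_e1M gE Qsum [RHS]big_mkcond; apply: eq_bigr => r _.
  have rK : (r <= K)%N by rewrite -ltnS.
  have Dg : Delta (g r) = c K r *: g r.
    by rewrite /Delta (macdonald_op_type (gt _ rK)) -scalerDl.
  case: eqP => [E|/eqP ne]; first by rewrite Q1 // Dg E.
  apply: (QS (c K r)) => //; rewrite mem_cat; apply/orP; right.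
  by apply: map_f; rewrite mem_iota add0n.
have cE K r : (n < K)%N -> (r <= K)%N -> c K r = ev nu ->
    forall i, nth 0%N nu i = (nth 0%N mu i + (i == r))%N.
  move=> nK rK; have nuK : (size nu <= K.+1)%N.
    by apply: leq_trans (partition_size pnu) _; rewrite snu ltnW.
  have muK : (size mu <= K.+1)%N.
    by apply: leq_trans (partition_size pmu) _; rewrite smu -ltnS ltnW // ltnW.
  rewrite (D0_eigenvalueE q t nuK) => /addrI/mulfI E i.
  have [iK|Ki] := ltnP i K.+1; last by rewrite !nth_default ?(leq_trans _ Ki) //; lia.
  apply/esym; apply: (@row_sum_inj K.+1 (fun i => nth 0%N mu i + (i == r))%N) iK.
  rewrite -E ?subr_eq0 1?eq_sym //; apply: eq_bigr => j _; rewrite /add_box /row_weight.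
  by case: eqP => [->|_]; rewrite ?addn0 // addn1 exprS mulrA.
have Ec K r : (n < K)%N -> (forall i, nth 0%N nu i = (nth 0%N mu i + (i == r))%N) -> c K r = ev nu.
  move=> nK nuE; have nuK : (size nu <= K.+1)%N.
    by apply: leq_trans (partition_size pnu) _; rewrite snu ltnW.
  rewrite (D0_eigenvalueE q t nuK) /c; congr (_ + _ * _); apply: eq_bigr => j _.
  by rewrite nuE /add_box /row_weight; case: eqP => [->|_]; rewrite ?addn0 // addn1 exprS mulrA.
have [[r nuE]|no] := pselect (exists r, forall i, nth 0%N nu i = (nth 0%N mu i + (i == r))%N); last first.
  rewrite (_ : v nu = 0); first exact: lspan0.
  apply: (kap_inj (N0 := n.+2) t_nroot) => -[//|K] nK; rewrite rmorph0.
  have [g [-> _ _]] := compare K nK; rewrite big_pred0 // => r; apply/eqP => E.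
  by apply: no; exists (r : nat); apply: (cE _ _ nK _ E); rewrite -ltnS.
apply: lspan_gen; exists nu => //.
apply: (add_box_good gH pnu (etrans snu (congr1 S (esym smu))) nuE); first by rewrite snu; apply: vn.
rewrite snu => K nK; have [g [gE gt ge]] := compare K nK.
have rK : (r <= K)%N.
  rewrite leqNgt; apply/negP => Kr; have := nuE r; rewrite eqxx nth_default; last first.
    by apply: leq_trans (partition_size pnu) _; rewrite snu; lia.
  by rewrite addn1.
exists (g r); split; [|exact: gt|exact: ge].
have rK1 : (r < K.+1)%N by [].
rewrite gE (big_pred1 (Ordinal rK1)) // => s; apply/eqP/eqP => [E|->]; last exact: Ec.
apply: val_inj => /=; have sK : (s <= K)%N by rewrite -ltnS.
by have := cE _ _ nK sK E r; rewrite nuE eqxx; case: eqP => [->|_] //; lia.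
Qed.

Lemma good_sum_D0 n f : good_sum n f -> good_sum n (D0 f).
Proof.
move: f; apply: lspan_lin; first exact: D0_lin.
move=> H [mu smu gH]; rewrite (good_eigen gH); apply: lspanZ.
by apply: lspan_gen; exists mu.
Qed.

Lemma good_sum_D0_comm k n f : good_sum n f -> good_sum (n + k) (D0_comm char0 q t k f).
Proof.
elim: k n f => [|k IH] n f fn; first by rewrite addn0; apply: good_sum_D0.
rewrite /= addnS; apply: lspanB; last exact/good_sum_e1/IH.
by rewrite -addSn; apply/IH/good_sum_e1.
Qed.

Lemma good1 : good [::] 1.
Proof.
split=> //; [exact: graded1 | by rewrite rmorph1 coef1 oner_eq0 | move=> K _].
rewrite rmorph1; suff -> : rw [::] = fun i => t ^+ i by apply: symm_type1.
by apply: funext => i; rewrite /row_weight nth_nil mul1r.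
Qed.

Lemma good_sum_e n : good_sum n.+1 (e_ n.+1).
Proof.
have c0 : ((1 - t) * (q - 1)) ^+ n.+1 != 0.
  have q1 : q - 1 != 0 by rewrite -opprB oppr_eq0 -(expr1 q) (qn 0).
  by rewrite expf_neq0 // mulf_neq0 // subr_eq0 eq_sym.
rewrite -[e_ n.+1](scalerK c0) -(D0_comm1 char0 t_neq0 t_neq1 q_neq0 _ t_nroot).
apply: lspanZ; apply: (@good_sum_D0_comm n.+1 0 1).
by apply: lspan_gen; exists [::] => //; apply: good1.
Qed.

End MacdonaldFunctions.

(** * Nabla *)

Section Conjugate.
Variable mu : seq nat.
Hypothesis pmu : is_partition mu.

Lemma ltn_count_sorted s i j : sorted geq s -> (i < count (fun x => j < x) s)%N = (j < nth 0 s i)%N.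
Proof.
elim: s i => [|a s IH] i; first by rewrite nth_nil !ltn0.
rewrite sorted_geq_cons => /andP[/allP sa ss] /=; case: (ltnP j a) => ja.
  by case: i => [|i] /=; rewrite ?ja // add1n ltnS IH.
have -> : count (fun x => j < x)%N s = 0%N.
  apply/eqP; rewrite -leqn0 leqNgt -has_count; apply/hasPn => x xs; rewrite -leqNgt.
  exact: leq_trans (sa _ xs) ja.
case: i => [|i] /=; first by rewrite [RHS]ltnNge ja.
apply/esym/negbTE; rewrite -leqNgt; have [si|si] := ltnP i (size s); last by rewrite nth_default.
exact: leq_trans (sa _ (mem_nth _ si)) ja.
Qed.

Lemma nth_conj j : nth 0%N (conj_partition mu) j = count (fun x => j < x)%N mu.
Proof.
have [sm _] := andP pmu; have [jh|hj] := ltnP j (head 0%N mu); first by rewrite nth_mkseq.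
rewrite nth_default ?size_mkseq //; apply/esym/eqP; rewrite -leqn0 leqNgt ltn_count_sorted //.
by rewrite nth0 -leqNgt.
Qed.

Lemma big_conj (R : Type) (idx : R) (op : Monoid.com_law idx) (f : nat -> nat -> R) N M :
  (size mu <= N)%N -> (head 0%N mu <= M)%N ->
  \big[op/idx]_(i < N) \big[op/idx]_(j < nth 0%N mu i) f i j =
  \big[op/idx]_(j < M) \big[op/idx]_(i < nth 0%N (conj_partition mu) j) f i j.
Proof.
have [sm _] := andP pmu => sN hM.
have muM i : (nth 0%N mu i <= M)%N.
  apply: leq_trans hM; case: (mu) sm => [|a s]; first by rewrite nth_nil.
  rewrite sorted_geq_cons => /andP[/allP sa _]; case: i => //= i.
  by have [si|si] := ltnP i (size s); [apply/sa/mem_nth | rewrite nth_default].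
have conjN j : (nth 0%N (conj_partition mu) j <= N)%N.
  by rewrite nth_conj (leq_trans (count_size _ _)).
under eq_bigr do rewrite (big_ord_widen M (f _) (muM _)) big_mkcond.
rewrite exchange_big; apply: eq_bigr => j _.
rewrite (big_ord_widen N (f^~ j) (conjN j)) [RHS]big_mkcond; apply: eq_bigr => i _.
by rewrite nth_conj ltn_count_sorted.
Qed.

Lemma partition_nE s N : (size s <= N)%N -> partition_n s = (\sum_(i < N) i * nth 0%N s i)%N.
Proof.
move=> sN; rewrite /partition_n (big_ord_widen N (fun i => i * nth 0%N s i)%N) //.
rewrite big_mkcond; apply: eq_bigr => i _; case: ltnP => // si.
by rewrite nth_default ?muln0.
Qed.

Variables (F : fieldType) (q t : F).

Lemma cell_prod N : (size mu <= N)%N ->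
  \prod_(i < N) \prod_(j < nth 0%N mu i) (q ^+ j * t ^+ i) =
  t ^+ partition_n mu * q ^+ partition_n (conj_partition mu).
Proof.
move=> sN; under eq_bigr do rewrite big_split; rewrite big_split mulrC; congr (_ * _) => /=; last first.
  rewrite (partition_nE sN) expr_sum; apply: eq_bigr => i _.
  by rewrite prodr_const card_ord -exprM.
rewrite (@big_conj _ _ _ (fun i j => q ^+ j) N _ sN (leqnn _)).
rewrite (@partition_nE _ (head 0%N mu)) ?size_mkseq // expr_sum; apply: eq_bigr => j _.
by rewrite prodr_const card_ord -exprM.
Qed.

End Conjugate.

(** In the expression 1 - (1 - q)(1 - t) sum q^j t^i over cells, transposition exchanges i and j. *)
Lemma D0_eigenvalue_conj (F : fieldType) (q t : F) mu : is_partition mu ->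
  D0_eigenvalue q t mu = D0_eigenvalue t q (conj_partition mu).
Proof.
have E (a b : F) s N : (size s <= N)%N -> D0_eigenvalue a b s =
    1 - (1 - a) * (1 - b) * \sum_(i < N) \sum_(j < nth 0%N s i) a ^+ j * b ^+ i.
  move=> sN; rewrite (D0_eigenvalueE a b sN).
  have -> : (1 - a) * (1 - b) * \sum_(i < N) \sum_(j < nth 0%N s i) a ^+ j * b ^+ i =
      (1 - b) * \sum_(i < N) (b ^+ i - a ^+ nth 0%N s i * b ^+ i).
    rewrite [(1 - a) * _]mulrC -mulrA; congr (_ * _); rewrite mulr_sumr; apply: eq_bigr => i _.
    rewrite -mulr_suml mulrA -[X in _ = X - _]mul1r -mulrBl; congr (_ * _).
    by rewrite -opprB mulNr -subrX1 opprB.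
  have geo : (1 - b) * \sum_(i < N) b ^+ i = 1 - b ^+ N by rewrite -opprB mulNr -subrX1 opprB.
  by rewrite sumrB mulrBr geo; ring.
move=> pmu; rewrite (E _ _ _ _ (leqnn _)) (E _ _ _ (head 0%N mu)) ?size_mkseq //.
rewrite (@big_conj _ pmu _ _ _ (fun i j => q ^+ j * t ^+ i) _ _ (leqnn _) (leqnn _)).
congr (_ - _ * _); first exact: mulrC.
by apply: eq_bigr => j _; apply: eq_bigr => i _; apply: mulrC.
Qed.

Section EigenvectorSpan.
Variable F : fieldType.
Hypothesis char0 : forall n, n.+1%:R != 0 :> F.
Variables (q t : F).
Hypothesis t_neq1 : t != 1.
Hypothesis row_sum_inj : forall K (al be : nat -> nat),
  \sum_(i < K) q ^+ al i * t ^+ i = \sum_(i < K) q ^+ be i * t ^+ i ->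
  forall i, (i < K)%N -> al i = be i.

(** [D0_eigen_span] is applied to the partitions that dominate mu: the eigenvalue determines the row
    lengths, so no partition outside this set shares it. *)
Lemma D0_eigen_schur n mu (f : symfun F) : sumn mu = n -> graded n f ->
  D0 char0 q t f = D0_eigenvalue q t mu *: f ->
  in_schur_span (fun la => dominates la mu) (phi_q char0 q f).
Proof.
move=> smu fn fmu; apply: in_schur_spanP.
have : hs (fun la => la \in partitions n /\ `[< dominates la mu >]) (phi_q char0 q f).
  apply: (D0_eigen_span (U := fun la => `[< dominates la mu >]) _ _ fn fmu) => [nu la _ /asboolP lamu nula|la lan /asboolP H].
    by apply/asboolP; apply: dominates_trans (pgt_dominates nula) lamu.
  apply/eqP => E; apply: H.
  have nE : forall i, nth 0%N la i = nth 0%N mu i.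
    exact: (D0_eigenvalue_inj t_neq1 (@row_sum_inj) E).
  move: lan; rewrite mem_partitions => /andP[pla /eqP sla]; split=> //; first by rewrite sla smu.
  by move=> k; rewrite -/(psum k mu) -/(psum k la) !psum_nth; apply: leq_sum => i _; rewrite nE.
apply: lspan_sub => _ [la [lan /asboolP lamu] ->].
by apply: ss_sub (hprod_schur F lan) => nu nula; apply: dominates_trans nula lamu.
Qed.

End EigenvectorSpan.

(** * Identification with Macdonald polynomials and comparison at - t^N *)

Section Main.
Variable F : fieldType.
Hypothesis char0 : forall n, n.+1%:R != 0 :> F.
Variables (q t : F).
Hypotheses (t_neq0 : t != 0) (q_neq0 : q != 0).
Hypothesis monomial_inj : forall a b c d, q ^+ a * t ^+ b = q ^+ c * t ^+ d -> a = c /\ b = d.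
Hypothesis row_sum_inj : forall K (al be : nat -> nat),
  \sum_(i < K) q ^+ al i * t ^+ i = \sum_(i < K) q ^+ be i * t ^+ i ->
  forall i, (i < K)%N -> al i = be i.
Hypothesis col_sum_inj : forall K (al be : nat -> nat),
  \sum_(i < K) t ^+ al i * q ^+ i = \sum_(i < K) t ^+ be i * q ^+ i ->
  forall i, (i < K)%N -> al i = be i.
Local Notation Lam := (symfun F).
Local Notation e_ := (elementary F).
Local Notation Psi := (Psi char0).

Lemma D0_swap : D0 char0 q t = D0 char0 t q.
Proof. by rewrite /D0; congr D0_gen; apply: funext => k; rewrite /D0_coef mulrC. Qed.

Let t_nroot k : t ^+ k.+1 != 1.
Proof. by apply/eqP => E; have [] := @monomial_inj 0 k.+1 0 0; rewrite ?E. Qed.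
Let t_neq1 : t != 1. Proof. exact: (t_nroot 0). Qed.
Let qn k : 1 - q ^+ k.+1 != 0.
Proof.
by rewrite subr_eq0; apply/eqP => E; have [] := @monomial_inj 0 0 k.+1 0; rewrite ?expr0 ?mulr1 ?E.
Qed.
Let q_neq1 : q != 1. Proof. by rewrite eq_sym -subr_eq0 -[q]expr1 (qn 0). Qed.

Lemma diag_plethysm u : is_plethysm_one_minus u (diag char0 (fun k => 1 - u ^+ k.+1)).
Proof. by move=> k; apply: diag_p. Qed.

(** The condition on X (1 - t) is the one on X (1 - q) for exchanged parameters and the conjugate
    partition, because [D0] is symmetric in q and t. *)
Lemma good_macdonald mu H : good char0 q t mu H ->
  is_modified_macdonald q t mu (((Psi H)`_(sumn mu))^-1 *: H).
Proof.
move=> gH; have [pmu Hn Htop _] := gH; set c := (Psi H)`_(sumn mu) in Htop *.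
have H'n : graded (sumn mu) (c^-1 *: H) by apply: lspanZ.
have D0H : D0 char0 q t (c^-1 *: H) = D0_eigenvalue q t mu *: (c^-1 *: H).
  rewrite (linZ (D0_lin char0 q t)) (good_eigen t_neq0 q_neq0 monomial_inj gH).
  by rewrite !scalerA mulrC.
split.
- by exists (diag char0 (fun k => 1 - q ^+ k.+1));
    [exact: diag_plethysm | exact: (D0_eigen_schur t_neq1 (@row_sum_inj) erefl H'n D0H)].
- exists (diag char0 (fun k => 1 - t ^+ k.+1)); first exact: diag_plethysm.
  have sc : sumn (conj_partition mu) = sumn mu.
    have E := @big_conj mu pmu _ _ addn (fun _ _ => 1%N) _ _ (leqnn _) (leqnn _).
    have psumE s N : (size s <= N)%N -> (\sum_(i < N) \sum_(j < nth 0%N s i) 1)%N = sumn s.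
      move=> sN; rewrite -(psum_oversize sN) psum_nth; apply: eq_bigr => i _.
      by rewrite sum1_card card_ord.
    by move: E; rewrite !psumE ?size_mkseq.
  rewrite D0_swap (D0_eigenvalue_conj _ _ pmu) in D0H.
  exact: (D0_eigen_schur q_neq1 (@col_sum_inj) sc H'n D0H).
- by rewrite -(Psi_top char0 H'n) (homZ (Psi_hom char0)) mul_polyC coefZ -/c mulVf.
Qed.

Theorem g_hall m n (g : seq nat -> {poly F}) (nabla : {linear Lam -> Lam}) (hall : {biscalar Lam}) :
  (0 < m)%N -> g_recursion q t m g -> is_nabla q t nabla -> is_hall hall ->
  (g (rcons (nseq n m) m.-1)).[0] = hall (iter m nabla (e_ n.+1)) (e_ n.+1).
Proof.
move=> m0 gP nablaP hallP.
pose gau K := gauss q t (K := K).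
have gauD K k f h : iter k (gau K) (f + h) = iter k (gau K) f + iter k (gau K) h.
  elim: k => //= k ->; exact: (linD (gauss_lin t_neq0 q_neq0 qn (K := K))).
have gauZ K k c f : iter k (gau K) (c *: f) = c *: iter k (gau K) f.
  elim: k => //= k ->; exact: (linZ (gauss_lin t_neq0 q_neq0 qn (K := K))).
have nabD k f h : iter k nabla (f + h) = iter k nabla f + iter k nabla h.
  by elim: k => //= k ->; rewrite raddfD.
have nabZ k c f : iter k nabla (c *: f) = c *: iter k nabla f.
  by elim: k => //= k ->; rewrite linearZ.
(* P is built along the decomposition of e_(n+1) into eigenvectors H, each contributing a multiple
   of [Psi H]: the m-fold Gaussian operator and the m-fold nabla have the same eigenvalue on it. *)
have [P [PK P0]] : exists P : {poly F},
    (forall K, (n < K)%N -> evt t (iter m (gau K) (kap char0 t K.+1 (e_ n.+1))) = P.[- t ^+ K.+1]) /\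
    P.[0] = hall (iter m nabla (e_ n.+1)) (e_ n.+1).
  (* Only the function acted upon is generalized; the second argument of the pairing stays
     e_(n+1). *)
  move: {1 2 3}(e_ n.+1) (good_sum_e char0 t_neq0 q_neq0 monomial_inj row_sum_inj n) => f.
  elim=> [|c H f' [mu smu gH] _ [P [PK P0]]].
    exists 0; split=> [K nK|].
      have -> : kap char0 t K.+1 0 = 0 *: 1 by rewrite rmorph0 scale0r.
      by rewrite gauZ evtZ mul0r horner0.
    have -> : iter m nabla 0 = 0 by elim: (m) => //= k ->; rewrite raddf0.
    by rewrite linear0l horner0.
  have [pmu Hn Htop Ht] := gH; rewrite smu in Hn Htop Ht.
  pose T := t ^+ partition_n mu * q ^+ partition_n (conj_partition mu).
  have gauH K k : (n < K)%N -> iter k (gau K) (kap char0 t K.+1 H) = T ^+ k *: kap char0 t K.+1 H.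
    move=> nK; have muK : (size mu <= K.+1)%N.
      by apply: leq_trans (partition_size pmu) _; rewrite smu ltnW // ltnW.
    elim: k => [|k IH]; first by rewrite scale1r.
    rewrite iterS IH /gau (linZ (gauss_lin t_neq0 q_neq0 qn (K := K))).
    rewrite (gauss_type t_neq0 q_neq0 qn (Ht K nK)) ?(cell_prod pmu _ _ muK) ?scalerA -?exprSr //.
    by rewrite -(psum_nth K.+1 mu) psum_oversize // smu; apply: kap_homog.
  have nabH k : iter k nabla H = T ^+ k *: H.
    have nH : nabla H = T *: H.
      have := nablaP _ _ pmu (good_macdonald gH); rewrite smu linearZ /= scalerA mulrC -scalerA.
      by move/(scalerI (_ : _^-1 != 0)); apply; rewrite invr_eq0.
    elim: k => [|k IH]; first by rewrite scale1r.
    by rewrite iterS IH linearZ /= nH scalerA -exprSr.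
  exists ((c * T ^+ m) *: Psi H + P); split=> [K nK|].
    rewrite rmorphD /= kapZ gauD gauZ gauH // evtD !evtZ PK // evt_kap.
    by rewrite hornerD hornerZ mulrA.
  rewrite nabD nabZ nabH linearDl hornerD P0 hornerZ scalerA linearZl_LR /=.
  by rewrite -(hall_elementary char0 hallP Hn).
rewrite -P0; congr _.[0]; apply: (poly_eq_at t_neq0 t_nroot (k0 := n.+2)) => -[//|K] nK.
have {}nK : (n < K)%N := nK.
rewrite -PK // (gauss_start t_neq0 t_neq1 q_neq0 qn m0 gP nK).
by rewrite (symm_varX char0 t_neq0 t_neq1 q_neq0).
Qed.

End Main.

(** * Independence of the monomials in q and t *)

Section GenericParameters.
Local Notation M := {mpoly rat[2]}.

Lemma Qqt_char0 n : n.+1%:R != 0 :> Qqt.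
Proof.
rewrite -[n.+1%:R](rmorph_nat (@tofrac M)) -tofrac0 tofrac_eq.
by rewrite -[n.+1%:R](rmorph_nat (@mpolyC 2 rat)) mpolyC_eq0 Num.Theory.pnatr_eq0.
Qed.

Let mon (a b : nat) : 'X_{1..2} := (U_(ord0) *+ a + U_(ord_max) *+ b)%MM.

Let mon_inj a b c d : mon a b = mon c d -> a = c /\ b = d.
Proof.
move=> /mnmP E; have := E ord0; have := E ord_max.
by rewrite /mon !mnmDE !mulmnE !mnm1E /= !(mul0n, mul1n, muln0, muln1, add0n, addn0) => -> ->.
Qed.

Let monE a b : qvar ^+ a * tvar ^+ b = tofrac ('X_[mon a b] : M).
Proof. by rewrite mpolyXD -!mpolyXn rmorphM !rmorphXn. Qed.

(** The monomial m1 i has coefficient 1 on the left, as m1 is injective, so it must occur on the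
    right. *)
Let mon_sum K (m1 m2 : nat -> 'X_{1..2}) :
  \sum_(i < K) (tofrac ('X_[m1 i] : M) : Qqt) = \sum_(i < K) (tofrac ('X_[m2 i] : M) : Qqt) ->
  (forall i j, m1 i = m1 j -> i = j) ->
  forall i, (i < K)%N -> exists j, m2 j = m1 i.
Proof.
rewrite -!rmorph_sum /= => /eqP; rewrite tofrac_eq => /eqP/(congr1 (mcoeff _)) E inj1 i iK.
have [[j jE]|no] := pselect (exists j, m2 j = m1 i); first by exists j.
have /eqP := E (m1 i); rewrite !raddf_sum /=.
rewrite [X in _ == X]big1 => [|j _]; last by rewrite mcoeffX; case: eqP => // jE; case: no; exists j.
rewrite (bigD1 (Ordinal iK)) //= mcoeffX eqxx big1 ?addr0 ?oner_eq0 // => j ji.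
by rewrite mcoeffX; case: eqP => // /inj1 E1; case/eqP: ji; apply: val_inj.
Qed.

Lemma qt_monomial_inj a b c d :
  qvar ^+ a * tvar ^+ b = qvar ^+ c * tvar ^+ d -> a = c /\ b = d.
Proof.
rewrite !monE => /eqP; rewrite tofrac_eq => /eqP/(congr1 (mcoeff (mon a b))) /eqP.
rewrite !mcoeffX eqxx; case: (mon c d =P mon a b) => [/mon_inj[-> ->] //|_].
by rewrite oner_eq0.
Qed.

Lemma qt_row_sum_inj K (al be : nat -> nat) :
  \sum_(i < K) qvar ^+ al i * tvar ^+ i = \sum_(i < K) qvar ^+ be i * tvar ^+ i ->
  forall i, (i < K)%N -> al i = be i.
Proof.
under eq_bigr do rewrite monE; under [X in _ = X -> _]eq_bigr do rewrite monE.
move=> E i iK.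
have [k l /mon_inj[] //|j /mon_inj[E1 E2]] := @mon_sum K (fun i => mon (al i) i) (fun i => mon (be i) i) E _ i iK.
by rewrite -E1 E2.
Qed.

Lemma qt_col_sum_inj K (al be : nat -> nat) :
  \sum_(i < K) tvar ^+ al i * qvar ^+ i = \sum_(i < K) tvar ^+ be i * qvar ^+ i ->
  forall i, (i < K)%N -> al i = be i.
Proof.
under eq_bigr do rewrite mulrC monE; under [X in _ = X -> _]eq_bigr do rewrite mulrC monE.
move=> E i iK.
have [k l /mon_inj[] //|j /mon_inj[E1 E2]] := @mon_sum K (fun i => mon i (al i)) (fun i => mon i (be i)) E _ i iK.
by rewrite -E2 E1.
Qed.

End GenericParameters.

Theorem corollary1p11 (m n : nat) (m_gt0 : (0 < m)%N) (n_gt0 : (0 < n)%N)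
    (g : seq nat -> {poly Qqt}) (g_rec : g_recursion qvar tvar m g)
    (nabla : {linear symfun Qqt -> symfun Qqt})
    (nablaP : is_nabla qvar tvar nabla)
    (hall : {biscalar symfun Qqt}) (hallP : is_hall hall) :
  (g (rcons (nseq n.-1 m) m.-1)).[0] =
    hall (iter m nabla (elementary Qqt n)) (elementary Qqt n).
Proof.
rewrite -{2 3}(prednK n_gt0).
apply: (g_hall Qqt_char0 _ _ (@qt_monomial_inj) (@qt_row_sum_inj) (@qt_col_sum_inj) n.-1 m_gt0 g_rec nablaP hallP).
  (* If t were 0, its first two powers would coincide, against the independence of monomials; the
     same argument serves for q. *)
  apply/eqP => E; have := @qt_monomial_inj 0 1 0 2.
  by rewrite E !expr0n /= !mulr0 => /(_ erefl) [].
apply/eqP => E; have := @qt_monomial_inj 1 0 2 0.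
by rewrite E !expr0n /= !mul0r => /(_ erefl) [].
Qed.
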